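(* For every non-decreasing function $\delta\colon(0,1)\to(0,1)$ there exist an analytic map $\phi\colon\mathbb{D}\to\mathbb{D}$ which is two-valent and satisfies $\phi(\mathbb{D})=\mathbb{D}\setminus\{0\}$, and a number $0<h_0<1$, such that $$m\big(\{z\in\mathbb{T}\,;\ |\phi^*(z)|\ge 1-h\}\big)\le \delta(h)\qquad\text{for all }0<h\le h_0 .$$ As a consequence, there exists a surjective and four-valent analytic map $\psi\colon\mathbb{D}\to\mathbb{D}$ such that the composition operator $C_\psi\colon H^2\to H^2$ belongs to every Schatten class $S_p(H^2)$, $p>0$.
   Context: $\mathbb{D}$ is the open unit disk, $\mathbb{T}=\partial\mathbb{D}$, $m$ the normalized Lebesgue (Haar) measure on $\mathbb{T}$, $H^2$ the Hardy space of $\mathbb{D}$. For an analytic self-map $\varphi$ of $\mathbb{D}$ (a ''symbol''), $\varphi^*(\xi)=\lim_{r\to1^-}\varphi(r\xi)$ is its radial limit function (defined $m$-a.e.), and $C_\varphi f=f\circ\varphi$ is the composition operator. A map is $p$-valent if every $w$ has at most $p$ preimages. The $n$-th approximation number of an operator $T$ between Hilbert spaces is $a_n(T)=\inf\{\|T-R\|:\operatorname{rank}R<n\}$, and $T\in S_p$ means $(a_n(T))_n\in\ell^p$. *)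

(* Defs.v *)
From HB Require Import structures.
From mathcomp Require Import all_boot all_order all_algebra.
From mathcomp Require Import all_classical all_reals all_analysis.
From mathcomp Require Import complex.
Import Order.TTheory GRing.Theory Num.Theory numFieldNormedType.Exports.

Set Implicit Arguments.
Unset Strict Implicit.
Unset Printing Implicit Defensive.

Local Open Scope ring_scope.
Local Open Scope classical_set_scope.

Section Defs.
Variable R : realType.
Local Notation C := R[i].

Definition cnorm (z : C) : R := ComplexField.Normc.normc z.

Definition disk : set C := [set z | cnorm z < 1].

Definition circ (t : R) : C := Complex (cos (2 * pi * t)) (sin (2 * pi * t)).

Definition holomorphic_on (f : C -> C) (A : set C) : Prop :=
  forall z, A z -> exists l : C, forall e : R, 0 < e -> exists d : R, 0 < d /\
    forall h : C, h != 0 -> cnorm h < d -> cnorm ((f (z + h) - f z) / h - l) < e.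

Definition analytic_selfmap (f : C -> C) : Prop :=
  holomorphic_on f disk /\ (forall z, disk z -> disk (f z)).

Definition pvalent (p : nat) (f : C -> C) : Prop :=
  forall (w : C) (s : seq C), uniq s ->
    (forall z, z \in s -> disk z /\ f z = w) -> (size s <= p)%N.

Definition radial_limit (f : C -> C) (xi L : C) : Prop :=
  forall e : R, 0 < e -> exists d : R, 0 < d /\
    forall r : R, 1 - d < r -> r < 1 -> cnorm (f (Complex r 0 * xi) - L) < e.

Definition circle_measure (A : set C) : \bar R :=
  (@lebesgue_measure R) (`[0%R, 1%R[ `&` (circ @^-1` A)).

Definition mean2 (f : C -> C) (r : R) : \bar R :=
  (\int[@lebesgue_measure R]_(t in `[0%R, 1%R[) ((cnorm (f (Complex r 0 * circ t))) ^+ 2)%:E)%E.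

Definition h2norm2 (f : C -> C) : \bar R :=
  ereal_sup [set mean2 f r | r in `[0%R, 1%R[].

Definition h2norm (f : C -> C) : \bar R := sqrte (h2norm2 f).

Definition H2 (f : C -> C) : Prop :=
  holomorphic_on f disk /\ (h2norm2 f < +oo)%E.

(* (possibly nonlinear) maps acting on functions; operators on H^2 are
   those maps restricted to H^2, functions being compared on D only *)
Definition opT := (C -> C) -> (C -> C).

Definition linear_on_H2 (T : opT) : Prop :=
  (forall f, H2 f -> H2 (T f)) /\
  forall (f g : C -> C) (a b : C), H2 f -> H2 g ->
    forall z, disk z -> T (fun w => a * f w + b * g w) z = a * T f z + b * T g z.

Definition rank_lt (T : opT) (n : nat) : Prop :=
  exists (k : nat) (g : 'I_k -> C -> C), (k < n)%N /\ (forall i, H2 (g i)) /\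
    forall f, H2 f -> exists c : 'I_k -> C,
      forall z, disk z -> T f z = \sum_(i < k) c i * g i z.

Definition opnorm_diff (T S : opT) : \bar R :=
  ereal_sup [set h2norm (fun z => T f z - S f z) |
             f in [set f | H2 f /\ (h2norm f <= 1)%E]].

Definition approx_number (T : opT) (n : nat) : \bar R :=
  ereal_inf [set opnorm_diff T S | S in [set S | linear_on_H2 S /\ rank_lt S n]].

Definition schatten (p : R) (T : opT) : Prop :=
  (\sum_(1 <= n <oo) ((approx_number T n) `^ p) < +oo)%E.

Definition comp_op (psi : C -> C) : opT := fun f => f \o psi.

End Defs.

(* Main.v *)
(* Let S be the strip |Im z| < pi/2, image of the disk under log((1+z)/(1-z)). Take
   u(w) = sum_k b_k / (X_k + w) with X_k growing as fast as we please, U(z) = u(log(1 + e^z)),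
   and let f be a primitive on S of i c U - U^2, normalised by inf Re f = 0 on the real axis.
   As 1/u is Lipschitz with a tiny constant, f' is nearly constant across S: Re f decreases
   to the right and upwards, Im f increases to the right and downwards. Hence a level curve
   of Re f crosses S once, Im f is monotone along it, and it varies by nearly c^2 pi, which
   for c = 7/4 lies between 2 pi and 4 pi. So exp(-f) is at most 2-to-1 on S and maps it onto
   the punctured disk. Moreover Re f is small only far to the right in S, that is, near a
   single boundary point of the disk, at a distance governed by the X_k: this gives phi.

   For the second part let psi be the square of a Moebius map composed with such a phi, where
   1 - |psi| <= h only on arcs so short that all negative powers of 1 - |psi| are integrable,
   uniformly over the circles |z| = r. By Cauchy's formula, replacing f by its Taylor polynomial
   of degree n - 2 in the composition with psi costs at most a constant times
   (1 - (1 - |psi|)/2)^(n - 1) / (1 - |psi|), so that the n-th approximation number of C_psi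
   is O(n^-N) for every N. *)

Require Import Defs.
From HB Require Import structures.
From mathcomp Require Import all_boot all_order all_algebra.
From mathcomp Require Import all_classical all_reals all_analysis.
From mathcomp Require Import measurable_realfun complex ring lra zify.
Import Order.TTheory GRing.Theory Num.Theory numFieldNormedType.Exports.
Import ComplexField.Normc.

Set Implicit Arguments.
Unset Strict Implicit.
Unset Printing Implicit Defensive.

Local Open Scope ring_scope.
Local Open Scope classical_set_scope.

(** The natural length scale is 1 / u: as 1 / u is Lipschitz with constant k, u changes at most by a
    factor 1 + k N over a length N / u. Where u is nearly constant, f' is close to - u^2 + i c u.
    Crossing the strip downwards, over a height pi, raises Re f by c u pi; to stay on a level curve
    one has to move right by c pi / u, and this move raises Im f by c u (c pi / u) = c^2 pi. The
    gain is independent of u, so all level curves behave alike, however fast the X_k grow. The two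
    orders u and u^2 have distinct tasks: the integral of u^2 to the right converges, which gives Re
    f a finite infimum there, yet its tails can be made as slow as desired. To the left, log(1 +
    e^z) keeps u bounded away from 0, so Re f is unbounded there and every level occurs.

    The bounds on phi are proved at each point r e^(2 pi i t), uniformly in r and in terms of min(t,
    1 - t) only. So they serve both for radial limits and for H^2 norms, which are suprema of
    circular means. *)

Section ComplexNorm.
Variable R : realType.
Local Notation C := R[i].
Implicit Types z w : C.

Lemma cnormM z w : cnorm (z * w) = cnorm z * cnorm w.
Proof. exact: normcM. Qed.

Lemma cnormV z : cnorm z^-1 = (cnorm z)^-1.
Proof. exact: normcV. Qed.

Lemma cnormD z w : cnorm (z + w) <= cnorm z + cnorm w.
Proof. exact: le_normcD. Qed.

Lemma cnormN z : cnorm (- z) = cnorm z.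
Proof. exact: normcN. Qed.

Lemma cnormB z w : cnorm (z - w) = cnorm (w - z).
Proof. by rewrite -cnormN opprB. Qed.

Lemma cnorm0 : cnorm (0 : C) = 0.
Proof. exact: normc0. Qed.

Lemma cnorm1 : cnorm (1 : C) = 1.
Proof. exact: normc1. Qed.

Lemma cnorm_sqr z : cnorm z ^+ 2 = complex.Re z ^+ 2 + complex.Im z ^+ 2.
Proof.
by case: z => a b; rewrite /cnorm /= sqr_sqrtr// addr_ge0// sqr_ge0.
Qed.

Lemma cnorm_ge0 z : 0 <= cnorm z.
Proof. by case: z => a b; exact: sqrtr_ge0. Qed.

Lemma cnorm_eq0 z : (cnorm z == 0) = (z == 0).
Proof.
by apply/eqP/eqP => [/eq0_normc//|->]; rewrite cnorm0.
Qed.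

Lemma cnorm_gt0 z : (0 < cnorm z) = (z != 0).
Proof. by rewrite lt_def cnorm_ge0 andbT cnorm_eq0. Qed.

Lemma cnormX z n : cnorm (z ^+ n) = cnorm z ^+ n.
Proof.
elim: n => [|n IH]; first by rewrite !expr0 cnorm1.
by rewrite !exprS cnormM IH.
Qed.

Lemma cnorm_real (r : R) : cnorm (Complex r 0) = `|r|.
Proof. by rewrite /cnorm /= expr0n addr0 sqrtr_sqr. Qed.

Lemma cnorm_imag (r : R) : cnorm (Complex 0 r) = `|r|.
Proof. by rewrite /cnorm /= expr0n add0r sqrtr_sqr. Qed.

Lemma cnorm_Re z : `|complex.Re z| <= cnorm z.
Proof.
rewrite -ler_sqr ?nnegrE ?cnorm_ge0// cnorm_sqr real_normK ?num_real//.
by rewrite lerDl sqr_ge0.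
Qed.

Lemma cnorm_Im z : `|complex.Im z| <= cnorm z.
Proof.
rewrite -ler_sqr ?nnegrE ?cnorm_ge0// cnorm_sqr real_normK ?num_real//.
by rewrite lerDr sqr_ge0.
Qed.

Lemma complex_split (x y : R) : Complex x y = Complex x 0 + Complex 0 y.
Proof. by congr Complex; rewrite /= ?addr0 ?add0r. Qed.

Lemma cnorm_leD z : cnorm z <= `|complex.Re z| + `|complex.Im z|.
Proof.
case: z => x y; rewrite complex_split (le_trans (cnormD _ _))//.
by rewrite cnorm_real cnorm_imag /= addr0 add0r.
Qed.

Lemma cnorm_sub z w : cnorm z - cnorm w <= cnorm (z - w).
Proof. by rewrite lerBlDr -{1}(subrK w z) cnormD. Qed.

Lemma cReD z w : complex.Re (z + w) = complex.Re z + complex.Re w.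
Proof. by case: z; case: w. Qed.

Lemma cImD z w : complex.Im (z + w) = complex.Im z + complex.Im w.
Proof. by case: z; case: w. Qed.

Lemma cReN z : complex.Re (- z) = - complex.Re z.
Proof. by case: z. Qed.

Lemma cImN z : complex.Im (- z) = - complex.Im z.
Proof. by case: z. Qed.

Lemma cReM z w : complex.Re (z * w) =
  complex.Re z * complex.Re w - complex.Im z * complex.Im w.
Proof. by case: z; case: w. Qed.

Lemma cImM z w : complex.Im (z * w) =
  complex.Re z * complex.Im w + complex.Im z * complex.Re w.
Proof. by case: z; case: w. Qed.

Lemma complex_eq z w : complex.Re z = complex.Re w ->
  complex.Im z = complex.Im w -> z = w.
Proof. by case: z; case: w => a b c d /= -> ->. Qed.

Lemma Complex_mul (a b c d : R) :
  Complex a b * Complex c d = Complex (a * c - b * d) (a * d + b * c).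
Proof. by []. Qed.

Lemma Complex_add (a b c d : R) :
  Complex a b + Complex c d = Complex (a + c) (b + d).
Proof. by []. Qed.

Lemma Complex_opp (a b : R) : - Complex a b = Complex (- a) (- b).
Proof. by []. Qed.

End ComplexNorm.

#[global] Arguments cnorm : simpl never.

(** * Complex differentiability *)

Section Diff.
Variable R : realType.
Local Notation C := R[i].
Implicit Types (z l : C) (f g : C -> C).

(** Remainder form of the derivative: without a quotient and with h = 0 allowed, so that estimates
    carry no side condition. [cdiffE] translates it to the quotient of [holomorphic_on]. *)
Definition cdiff f z l := forall e : R, 0 < e -> exists2 d : R, 0 < d &
  forall h, cnorm h < d -> cnorm (f (z + h) - f z - l * h) <= e * cnorm h.

Definition ccont f z := forall e : R, 0 < e -> exists2 d : R, 0 < d &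
  forall h, cnorm h < d -> cnorm (f (z + h) - f z) < e.

Lemma cdiffE f z l : cdiff f z l <->
  forall e : R, 0 < e -> exists d : R, 0 < d /\
    forall h : C, h != 0 -> cnorm h < d -> cnorm ((f (z + h) - f z) / h - l) < e.
Proof.
split=> H e e0.
  have [d d0 Hd] := H (e / 2) ltac:(lra).
  exists d; split=> // h h0 hd.
  have -> : (f (z + h) - f z) / h - l = (f (z + h) - f z - l * h) / h.
    by rewrite [RHS]mulrBl mulfK.
  rewrite cnormM cnormV ltr_pdivrMr ?cnorm_gt0//.
  apply: le_lt_trans (Hd _ hd) _.
  by rewrite ltr_pM2r ?cnorm_gt0//; lra.
have [d [d0 Hd]] := H e e0; exists d => // h hd.
have [->|h0] := eqVneq h 0.
  by rewrite addr0 subrr mulr0 subr0 cnorm0 mulr0.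
have -> : f (z + h) - f z - l * h = ((f (z + h) - f z) / h - l) * h.
  by rewrite [RHS]mulrBl divfK.
by rewrite cnormM ler_wpM2r ?cnorm_ge0// ltW// Hd.
Qed.

Lemma holomorphic_onP f (A : set C) :
  holomorphic_on f A <-> forall z, A z -> exists l, cdiff f z l.
Proof.
by split=> H z /H[l /cdiffE Hl]; exists l.
Qed.

Lemma cdiff_cont f z l : cdiff f z l -> ccont f z.
Proof.
move=> H e e0; have [d d0 Hd] := H 1 ltr01.
have k0 : 0 < 1 + cnorm l by rewrite ltr_wpDr ?cnorm_ge0.
exists (Num.min d (e / (1 + cnorm l))); first by rewrite lt_min d0 divr_gt0.
move=> h; rewrite lt_min ltr_pdivlMr// => /andP[/Hd hd he].
rewrite -(subrK (l * h) (f (z + h) - f z)).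
apply: le_lt_trans (cnormD _ _) _; apply: le_lt_trans he.
by rewrite cnormM mulrDr mulr1 (mulrC (cnorm l)) lerD2r -[leRHS]mul1r.
Qed.

Lemma cdiff_cst (a : C) z : cdiff (fun=> a) z 0.
Proof.
by move=> e e0; exists 1 => // h _; rewrite subrr mul0r subr0 cnorm0 mulr_ge0 ?cnorm_ge0 ?ltW.
Qed.

Lemma cdiff_id z : cdiff id z 1.
Proof.
move=> e e0; exists 1 => // h _.
have -> : id (z + h) - id z - 1 * h = 0 by rewrite /=; ring.
by rewrite cnorm0 mulr_ge0 ?cnorm_ge0 ?ltW.
Qed.

Lemma cdiff_eq f z l l' : cdiff f z l -> l = l' -> cdiff f z l'.
Proof. by move=> + <-. Qed.

Lemma cdiff_local f g z l (d : R) : 0 < d -> (forall h, cnorm h < d -> f (z + h) = g (z + h)) ->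
  cdiff f z l -> cdiff g z l.
Proof.
move=> d0 fg H e e0; have [d1 d10 H1] := H e e0.
exists (Num.min d d1); first by rewrite lt_min d0.
move=> h; rewrite lt_min => /andP[hd hd1].
have gz : g z = f z by have := fg 0; rewrite cnorm0 addr0 => ->.
by rewrite gz -fg// H1.
Qed.

Lemma cdiffD f g z l m : cdiff f z l -> cdiff g z m ->
  cdiff (fun w => f w + g w) z (l + m).
Proof.
move=> H K e e0; have e20 : 0 < e / 2 by rewrite divr_gt0.
have [d d0 Hd] := H _ e20; have [d' d'0 Kd] := K _ e20.
exists (Num.min d d'); first by rewrite lt_min d0.
move=> h; rewrite lt_min => /andP[/Hd h1 /Kd h2].
have -> : f (z + h) + g (z + h) - (f z + g z) - (l + m) * h =
  (f (z + h) - f z - l * h) + (g (z + h) - g z - m * h) by ring.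
apply: le_trans (cnormD _ _) _; apply: le_trans (lerD h1 h2) _.
by rewrite -mulrDl -splitr.
Qed.

(* Caratheodory form of differentiability: composition and products become
   statements about continuous slopes *)
Lemma cdiff_slope f z l : cdiff f z l <-> exists k : C -> C,
  [/\ k 0 = l, (forall h, f (z + h) - f z = k h * h) & ccont k 0].
Proof.
split=> [H|[k [k0 kE kc]] e e0].
  exists (fun h => if h == 0 then l else (f (z + h) - f z) / h); split.
  - by rewrite eqxx.
  - move=> h; case: eqVneq => [->|h0]; last by rewrite divfK.
    by rewrite addr0 subrr mulr0.
  - move=> e e0; have /cdiffE/(_ e e0)[d [d0 Hd]] := H.
    exists d => // h hd; rewrite add0r eqxx; case: eqVneq => [_|h0].
      by rewrite subrr cnorm0.
    exact: Hd.
have [d d0 Hd] := kc _ e0; exists d => // h /Hd.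
rewrite add0r k0 kE -mulrBl cnormM => /ltW hd.
by rewrite ler_wpM2r ?cnorm_ge0.
Qed.

Lemma ccont_cst (a : C) z : ccont (fun=> a) z.
Proof. exact: cdiff_cont (cdiff_cst a z). Qed.

Lemma ccontD f g z : ccont f z -> ccont g z -> ccont (fun w => f w + g w) z.
Proof.
move=> H K e e0; have e20 : 0 < e / 2 by rewrite divr_gt0.
have [d d0 Hd] := H _ e20; have [d' d'0 Kd] := K _ e20.
exists (Num.min d d'); first by rewrite lt_min d0.
move=> h; rewrite lt_min => /andP[/Hd h1 /Kd h2].
rewrite opprD addrACA; apply: le_lt_trans (cnormD _ _) _.
by rewrite (splitr e) ltrD.
Qed.

Lemma ccontM f g z : ccont f z -> ccont g z -> ccont (fun w => f w * g w) z.
Proof.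
move=> H K e e0.
pose A := 1 + cnorm (f z) + cnorm (g z).
have A0 : 0 < A by rewrite /A -addrA ltr_wpDr// addr_ge0 ?cnorm_ge0.
pose e1 := Num.min 1 (e / (2 * A)).
have e10 : 0 < e1 by rewrite lt_min ltr01 divr_gt0// mulr_gt0.
have [d d0 Hd] := H _ e10; have [d' d'0 Kd] := K _ e10.
exists (Num.min d d'); first by rewrite lt_min d0.
move=> h; rewrite lt_min => /andP[/Hd h1 /Kd h2].
have e1A : e1 * (2 * A) <= e by rewrite -ler_pdivlMr ?mulr_gt0// ge_min lexx orbT.
have e11 : e1 <= 1 by rewrite ge_min lexx.
have -> : f (z + h) * g (z + h) - f z * g z =
  (f (z + h) - f z) * (g (z + h) - g z) + (f (z + h) - f z) * g z
   + f z * (g (z + h) - g z) by ring.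
apply: le_lt_trans (cnormD _ _) _; rewrite cnormM.
apply: (@le_lt_trans _ _ (e1 * 1 + e1 * cnorm (g z) + cnorm (f z) * e1)).
  apply: lerD.
    apply: le_trans (cnormD _ _) _; rewrite !cnormM lerD//.
      by rewrite ler_pM ?cnorm_ge0 ?ltW// (lt_le_trans h2).
    by rewrite ler_wpM2r ?cnorm_ge0 ?ltW.
  by rewrite ler_wpM2l ?cnorm_ge0 ?ltW.
apply: lt_le_trans e1A.
rewrite /A; have := cnorm_ge0 (f z); have := cnorm_ge0 (g z) => *; nra.
Qed.

Lemma ccont_comp f g z : ccont f z -> ccont g (f z) -> ccont (g \o f) z.
Proof.
move=> H K e /K[d d0 Kd]; have [d' d'0 Hd] := H _ d0.
exists d' => // h /Hd hd /=.
by have := Kd _ hd; rewrite addrCA subrr addr0.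
Qed.

Lemma ccont_shift f z : ccont f z -> ccont (fun h => f (z + h)) 0.
Proof. by move=> H e /H[d d0 Hd]; exists d => // h; rewrite add0r addr0; exact: Hd. Qed.

Lemma cdiffM f g z l m : cdiff f z l -> cdiff g z m ->
  cdiff (fun w => f w * g w) z (l * g z + f z * m).
Proof.
move=> H K; have gc := cdiff_cont K.
have [k [k0 kE kc]] := (cdiff_slope _ _ _).1 H.
have [j [j0 jE jc]] := (cdiff_slope _ _ _).1 K.
apply/cdiff_slope; exists (fun h => k h * g (z + h) + f z * j h); split.
- by rewrite k0 j0 addr0.
- move=> h; have -> : f (z + h) * g (z + h) - f z * g z =
    (f (z + h) - f z) * g (z + h) + f z * (g (z + h) - g z) by ring.
  by rewrite kE jE; ring.
- by apply: ccontD; apply: ccontM => //; [exact: ccont_shift|exact: ccont_cst].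
Qed.

Lemma cdiff_comp f g z l m : cdiff f z l -> cdiff g (f z) m ->
  cdiff (g \o f) z (m * l).
Proof.
move=> H K; have fc := cdiff_cont H.
have [k [k0 kE kc]] := (cdiff_slope _ _ _).1 H.
have [j [j0 jE jc]] := (cdiff_slope _ _ _).1 K.
apply/cdiff_slope; exists (fun h => j (f (z + h) - f z) * k h); split.
- by rewrite addr0 subrr k0 j0.
- move=> h /=; rewrite -mulrA -kE -jE; congr (g _ - _).
  by rewrite addrCA subrr addr0.
- apply: ccontM => //.
  apply: (@ccont_comp (fun h => f (z + h) - f z) j); last by rewrite addr0 subrr.
  by apply: ccontD; [exact: ccont_shift|exact: ccont_cst].
Qed.

Lemma cdiffN f z l : cdiff f z l -> cdiff (fun w => - f w) z (- l).
Proof.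
move=> H e /H[d d0 Hd]; exists d => // h /Hd.
by rewrite -cnormN; congr (cnorm _ <= _); ring.
Qed.

Lemma cdiffB f g z l m : cdiff f z l -> cdiff g z m ->
  cdiff (fun w => f w - g w) z (l - m).
Proof. by move=> H /cdiffN; exact: cdiffD. Qed.

Lemma cdiffZ (a : C) f z l : cdiff f z l -> cdiff (fun w => a * f w) z (a * l).
Proof.
by move=> H; apply: cdiff_eq (cdiffM (cdiff_cst a z) H) _; rewrite mul0r add0r.
Qed.

Lemma cdiffX f z l n : cdiff f z l ->
  cdiff (fun w => f w ^+ n) z (n%:R * f z ^+ n.-1 * l).
Proof.
move=> H; elim: n => [|n IH].
  by apply: cdiff_eq (cdiff_cst _ _) _; rewrite mul0r mul0r.
apply: (@cdiff_local (fun w => f w * f w ^+ n) _ _ _ 1) => //.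
  by move=> h _; rewrite exprS.
apply: cdiff_eq (cdiffM H IH) _.
case: n {IH} => [|n] /=; first by rewrite !expr0; ring.
by rewrite (mulrSr 1 n.+1) exprS; ring.
Qed.

Lemma cdiff_inv z : z != 0 -> cdiff (fun w => w^-1) z (- (z ^+ 2)^-1).
Proof.
move=> z0; have nz : 0 < cnorm z by rewrite cnorm_gt0.
move=> e e0; pose c := cnorm z ^+ 3 / 2.
have c0 : 0 < c by rewrite divr_gt0// exprn_gt0.
exists (Num.min (cnorm z / 2) (e * c)); first by rewrite lt_min divr_gt0//= mulr_gt0.
move=> h; rewrite lt_min => /andP[h1 h2].
have zh : cnorm z / 2 <= cnorm (z + h).
  by have := cnorm_sub z (- h); rewrite opprK cnormN => ?; lra.
have zh0 : z + h != 0 by rewrite -cnorm_gt0; lra.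
have -> : (z + h)^-1 - z^-1 - - (z ^+ 2)^-1 * h = h * h / (z ^+ 2 * (z + h)).
  by field; rewrite z0 zh0.
rewrite !cnormM cnormV mulrAC ler_wpM2r ?cnorm_ge0//.
rewrite cnormM cnormX ler_pdivrMr; last first.
  by rewrite mulr_gt0 ?exprn_gt0// cnorm_gt0.
apply: le_trans (ltW h2) _; apply: (ler_wpM2l (ltW e0)).
have -> : c = cnorm z ^+ 2 * (cnorm z / 2) by rewrite /c exprSr -mulrA.
by apply: ler_wpM2l; rewrite // exprn_ge0// cnorm_ge0.
Qed.

Lemma cdiffV f z l : f z != 0 -> cdiff f z l ->
  cdiff (fun w => (f w)^-1) z (- l / f z ^+ 2).
Proof.
move=> fz H; apply: cdiff_eq (cdiff_comp H (cdiff_inv fz)) _.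
by rewrite mulNr mulrC mulNr.
Qed.

End Diff.

(** * Oriented integrals of continuous functions along segments *)

Section PathIntegral.
Variable R : realType.
Local Notation C := R[i].
Local Notation mu := (@lebesgue_measure R).
Implicit Types (f : R -> R) (g : R -> C).

Definition rcont f x := forall e : R, 0 < e -> exists2 d : R, 0 < d &
  forall h : R, `|h| < d -> `|f (x + h) - f x| < e.

Definition pcont g x := forall e : R, 0 < e -> exists2 d : R, 0 < d &
  forall h : R, `|h| < d -> cnorm (g (x + h) - g x) < e.

Lemma rcontP f x : rcont f x <-> {for x, continuous f}.
Proof.
split=> [H|/cvgrPdist_lt H].
  apply/cvgrPdist_lt => e /H[d d0 Hd]; apply/nbhs_ballP; exists d => //= y.
  rewrite /ball/= => xy; have -> : y = x + (y - x) by rewrite addrC subrK.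
  by rewrite distrC; apply: Hd; rewrite distrC.
move=> e /H[d /= d0 Hd]; exists d => // h hd; rewrite distrC; apply: Hd => /=.
by rewrite opprD addrA subrr sub0r normrN.
Qed.

Lemma pcont_Re g x : pcont g x -> rcont (fun t => complex.Re (g t)) x.
Proof.
move=> H e /H[d d0 Hd]; exists d => // h /Hd; apply: le_lt_trans.
by rewrite -cReN -cReD cnorm_Re.
Qed.

Lemma pcont_Im g x : pcont g x -> rcont (fun t => complex.Im (g t)) x.
Proof.
move=> H e /H[d d0 Hd]; exists d => // h /Hd; apply: le_lt_trans.
by rewrite -cImN -cImD cnorm_Im.
Qed.

Lemma rcont_within f a b : (forall x, a <= x <= b -> rcont f x) ->
  {within `[a, b], continuous f}.
Proof.
move=> H; apply: continuous_in_subspaceT => x /set_mem /=; rewrite in_itv /= => ab.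
exact/rcontP/H.
Qed.

Lemma rcont_integrable f a b : (forall x, a <= x <= b -> rcont f x) ->
  mu.-integrable `[a, b] (EFin \o f).
Proof.
move=> H; apply: continuous_compact_integrable; first exact: segment_compact.
exact: rcont_within.
Qed.

(** Oriented, so that primitives and additivity make no assumption on the order of the end
    points. *)
Definition orint (a b : R) f : R :=
  if a <= b then \int[mu]_(x in `[a, b]) f x else - \int[mu]_(x in `[b, a]) f x.

Lemma orint_le a b f : a <= b -> orint a b f = \int[mu]_(x in `[a, b]) f x.
Proof. by rewrite /orint => ->. Qed.

Lemma orint_sym a b f : orint b a f = - orint a b f.
Proof.
rewrite /orint; case: (ltgtP a b) => [||->]; rewrite ?opprK//.
by rewrite set_itv1 Rintegral_set1 oppr0.
Qed.

Lemma orint_chasles_le f a b c : a <= b -> b <= c ->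
  (forall x, a <= x <= c -> rcont f x) ->
  orint a c f = orint a b f + orint b c f.
Proof.
move=> ab bc H; rewrite !orint_le//; last exact: le_trans bc.
apply/eqP; rewrite addrC -subr_eq; apply/eqP.
rewrite Rintegral_itvB ?bnd_simp//; last exact: rcont_integrable.
rewrite Rintegral_itv_obnd_cbnd//.
have S : `]b, c] `<=` `[a, c].
  by move=> x /=; rewrite !in_itv/= => /andP[bx ->]; rewrite (le_trans ab (ltW bx)).
exact: integrableS (rcont_integrable H).
Qed.

Lemma orint_chasles f lo hi a b c : lo <= a <= hi -> lo <= b <= hi -> lo <= c <= hi ->
  (forall x, lo <= x <= hi -> rcont f x) ->
  orint a c f = orint a b f + orint b c f.
Proof.
move=> /andP[la ah] /andP[lb bh] /andP[lc ch] H.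
(* Additivity for ordered points; every other order of a, b, c follows by changing signs. *)
have K u v w : lo <= u -> w <= hi -> u <= v -> v <= w ->
    orint u w f = orint u v f + orint v w f.
  move=> lu wh uv vw; apply: orint_chasles_le => // x /andP[ux xw].
  by apply: H; rewrite (le_trans lu ux) (le_trans xw wh).
have [ab|/ltW ba] := leP a b; have [bc|/ltW cb] := leP b c; have [ac|/ltW ca] := leP a c;
 try (have := le_trans ab bc => ?); try (have := le_trans cb ba => ?).
- by apply: K.
- by rewrite (orint_sym c a) (orint_sym c b) (K c a b)//; ring.
- by rewrite (orint_sym c b) (K a c b)//; ring.
- by rewrite (orint_sym c a) (orint_sym c b) (K c a b)//; ring.
- by rewrite (orint_sym b a) (K b a c)//; ring.
- by rewrite (orint_sym b a) (orint_sym c a) (K b c a)//; ring.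
- by rewrite (orint_sym b a) (K b a c)//; ring.
- by rewrite (orint_sym b a) (orint_sym c a) (orint_sym c b) (K c b a)//; ring.
Qed.

Lemma orint_bound f a b (k e : R) : (forall x, Num.min a b <= x <= Num.max a b -> rcont f x) ->
  (forall x, Num.min a b <= x <= Num.max a b -> `|f x - k| <= e) ->
  `|orint a b f - k * (b - a)| <= e * `|b - a|.
Proof.
wlog ab : a b / a <= b => [wl|] H K.
  have [ab|/ltW ba] := leP a b; first exact: wl.
  rewrite orint_sym (distrC b a).
  have -> : - orint b a f - k * (b - a) = - (orint b a f - k * (a - b)) by ring.
  by rewrite normrN; apply: wl => // x; rewrite minC maxC; [exact: H|exact: K].
move: H K; rewrite min_l// max_r// => H K.
have I := rcont_integrable H.
have If c : mu.-integrable `[a, b] (EFin \o (fun=> c) : R -> \bar R).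
  by apply: rcont_integrable => x _ e' e'0; exists 1 => // h _; rewrite subrr normr0.
have cE c : \int[mu]_(x in `[a, b]) c = c * (b - a).
  by rewrite Rintegral_cst//= lebesgue_measure_itv/= lte_fin; case: ltgtP ab => // -> _;
    rewrite /= ?subrr// EFinN -EFinD.
rewrite orint_le// (ger0_norm (_ : 0 <= b - a)) ?subr_ge0// -(cE k) -RintegralB//.
apply: le_trans (le_normr_Rintegral _ _) _ => //.
  exact: integrableB I (If k).
rewrite -(cE e); apply: le_Rintegral => //.
apply: integrable_norm; exact: integrableB I (If k).
Qed.

Lemma orintD f1 f2 a b : (forall x, Num.min a b <= x <= Num.max a b -> rcont f1 x) ->
  (forall x, Num.min a b <= x <= Num.max a b -> rcont f2 x) ->
  orint a b (fun x => f1 x + f2 x) = orint a b f1 + orint a b f2.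
Proof.
wlog ab : a b / a <= b => [wl|] H K.
  have [ab|/ltW ba] := leP a b; first exact: wl.
  by rewrite orint_sym wl// 1?minC 1?maxC// opprD -!orint_sym.
move: H K; rewrite min_l// max_r// => H K.
by rewrite !orint_le// RintegralD//; exact: rcont_integrable.
Qed.

Lemma orintZ f k a b : (forall x, Num.min a b <= x <= Num.max a b -> rcont f x) ->
  orint a b (fun x => k * f x) = k * orint a b f.
Proof.
wlog ab : a b / a <= b => [wl|] H.
  have [ab|/ltW ba] := leP a b; first exact: wl.
  by rewrite orint_sym wl// 1?minC 1?maxC// -mulrN -orint_sym.
move: H; rewrite min_l// max_r// => H.
by rewrite !orint_le// RintegralZl//; exact: rcont_integrable.
Qed.

Lemma eq_orint f1 f2 a b : (forall x, Num.min a b <= x <= Num.max a b -> f1 x = f2 x) ->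
  orint a b f1 = orint a b f2.
Proof.
wlog ab : a b / a <= b => [wl|] H.
  have [ab|/ltW ba] := leP a b; first exact: wl.
  by rewrite orint_sym wl 1?minC 1?maxC// -orint_sym.
move: H; rewrite min_l// max_r// => H.
by rewrite !orint_le//; apply: eq_Rintegral => x /set_mem /=; rewrite in_itv/= => /H.
Qed.

Definition cint (a b : R) g : C :=
  Complex (orint a b (fun x => complex.Re (g x))) (orint a b (fun x => complex.Im (g x))).

Lemma cint_sym a b g : cint b a g = - cint a b g.
Proof. by rewrite /cint !(orint_sym a b). Qed.

Lemma cint_chasles g lo hi a b c : lo <= a <= hi -> lo <= b <= hi -> lo <= c <= hi ->
  (forall x, lo <= x <= hi -> pcont g x) ->
  cint a c g = cint a b g + cint b c g.
Proof.
move=> Ha Hb Hc H; rewrite /cint Complex_add.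
by rewrite -!(orint_chasles Ha Hb Hc)// => x /H; [exact: pcont_Im|exact: pcont_Re].
Qed.

(** Real and imaginary parts are estimated separately, which costs the factor 2. *)
Lemma cint_bound g a b (k : C) (e : R) :
  (forall x, Num.min a b <= x <= Num.max a b -> pcont g x) ->
  (forall x, Num.min a b <= x <= Num.max a b -> cnorm (g x - k) <= e) ->
  cnorm (cint a b g - k * Complex (b - a) 0) <= 2 * e * `|b - a|.
Proof.
move=> H K; apply: le_trans (cnorm_leD _) _.
rewrite -mulrA mulr2n mulrDl mul1r; apply: lerD.
  rewrite cReD cReN. rewrite cReM /= mulr0 subr0; apply: orint_bound => x /[dup] /H Hx /K Kx.
    exact: pcont_Re.
  by apply: le_trans Kx; rewrite -cReN -cReD cnorm_Re.
rewrite cImD cImN cImM /= mulr0 add0r; apply: orint_bound => x /[dup] /H Hx /K Kx.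
  exact: pcont_Im.
by apply: le_trans Kx; rewrite -cImN -cImD cnorm_Im.
Qed.

Lemma cint_bound0 g a b (e : R) :
  (forall x, Num.min a b <= x <= Num.max a b -> pcont g x) ->
  (forall x, Num.min a b <= x <= Num.max a b -> cnorm (g x) <= e) ->
  cnorm (cint a b g) <= 2 * e * `|b - a|.
Proof.
move=> H K; have := @cint_bound g a b 0 e H; rewrite mul0r subr0; apply.
by move=> x /K; rewrite subr0.
Qed.

Lemma cintD g1 g2 a b : (forall x, Num.min a b <= x <= Num.max a b -> pcont g1 x) ->
  (forall x, Num.min a b <= x <= Num.max a b -> pcont g2 x) ->
  cint a b (fun x => g1 x + g2 x) = cint a b g1 + cint a b g2.
Proof.
move=> H K; rewrite /cint Complex_add -!orintD; last first.
- by move=> x /K/pcont_Re.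
- by move=> x /H/pcont_Re.
- by move=> x /K/pcont_Im.
- by move=> x /H/pcont_Im.
by congr Complex; apply: eq_orint => x _; rewrite ?cReD ?cImD.
Qed.

Lemma eq_cint g1 g2 a b : (forall x, Num.min a b <= x <= Num.max a b -> g1 x = g2 x) ->
  cint a b g1 = cint a b g2.
Proof. by move=> H; rewrite /cint; congr Complex; apply: eq_orint => x /H ->. Qed.

Lemma rcontZ f k x : rcont f x -> rcont (fun t => k * f t) x.
Proof. by move=> /rcontP H; apply/rcontP; exact: cvgMr. Qed.

Lemma cintZ g (k : C) a b : (forall x, Num.min a b <= x <= Num.max a b -> pcont g x) ->
  cint a b (fun x => k * g x) = k * cint a b g.
Proof.
case: k => p q H; rewrite /cint Complex_mul -mulNr -!orintZ; try by
  move=> x /H; first [exact: pcont_Im|exact: pcont_Re].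
rewrite -!orintD; try by move=> x /H ?; apply: rcontZ; first [exact: pcont_Im|exact: pcont_Re].
by congr Complex; apply: eq_orint => x _; rewrite ?cReM ?cImM /= ?mulNr.
Qed.

End PathIntegral.

(** * Goursat's theorem for rectangles *)

Section Goursat.
Variable R : realType.
Local Notation C := R[i].
Implicit Types (h : C -> C).

Lemma ccont_hpath h (x y : R) : ccont h (Complex x y) -> pcont (fun t => h (Complex t y)) x.
Proof.
move=> H e /H[d d0 Hd]; exists d => // k kd.
have -> : Complex (x + k) y = Complex x y + Complex k 0 by rewrite Complex_add addr0.
by apply: Hd; rewrite cnorm_real.
Qed.

Lemma ccont_vpath h (x y : R) : ccont h (Complex x y) -> pcont (fun t => h (Complex x t)) y.
Proof.
move=> H e /H[d d0 Hd]; exists d => // k kd.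
have -> : Complex x (y + k) = Complex x y + Complex 0 k by rewrite Complex_add addr0.
by apply: Hd; rewrite cnorm_imag.
Qed.

Lemma pcontD (g1 g2 : R -> C) x : pcont g1 x -> pcont g2 x -> pcont (fun t => g1 t + g2 t) x.
Proof.
move=> H K e e0; have e20 : 0 < e / 2 by rewrite divr_gt0.
have [d d0 Hd] := H _ e20; have [d' d'0 Kd] := K _ e20.
exists (Num.min d d'); first by rewrite lt_min d0.
move=> k; rewrite lt_min => /andP[/Hd h1 /Kd h2].
rewrite opprD addrACA; apply: le_lt_trans (cnormD _ _) _.
by rewrite (splitr e) ltrD.
Qed.

Lemma pcontN (g : R -> C) x : pcont g x -> pcont (fun t => - g t) x.
Proof.
move=> H e /H[d d0 Hd]; exists d => // k /Hd; apply: le_lt_trans.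
by rewrite -opprD cnormN.
Qed.

Lemma cintB (g1 g2 : R -> C) a b : (forall x, Num.min a b <= x <= Num.max a b -> pcont g1 x) ->
  (forall x, Num.min a b <= x <= Num.max a b -> pcont g2 x) ->
  cint a b (fun x => g1 x - g2 x) = cint a b g1 - cint a b g2.
Proof.
move=> H K; rewrite cintD//; last by move=> x /K/pcontN.
congr (_ + _); rewrite -[RHS]mulN1r -cintZ//.
by apply: eq_cint => x _; rewrite mulN1r.
Qed.

(** The integral of h dz along the boundary of [a, b] x [c, d], counterclockwise. *)
Definition rectI h (a b c d : R) : C :=
  cint a b (fun x => h (Complex x c)) - cint a b (fun x => h (Complex x d)) +
  Complex 0 1 * (cint c d (fun y => h (Complex b y)) - cint c d (fun y => h (Complex a y))).

Definition hol_rect h (a b c d : R) := forall x y, a <= x <= b -> c <= y <= d ->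
  exists l, cdiff h (Complex x y) l.

Lemma rectI_hsplit h a m b c d : a <= m <= b -> c <= d -> hol_rect h a b c d ->
  rectI h a b c d = rectI h a m c d + rectI h m b c d.
Proof.
move=> /andP[am mb] cd H; rewrite /rectI.
have ab := le_trans am mb.
have K y : c <= y <= d -> forall x, a <= x <= b -> pcont (fun t => h (Complex t y)) x.
  by move=> ycd x xab; have [l /cdiff_cont] := H x y xab ycd; exact: ccont_hpath.
rewrite (@cint_chasles _ (fun x => h (Complex x c)) a b a m b) ?lexx ?am ?ab//; last first.
  by apply: K; rewrite lexx.
rewrite (@cint_chasles _ (fun x => h (Complex x d)) a b a m b) ?lexx ?am ?ab//; last first.
  by apply: K; rewrite lexx cd.
by ring.
Qed.

Lemma rectI_vsplit h a b c m d : a <= b -> c <= m <= d -> hol_rect h a b c d ->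
  rectI h a b c d = rectI h a b c m + rectI h a b m d.
Proof.
move=> ab /andP[cm md] H; rewrite /rectI.
have cd := le_trans cm md.
have K x : a <= x <= b -> forall y, c <= y <= d -> pcont (fun t => h (Complex x t)) y.
  by move=> xab y ycd; have [l /cdiff_cont] := H x y xab ycd; exact: ccont_vpath.
rewrite (@cint_chasles _ (fun y => h (Complex b y)) c d c m d) ?lexx ?cm ?cd//; last first.
  by apply: K; rewrite lexx ab.
rewrite (@cint_chasles _ (fun y => h (Complex a y)) c d c m d) ?lexx ?cm ?cd//; last first.
  by apply: K; rewrite lexx.
by ring.
Qed.

Lemma hol_rectS h a b c d a' b' c' d' : a <= a' -> b' <= b -> c <= c' -> d' <= d ->
  hol_rect h a b c d -> hol_rect h a' b' c' d'.
Proof.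
move=> aa bb cc dd H x y /andP[ax xb] /andP[cy yd]; apply: H.
  by rewrite (le_trans aa ax) (le_trans xb bb).
by rewrite (le_trans cc cy) (le_trans yd dd).
Qed.

(** The affine part of h at the point contributes 0, and the rest is at most e s on the boundary,
    where s is half the perimeter; integration gives the order e s^2. Opposite sides are paired, so
    that only differences of h are integrated. *)
Lemma rectI_local h (x0 y0 : R) l (e : R) : cdiff h (Complex x0 y0) l -> 0 < e ->
  exists2 r : R, 0 < r & forall a b c d, a <= x0 <= b -> c <= y0 <= d ->
    hol_rect h a b c d -> (b - a) + (d - c) < r ->
    cnorm (rectI h a b c d) <= 4 * e * ((b - a) + (d - c)) ^+ 2.
Proof.
move=> Hd e0; have [r r0 Hr] := Hd _ e0; exists r => // a b c d.
move=> /andP[ax xb] /andP[cy yd] H small.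
have ab := le_trans ax xb; have cd := le_trans cy yd.
set s := (b - a) + (d - c).
have s0 : 0 <= s by rewrite /s addr_ge0// subr_ge0.
have near x y : a <= x <= b -> c <= y <= d ->
    cnorm (h (Complex x y) - h (Complex x0 y0) - l * Complex (x - x0) (y - y0)) <= e * s.
  move=> /andP[a_x x_b] /andP[c_y y_d].
  have -> : Complex x y = Complex x0 y0 + Complex (x - x0) (y - y0).
    by rewrite Complex_add !(addrC _ (_ - _)) !subrK.
  have le : cnorm (Complex (x - x0) (y - y0)) <= s.
    apply: le_trans (cnorm_leD _) _; rewrite /s /=.
    by apply: lerD; rewrite ler_norml; apply/andP; split; lra.
  by apply: le_trans (Hr _ (le_lt_trans le small)) _; rewrite ler_wpM2l// ltW.
have Kh y : c <= y <= d -> forall x, Num.min a b <= x <= Num.max a b ->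
    pcont (fun t => h (Complex t y)) x.
  move=> ycd x; rewrite min_l// max_r// => xab.
  by have [l' /cdiff_cont] := H x y xab ycd; exact: ccont_hpath.
have Kv x : a <= x <= b -> forall y, Num.min c d <= y <= Num.max c d ->
    pcont (fun t => h (Complex x t)) y.
  move=> xab y; rewrite min_l// max_r// => ycd.
  by have [l' /cdiff_cont] := H x y xab ycd; exact: ccont_vpath.
rewrite /rectI -!cintB; try by [apply: Kh; lra|apply: Kv; lra].
(* [k1] and [k2] are the differences of the linear part between opposite sides; k1 (b - a) and i k2
   (d - c) cancel. *)
pose k1 := l * Complex 0 (c - d); pose k2 := l * Complex (b - a) 0.
have B1 : cnorm (cint a b (fun x => h (Complex x c) - h (Complex x d)) -
    k1 * Complex (b - a) 0) <= 2 * (2 * (e * s)) * `|b - a|.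
  apply: cint_bound => x xab; first by apply: pcontD; [|apply: pcontN]; apply: Kh => //; lra.
  move: xab; rewrite min_l// max_r// => xab.
  have -> : h (Complex x c) - h (Complex x d) - k1 =
    (h (Complex x c) - h (Complex x0 y0) - l * Complex (x - x0) (c - y0)) -
    (h (Complex x d) - h (Complex x0 y0) - l * Complex (x - x0) (d - y0)).
    have -> : k1 = l * Complex (x - x0) (c - y0) - l * Complex (x - x0) (d - y0).
      rewrite -mulrBr /k1; congr (l * _); apply: complex_eq => /=; ring.
    by ring.
  apply: le_trans (cnormD _ _) _; rewrite cnormN mulr2n mulrDl mul1r.
  by apply: lerD; apply: near => //; lra.
have B2 : cnorm (cint c d (fun y => h (Complex b y) - h (Complex a y)) -
    k2 * Complex (d - c) 0) <= 2 * (2 * (e * s)) * `|d - c|.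
  apply: cint_bound => y ycd; first by apply: pcontD; [|apply: pcontN]; apply: Kv => //; lra.
  move: ycd; rewrite min_l// max_r// => ycd.
  have -> : h (Complex b y) - h (Complex a y) - k2 =
    (h (Complex b y) - h (Complex x0 y0) - l * Complex (b - x0) (y - y0)) -
    (h (Complex a y) - h (Complex x0 y0) - l * Complex (a - x0) (y - y0)).
    have -> : k2 = l * Complex (b - x0) (y - y0) - l * Complex (a - x0) (y - y0).
      rewrite -mulrBr /k2; congr (l * _); apply: complex_eq => /=; ring.
    by ring.
  apply: le_trans (cnormD _ _) _; rewrite cnormN mulr2n mulrDl mul1r.
  by apply: lerD; apply: near => //; lra.
set A := cint a b _ in B1 *; set B := cint c d _ in B2 *.
have -> : A + Complex 0 1 * B =
  (A - k1 * Complex (b - a) 0) + Complex 0 1 * (B - k2 * Complex (d - c) 0).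
  have -> : k1 * Complex (b - a) 0 = - (Complex 0 1 * (k2 * Complex (d - c) 0)).
    rewrite /k1 /k2; case: (l) => p q; apply: complex_eq => /=; ring.
  by ring.
apply: le_trans (cnormD _ _) _; rewrite cnormM cnorm_imag normr1 mul1r.
apply: le_trans (lerD B1 B2) _.
rewrite !ger0_norm ?subr_ge0// -mulrDr -/s.
by rewrite le_eqVlt; apply/orP; left; apply/eqP; ring.
Qed.

Definition rquarter h (Q : R * R * R * R) (Q' : R * R * R * R) :=
  let: (a, b, c, d) := Q in let: (a', b', c', d') := Q' in
  [/\ [/\ a <= a', a' <= b' & b' <= b], [/\ c <= c', c' <= d' & d' <= d],
   b' - a' = (b - a) / 2, d' - c' = (d - c) / 2 &
   cnorm (rectI h a b c d) <= 4 * cnorm (rectI h a' b' c' d')].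

(** The integrals over the four quarters add up to the whole one, so one of them has at least a
    fourth of its modulus. *)
Lemma rquarter_exists h a b c d : a <= b -> c <= d -> hol_rect h a b c d ->
  exists Q', rquarter h (a, b, c, d) Q'.
Proof.
move=> ab cd H; pose m := (a + b) / 2; pose n := (c + d) / 2.
have am : a <= m by rewrite /m; lra.
have mb : m <= b by rewrite /m; lra.
have cn : c <= n by rewrite /n; lra.
have nd : n <= d by rewrite /n; lra.
have e1 := @rectI_hsplit h a m b c d ltac:(lra) cd H.
have e2 := @rectI_vsplit h a m c n d am ltac:(lra) (@hol_rectS h a b c d _ _ _ _ (lexx a) mb (lexx c) (lexx d) H).
have e3 := @rectI_vsplit h m b c n d mb ltac:(lra) (@hol_rectS h a b c d _ _ _ _ am (lexx b) (lexx c) (lexx d) H).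
have : cnorm (rectI h a b c d) <= cnorm (rectI h a m c n) + cnorm (rectI h a m n d) +
   (cnorm (rectI h m b c n) + cnorm (rectI h m b n d)).
  rewrite e1 e2 e3; apply: le_trans (cnormD _ _) _.
  by apply: lerD; exact: cnormD.
move=> tle.
have w1 : m - a = (b - a) / 2 by rewrite /m; clear; lra.
have w2 : b - m = (b - a) / 2 by rewrite /m; clear; lra.
have w3 : n - c = (d - c) / 2 by rewrite /n; clear; lra.
have w4 : d - n = (d - c) / 2 by rewrite /n; clear; lra.
have [h1|h1] := leP (cnorm (rectI h a b c d)) (4 * cnorm (rectI h a m c n)); first by exists (a, m, c, n).
have [h2|h2] := leP (cnorm (rectI h a b c d)) (4 * cnorm (rectI h a m n d)); first by exists (a, m, n, d).
have [h3|h3] := leP (cnorm (rectI h a b c d)) (4 * cnorm (rectI h m b c n)); first by exists (m, b, c, n).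
have arith (x1 x2 x3 x4 x5 : R) : x1 <= x2 + x3 + (x4 + x5) ->
    4 * x2 < x1 -> 4 * x3 < x1 -> 4 * x4 < x1 -> x1 <= 4 * x5 by clear; lra.
have h4 := arith _ _ _ _ _ tle h1 h2 h3.
by exists (m, b, n, d).
Qed.

Lemma nested_point (a b : nat -> R) : (forall n, a n <= b n) ->
  (forall n, a n <= a n.+1) -> (forall n, b n.+1 <= b n) ->
  exists x, forall n, a n <= x <= b n.
Proof.
move=> ab na nb.
have ma n m : (n <= m)%N -> a n <= a m by apply: (homo_leq (@lexx _ _) (@le_trans _ _)).
have mb n m : (n <= m)%N -> b m <= b n.
  by move=> nm; rewrite -(subnK nm); elim: (m - n)%N => [|k IH]; rewrite ?addSn // (le_trans (nb _)).
have anb n m : a n <= b m.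
  have [nm|/ltnW mn] := leqP n m; first exact: le_trans (ma _ _ nm) (ab _).
  exact: le_trans (ab _) (mb _ _ mn).
have S0 : has_sup (range a).
  by split; [exists (a 0%N); exists 0%N|exists (b 0%N) => _ [n _ <-]].
exists (sup (range a)) => n; apply/andP; split.
  by apply: sup_upper_bound => //; exists n.
by apply: ge_sup; [case: S0|move=> _ [m _ <-]].
Qed.

Theorem goursat h a b c d : a <= b -> c <= d -> hol_rect h a b c d -> rectI h a b c d = 0.
Proof.
move=> ab cd H; apply/eqP; rewrite -cnorm_eq0 eq_le cnorm_ge0 andbT leNgt.
apply/negP => eta0; set eta := cnorm _ in eta0.
pose good (Q : R * R * R * R) := let: (a', b', c', d') := Q in
  [/\ a <= a', a' <= b' & b' <= b] /\ [/\ c <= c', c' <= d' & d' <= d].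
(* A subdivision map on all quadruples, arbitrary outside the good ones; its iterates are the nested
   rectangles. *)
have /choice[st Hst] : forall Q, exists Q', good Q -> rquarter h Q Q' /\ good Q'.
  move=> [[[a' b'] c'] d']; have [gQ|] := pselect (good (a', b', c', d')); last first.
    by exists (a', b', c', d').
  have [[a1 a2 a3] [c1 c2 c3]] := gQ.
  have [[[[a'' b''] c''] d''] HQ'] := rquarter_exists a2 c2 (hol_rectS a1 a3 c1 c3 H).
  exists (a'', b'', c'', d'') => _; split=> //.
  by have [[? ? ?] [? ? ?] _ _ _] := HQ'; split; split=> //; lra.
pose Q n := iter n st (a, b, c, d).
have gQ n : good (Q n).
  elim: n => [|n IH] /=; first by split; split.
  by have [] := Hst _ IH.
have sQ n : rquarter h (Q n) (Q n.+1) by have [] := Hst _ (gQ n).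
pose qa n := (Q n).1.1.1; pose qb n := (Q n).1.1.2; pose qc n := (Q n).1.2; pose qd n := (Q n).2.
have QE n : Q n = (qa n, qb n, qc n, qd n) by rewrite /qa /qb /qc /qd; case: (Q n) => [[[]]].
have gQ' n : [/\ a <= qa n, qa n <= qb n & qb n <= b] /\ [/\ c <= qc n, qc n <= qd n & qd n <= d].
  by have := gQ n; rewrite QE.
have sQ' n : [/\ [/\ qa n <= qa n.+1, qa n.+1 <= qb n.+1 & qb n.+1 <= qb n],
   [/\ qc n <= qc n.+1, qc n.+1 <= qd n.+1 & qd n.+1 <= qd n],
   qb n.+1 - qa n.+1 = (qb n - qa n) / 2, qd n.+1 - qc n.+1 = (qd n - qc n) / 2 &
   cnorm (rectI h (qa n) (qb n) (qc n) (qd n)) <=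
   4 * cnorm (rectI h (qa n.+1) (qb n.+1) (qc n.+1) (qd n.+1))].
  by have := sQ n; rewrite !QE.
have [x0 Hx] : exists x, forall n, qa n <= x <= qb n.
  by apply: nested_point => n; [case: (gQ' n) => -[]|case: (sQ' n) => -[]|case: (sQ' n) => -[]].
have [y0 Hy] : exists x, forall n, qc n <= x <= qd n.
  by apply: nested_point => n; [case: (gQ' n) => _ []|case: (sQ' n) => _ []|case: (sQ' n) => _ []].
have [l Hl] : exists l, cdiff h (Complex x0 y0) l.
  by apply: H; [have := Hx 0%N|have := Hy 0%N].
pose s := (b - a) + (d - c).
have s0 : 0 <= s by rewrite addr_ge0// subr_ge0.
have side n : (qb n - qa n) + (qd n - qc n) = s / 2 ^+ n.
  elim: n => [|n IH]; first by rewrite expr0 divr1.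
  have [_ _ -> -> _] := sQ' n; rewrite -mulrDl IH exprS invfM; ring.
have low n : eta <= 4 ^+ n * cnorm (rectI h (qa n) (qb n) (qc n) (qd n)).
  elim: n => [|n IH]; first by rewrite expr0 mul1r.
  apply: le_trans IH _; have [_ _ _ _ le] := sQ' n.
  by rewrite exprSr -mulrA ler_wpM2l// exprn_ge0.
(* The n-th rectangle keeps an integral of at least eta / 4^n, while the local bound is 4 e s^2 /
   4^n; this e makes 4 e s^2 < eta. The + 1 covers a rectangle reduced to a point. *)
pose e := eta / (8 * (s ^+ 2 + 1)).
have s20 : 0 <= s ^+ 2 by exact: sqr_ge0.
have e0 : 0 < e by rewrite divr_gt0// mulr_gt0// ltr_wpDl.
have [r r0 Hr] := rectI_local Hl e0.
have [n Hn] : exists n, s / 2 ^+ n < r.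
  have [n Hn] : exists n : nat, s / r < n%:R.
    by exists (Num.trunc (s / r)).+1; rewrite truncnS_gt.
  exists n; rewrite ltr_pdivrMr ?exprn_gt0// -ltr_pdivrMl// mulrC.
  by apply: lt_le_trans Hn _; rewrite -natrX ler_nat ltnW// ltn_expl.
have [[g1 _ g2] [g3 _ g4]] := gQ' n.
have := Hr _ _ _ _ (Hx n) (Hy n) (hol_rectS g1 g2 g3 g4 H).
rewrite side => /(_ Hn) up.
have : eta <= 4 * e * s ^+ 2.
  apply: le_trans (low n) _.
  have -> : 4 * e * s ^+ 2 = 4 ^+ n * (4 * e * (s / 2 ^+ n) ^+ 2).
    have -> : (4 : R) ^+ n = 2 ^+ n * 2 ^+ n by rewrite -exprMn -natrM.
    by field; rewrite expf_neq0.
  by rewrite ler_wpM2l// exprn_ge0.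
rewrite /e leNgt => /negP; apply.
have -> : 4 * (eta / (8 * (s ^+ 2 + 1))) * s ^+ 2 = eta * (s ^+ 2 / (2 * (s ^+ 2 + 1))).
  by field; rewrite gt_eqF// ltr_wpDl.
rewrite -[ltRHS]mulr1 ltr_pM2l// ltr_pdivrMr ?mulr_gt0 ?ltr_wpDl//.
by lra.
Qed.

End Goursat.

(** * Real derivatives in remainder form *)

Section RealDiff.
Variable R : realType.
Implicit Types f : R -> R.

Definition rdiff f (x l : R) := forall e : R, 0 < e -> exists2 d : R, 0 < d &
  forall h : R, `|h| < d -> `|f (x + h) - f x - l * h| <= e * `|h|.

Lemma rdiffP f x l : rdiff f x l <-> is_derive x 1 f l.
Proof.
split=> [H|[Hd Hl] e e0].
  have K : (fun h : R => h^-1 *: ((f \o shift x) (h *: 1) - f x)) h @[h --> 0^'] --> l.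
    apply/cvgrPdist_le => e e0; have [d d0 Hd] := H _ e0.
    near=> h; have h0 : h != 0 by near: h; exact: nbhs_dnbhs_neq.
    have hd : `|h| < d by near: h; exact: dnbhs0_lt.
    rewrite /= /GRing.scale/= mulr1 distrC.
    have -> : h^-1 * (f (h + x) - f x) - l = (f (x + h) - f x - l * h) / h.
      by rewrite (addrC h); field.
    by rewrite normrM normfV ler_pdivrMr ?normr_gt0// Hd.
  have C : derivable f x 1 by apply/cvg_ex; exists l.
  by apply: DeriveDef => //; exact: cvg_lim K.
have : (fun h : R => h^-1 *: ((f \o shift x) (h *: 1) - f x)) h @[h --> 0^'] --> l.
  by rewrite -Hl; exact: Hd.
move/cvgrPdist_le => /(_ e e0) [d /= d0 Hdd]; exists d => // h hd.
have [->|h0] := eqVneq h 0; first by rewrite addr0 subrr mulr0 subr0 normr0 mulr0.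
have := Hdd h; rewrite /= sub0r normrN => /(_ hd h0).
rewrite /GRing.scale/= mulr1 distrC.
have -> : h^-1 * (f (h + x) - f x) - l = (f (x + h) - f x - l * h) / h.
  by rewrite (addrC h); field.
by rewrite normrM normfV ler_pdivrMr ?normr_gt0.
Unshelve. all: by end_near. Qed.

Lemma rdiff_cont f x l : rdiff f x l -> rcont f x.
Proof.
move=> /rdiffP[H _]; apply/rcontP; apply: differentiable_continuous.
exact/derivable1_diffP.
Qed.

Lemma rmean_value f (df : R -> R) (a b : R) : a <= b ->
  (forall x, a <= x <= b -> rdiff f x (df x)) ->
  exists2 c, a <= c <= b & f b - f a = df c * (b - a).
Proof.
move=> ab H; have [||c cab E] := @MVT_segment R f df a b ab.
- by move=> x; rewrite in_itv/= => /andP[/ltW ax /ltW xb]; apply/rdiffP/H; rewrite ax.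
- by apply: rcont_within => x /H/rdiff_cont.
- by exists c => //; move: cab; rewrite in_itv.
Qed.

End RealDiff.

(** * Complex exponential and logarithm *)

Section Cexp.
Variable R : realType.
Local Notation C := R[i].

Definition cexp (z : C) : C :=
  Complex (expR (complex.Re z) * cos (complex.Im z)) (expR (complex.Re z) * sin (complex.Im z)).

Lemma cexpD z w : cexp (z + w) = cexp z * cexp w.
Proof.
rewrite /cexp cReD cImD expRD cosD sinD Complex_mul.
by congr Complex; ring.
Qed.

Lemma cexp0 : cexp 0 = 1.
Proof. by rewrite /cexp /= expR0 cos0 sin0 mulr0 mulr1. Qed.

Lemma cnorm_cexp z : cnorm (cexp z) = expR (complex.Re z).
Proof.
apply/eqP; rewrite -(@eqrXn2 _ 2) ?cnorm_ge0 ?expR_ge0// cnorm_sqr /=.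
by rewrite !exprMn -mulrDr cos2Dsin2 mulr1.
Qed.

Lemma cexp_neq0 z : cexp z != 0.
Proof. by rewrite -cnorm_gt0 cnorm_cexp expR_gt0. Qed.

Lemma cexpN z : cexp (- z) = (cexp z)^-1.
Proof.
by apply: (mulfI (cexp_neq0 z)); rewrite -cexpD subrr cexp0 divff// cexp_neq0.
Qed.

(** The functional equation reduces the claim to the point 0, where the real derivatives of exp, cos
    and sin are combined. *)
Lemma cdiff_cexp z : cdiff cexp z (cexp z).
Proof.
suff K : cdiff cexp 0 1.
  have E := cdiff_comp (cdiffB (cdiff_id z) (cdiff_cst z z)) (_ : cdiff cexp (z - z) 1).
  have {}E := cdiffZ (cexp z) (E ltac:(rewrite subrr; exact: K)).
  apply: cdiff_eq (cdiff_local ltr01 _ E) _; last by ring.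
  by move=> h _ /=; rewrite -cexpD addrC addrNK.
move=> e e0; pose e1 := Num.min (e / 8) 1.
have e10 : 0 < e1 by rewrite lt_min ltr01 andbT; lra.
have e1e : e1 <= e / 8 by rewrite ge_min lexx.
have e11 : e1 <= 1 by rewrite ge_min lexx orbT.
have [d1 d10 H1] := (rdiffP _ _ _).2 (is_derive_expR (0 : R)) _ e10.
have [d2 d20 H2] := (rdiffP _ _ _).2 (is_derive_cos (0 : R)) _ e10.
have [d3 d30 H3] := (rdiffP _ _ _).2 (is_derive_sin (0 : R)) _ e10.
exists (Num.min (Num.min d1 d2) (Num.min d3 (Num.min (1 / 2) (e / 16)))).
  by rewrite !lt_min d10 d20 d30 /=; apply/andP; split; lra.
move=> [p q]; rewrite !lt_min => /andP[/andP[l1 l2] /and3P[l3 l4 l5]].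
set h := Complex p q in l1 l2 l3 l4 l5 *.
have pn : `|p| <= cnorm h := cnorm_Re h.
have qn : `|q| <= cnorm h := cnorm_Im h.
have := H1 p (le_lt_trans pn l1); have := H2 q (le_lt_trans qn l2).
have := H3 q (le_lt_trans qn l3).
rewrite !add0r expR0 cos0 sin0 !subr0 oppr0 mul0r !subr0 !mul1r => B3 B2 B1.
have p0 : 0 <= `|p| by []; have q0 : 0 <= `|q| by [].
have m1 : e1 * `|p| <= `|p| by rewrite ler_piMl.
have m2 : e1 * `|q| <= `|q| by rewrite ler_piMl.
rewrite cexp0; apply: le_trans (cnorm_leD _) _.
rewrite !cReD !cImD !cReN !cImN /= oppr0 addr0.
have p1 : `|expR p - 1| <= 2 * `|p|.
  rewrite -(subrK p (expR p - 1)); apply: le_trans (ler_normD _ _) _; lra.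
have ep : `|expR p| <= 2.
  rewrite -(subrK 1 (expR p)); apply: le_trans (ler_normD _ _) _; rewrite normr1; lra.
have sq : `|sin q| <= 2 * `|q|.
  rewrite -(subrK q (sin q)); apply: le_trans (ler_normD _ _) _; lra.
have -> : expR p * cos q - 1 - p = (expR p - 1 - p) + expR p * (cos q - 1) by ring.
have -> : expR p * sin q - q = (expR p - 1) * sin q + (sin q - q) by ring.
have b1 : `|expR p * (cos q - 1)| <= 2 * (e1 * `|q|) by rewrite normrM ler_pM.
have b2 : `|(expR p - 1) * sin q| <= (2 * `|p|) * (2 * `|q|) by rewrite normrM ler_pM.
have b3 : `|p| * `|q| <= e / 16 * `|q| by rewrite ler_wpM2r// ltW// (le_lt_trans pn).
have b4 : e1 * `|p| <= e / 8 * cnorm h by rewrite ler_pM// ltW.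
have b5 : e1 * `|q| <= e / 8 * cnorm h by rewrite ler_pM// ltW.
have b6 : e / 16 * `|q| <= e / 16 * cnorm h by rewrite ler_wpM2l//; lra.
have h0 : 0 <= e * cnorm h by rewrite mulr_ge0 ?cnorm_ge0// ltW.
apply: le_trans (lerD (ler_normD _ _) (ler_normD _ _)) _.
rewrite -[leRHS]/(e * cnorm h); lra.
Qed.

(** If k is the increment of f, the slope j of g gives h = j(k) k. Continuity of f keeps j(k) close
    to m, away from 0, so k is of the order of h. *)
Lemma cdiff_inverse (f g : C -> C) z m (d : R) : 0 < d ->
  (forall h, cnorm h < d -> g (f (z + h)) = z + h) -> ccont f z ->
  cdiff g (f z) m -> m != 0 -> cdiff f z m^-1.
Proof.
move=> d0 gf fc gd m0; have mn : 0 < cnorm m by rewrite cnorm_gt0.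
have [j [j0 jE jc]] := (cdiff_slope _ _ _).1 gd.
move=> e e0; pose e1 := Num.min (cnorm m / 2) (e * cnorm m ^+ 2 / 2).
have e10 : 0 < e1 by rewrite lt_min divr_gt0//= divr_gt0// mulr_gt0// exprn_gt0.
have [d1 d10 H1] := jc _ e10; have [d2 d20 H2] := fc _ d10.
exists (Num.min d d2); first by rewrite lt_min d0.
move=> h; rewrite lt_min => /andP[hd /H2 h2].
set k := f (z + h) - f z in h2 *.
have := H1 _ h2; rewrite add0r j0 lt_min => /andP[s1 s2].
have hE : h = j k * k.
  have fz : g (f z) = z by have := gf 0; rewrite cnorm0 addr0 => ->.
  by rewrite -jE /k addrCA subrr addr0 gf// fz addrAC subrr add0r.
have jm : cnorm m / 2 <= cnorm (j k).
  have := cnorm_sub m (m - j k); have -> : m - (m - j k) = j k by ring.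
  by rewrite (cnormB m); lra.
have -> : k - m^-1 * h = - ((j k - m) * k / m) by rewrite {1}hE; field.
rewrite cnormN !cnormM cnormV ler_pdivrMr//.
have kh : cnorm k * (cnorm m / 2) <= cnorm h.
  by rewrite [X in _ <= cnorm X]hE cnormM mulrC ler_wpM2r// cnorm_ge0.
apply: (@le_trans _ _ (e * cnorm m ^+ 2 / 2 * cnorm k)).
  by rewrite ler_wpM2r ?cnorm_ge0// ltW.
rewrite (_ : _ * _ = e * cnorm m * (cnorm k * (cnorm m / 2))); last by field.
by rewrite [leRHS]mulrAC ler_wpM2l// mulr_ge0 ?cnorm_ge0 ?ltW.
Qed.

(** Meant for the right half-plane, where atan (y / x) is the argument. *)
Definition clog (z : C) : C :=
  Complex (ln (cnorm z)) (atan (complex.Im z / complex.Re z)).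

Lemma clogK z : 0 < complex.Re z -> cexp (clog z) = z.
Proof.
move=> x0; have z0 : z != 0.
  by apply/eqP => zE; move: x0; rewrite zE /= ltxx.
have n0 : 0 < cnorm z by rewrite cnorm_gt0.
rewrite /cexp /clog /= lnK ?posrE//.
have cE : cos (atan (complex.Im z / complex.Re z)) = complex.Re z / cnorm z.
  rewrite cos_atan.
  have -> : 1 + (complex.Im z / complex.Re z) ^+ 2 = (cnorm z / complex.Re z) ^+ 2.
    by rewrite [RHS]exprMn cnorm_sqr; field; rewrite gt_eqF.
  by rewrite sqrtr_sqr ger0_norm ?invf_div// divr_ge0 ?cnorm_ge0 ?ltW.
have sE : sin (atan (complex.Im z / complex.Re z)) = complex.Im z / cnorm z.
  have : tan (atan (complex.Im z / complex.Re z)) = complex.Im z / complex.Re z by exact: atanK.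
  rewrite /tan cE => /(congr1 (fun t => t * (complex.Re z / cnorm z))).
  rewrite divfK; last by rewrite mulf_neq0 ?invr_eq0 ?gt_eqF.
  by move=> ->; field; rewrite !gt_eqF.
by rewrite cE sE; apply: complex_eq => /=; field; rewrite gt_eqF.
Qed.

Lemma cexpK z : `|complex.Im z| < pi / 2 -> clog (cexp z) = z.
Proof.
rewrite ltr_norml => yb; case: z yb => x y /= yb.
rewrite /clog cnorm_cexp /= expRK; congr Complex.
have c0 : cos y != 0 by rewrite gt_eqF// cos_gt0_pihalf.
have -> : expR x * sin y / (expR x * cos y) = tan y.
  by rewrite /tan; field; rewrite c0 gt_eqF ?expR_gt0.
by rewrite tanK// in_itv.
Qed.

Lemma clog_Im z : `|complex.Im (clog z)| < pi / 2.
Proof. by rewrite ltr_norml /= atan_gtNpi2 atan_ltpi2. Qed.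

Lemma cexp_Re_gt0 z : `|complex.Im z| < pi / 2 -> 0 < complex.Re (cexp z).
Proof.
by rewrite ltr_norml => yb; rewrite /= mulr_gt0 ?expR_gt0// cos_gt0_pihalf.
Qed.

Lemma ccont_clog z : 0 < complex.Re z -> ccont clog z.
Proof.
move=> x0; have z0 : z != 0.
  by apply/eqP => zE; move: x0; rewrite zE /= ltxx.
have n0 : 0 < cnorm z by rewrite cnorm_gt0.
move=> e e0; have e20 : 0 < e / 2 by lra.
have /(_ _ e20)[d1 d10 H1] : rcont (@ln R) (cnorm z) by apply/rcontP; exact: continuous_ln.
have /(_ _ e20)[d2 d20 H2] : rcont (@atan R) (complex.Im z / complex.Re z).
  by apply/rcontP; exact: continuous_atan.
pose x := complex.Re z; pose y := complex.Im z.
(* A Lipschitz constant of y / x at z, valid while the real part stays above x / 2. *)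
pose A := 2 * (`|x| + `|y| + 1) / x ^+ 2.
have A0 : 0 < A by rewrite divr_gt0 ?exprn_gt0// mulr_gt0// ltr_wpDl// addr_ge0.
exists (Num.min (Num.min d1 (d2 / A)) (x / 2)); first by rewrite !lt_min d10 (divr_gt0 d20 A0) divr_gt0.
move=> h; rewrite !lt_min ltr_pdivlMr// => /andP[/andP[h1 h2] h3].
apply: (le_lt_trans (cnorm_leD _)); rewrite [ltRHS]splitr; apply: ltrD.
  rewrite cReD cReN /=; have -> : cnorm (z + h) = cnorm z + (cnorm (z + h) - cnorm z) by ring.
  apply: H1; apply: le_lt_trans h1; rewrite ler_norml; apply/andP; split.
    by have := cnorm_sub z (- h); rewrite opprK cnormN; lra.
  by have := cnormD z h; lra.
rewrite cImD cImN /= !cReD !cImD -/x -/y.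
set p := complex.Re h; set q := complex.Im h.
have pn : `|p| <= cnorm h := cnorm_Re h.
have qn : `|q| <= cnorm h := cnorm_Im h.
have xp : x / 2 <= x + p by have := ler_norm (- p); rewrite normrN; lra.
have xp0 : 0 < x + p by apply: lt_le_trans xp; rewrite divr_gt0.
have -> : (y + q) / (x + p) = y / x + ((y + q) / (x + p) - y / x) by ring.
apply: H2; apply: le_lt_trans h2.
have -> : (y + q) / (x + p) - y / x = (q * x - p * y) / ((x + p) * x).
  by field; rewrite !gt_eqF.
rewrite normrM normfV (ger0_norm (ltW (mulr_gt0 xp0 x0))) ler_pdivrMr ?mulr_gt0//.
apply: (@le_trans _ _ (cnorm h * (`|x| + `|y| + 1))).
  apply: le_trans (ler_normB _ _) _; rewrite !normrM.
  have := ler_wpM2r (normr_ge0 x) qn; have := ler_wpM2r (normr_ge0 y) pn.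
  have := cnorm_ge0 h; lra.
rewrite -mulrA ler_wpM2l ?cnorm_ge0//.
rewrite (_ : A * _ = (`|x| + `|y| + 1) * (2 * (x + p) / x)); last first.
  by rewrite /A; field; rewrite gt_eqF.
rewrite -[leLHS]mulr1 ler_wpM2l ?addr_ge0// ler_pdivlMr//; lra.
Qed.

Lemma cdiff_clog z : 0 < complex.Re z -> cdiff clog z z^-1.
Proof.
move=> x0; have E := clogK x0.
have C := cdiff_cexp (clog z); rewrite E in C.
apply: (@cdiff_inverse clog cexp z z (complex.Re z)) => //.
- move=> h hd; apply: clogK; rewrite cReD.
  by have := cnorm_Re h; have := ler_norm (- complex.Re h); rewrite normrN; lra.
- exact: ccont_clog.
- by apply/eqP => zE; move: x0; rewrite zE /= ltxx.
Qed.

End Cexp.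

(** * Primitives on a horizontal strip *)

Section Primitive.
Variable R : realType.
Local Notation C := R[i].
Implicit Types (h : C -> C).

Lemma rectI_symh h a b c d : rectI h b a c d = - rectI h a b c d.
Proof. by rewrite /rectI !(cint_sym a b); ring. Qed.

Lemma rectI_symv h a b c d : rectI h a b d c = - rectI h a b c d.
Proof. by rewrite /rectI !(cint_sym c d); ring. Qed.

Lemma goursat_or h a b c d :
  hol_rect h (Num.min a b) (Num.max a b) (Num.min c d) (Num.max c d) -> rectI h a b c d = 0.
Proof.
have [ab|/ltW ba] := leP a b; have [cd|/ltW dc] := leP c d => H.
- exact: goursat.
- by rewrite rectI_symv goursat ?oppr0.
- by rewrite rectI_symh goursat ?oppr0.
- by rewrite rectI_symh rectI_symv goursat ?oppr0.
Qed.

Lemma strip_primitive (a : R) h :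
  (forall z, `|complex.Im z| < a -> exists l, cdiff h z l) ->
  exists f, forall z, `|complex.Im z| < a -> cdiff f z (h z).
Proof.
move=> H.
(* The path follows the real axis and then goes up. Goursat on one rectangle reroutes the path to z
   + k through z, so that the increment is an integral over two short segments near z. *)
pose f (z : C) := cint 0 (complex.Re z) (fun t => h (Complex t 0)) +
   Complex 0 1 * cint 0 (complex.Im z) (fun t => h (Complex (complex.Re z) t)).
exists f => -[x y] /= ya.
have ch z : `|complex.Im z| < a -> ccont h z by move=> /H[l]; exact: cdiff_cont.
have a0 : 0 < a by apply: le_lt_trans ya.
move=> e e0; have e40 : 0 < e / 4 by lra.
have [d d0 Hd] := ch (Complex x y) ya _ e40.
exists (Num.min (d / 2) (a - `|y|)); first by rewrite lt_min subr_gt0 ya divr_gt0.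
move=> [p q]; rewrite lt_min => /andP[]; set k := Complex p q => k1 k2.
have pn : `|p| <= cnorm k := cnorm_Re k.
have qn : `|q| <= cnorm k := cnorm_Im k.
have yin t : Num.min y (y + q) <= t <= Num.max y (y + q) -> `|t - y| <= `|q|.
  rewrite ge_min le_max => /andP[t1 t2].
  have := ler_norm q; have := ler_norm (- q); rewrite normrN => q1 q2.
  by rewrite ler_norml; apply/andP; split; [case/orP: t1|case/orP: t2]; lra.
have xin t : Num.min x (x + p) <= t <= Num.max x (x + p) -> `|t - x| <= `|p|.
  rewrite ge_min le_max => /andP[t1 t2].
  have := ler_norm p; have := ler_norm (- p); rewrite normrN => q1 q2.
  by rewrite ler_norml; apply/andP; split; [case/orP: t1|case/orP: t2]; lra.
have yqa t : `|t - y| <= `|q| -> `|t| < a.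
  move=> tq; rewrite -(subrK y t); apply: le_lt_trans (ler_normD _ _) _; lra.
pose m := Num.min (Num.min 0 y) (y + q); pose M := Num.max (Num.max 0 y) (y + q).
have vin t : m <= t <= M -> `|t| < a.
  have yqa' : `|y + q| < a by apply: yqa; rewrite addrAC subrr add0r.
  move: yqa' ya; rewrite !ltr_norml !ge_min !le_max => /andP[u1 u2] /andP[u3 u4].
  by move=> /andP[t1 t2]; apply/andP; split; [case/orP: t1 => [/orP[]|]|case/orP: t2 => [/orP[]|]]; lra.
have hc u v : `|v| < a -> pcont (fun t => h (Complex t v)) u.
  by move=> va; apply: ccont_hpath; exact: ch.
have vc u v : `|v| < a -> pcont (fun t => h (Complex u t)) v.
  by move=> va; apply: ccont_vpath; exact: ch.
have E1 : cint 0 (x + p) (fun t => h (Complex t 0)) =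
   cint 0 x (fun t => h (Complex t 0)) + cint x (x + p) (fun t => h (Complex t 0)).
  pose lo := Num.min (Num.min 0 x) (x + p); pose hi := Num.max (Num.max 0 x) (x + p).
  by apply: (@cint_chasles _ _ lo hi); rewrite /lo /hi ?ge_min ?le_max ?lexx ?orbT// => u _; apply: hc; rewrite normr0.
have E2 : cint 0 (y + q) (fun t => h (Complex (x + p) t)) =
   cint 0 y (fun t => h (Complex (x + p) t)) + cint y (y + q) (fun t => h (Complex (x + p) t)).
  by apply: (@cint_chasles _ _ m M); rewrite /m /M ?ge_min ?le_max ?lexx ?orbT// => u /vin; apply: vc.
have E3 : rectI h x (x + p) 0 y = 0.
  apply: goursat_or => u v _ v0y; apply: H => /=; apply: vin.
  by move: v0y; rewrite ge_min le_max /m /M !ge_min !le_max => /andP[/orP[]-> /orP[]->]; rewrite ?orbT.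
have -> : f (Complex x y + k) - f (Complex x y) - h (Complex x y) * k =
   (cint x (x + p) (fun t => h (Complex t y)) - h (Complex x y) * Complex (x + p - x) 0) +
   Complex 0 1 * (cint y (y + q) (fun t => h (Complex (x + p) t)) - h (Complex x y) * Complex (y + q - y) 0).
  have -> : f (Complex x y + k) = cint 0 (x + p) (fun t => h (Complex t 0)) +
     Complex 0 1 * cint 0 (y + q) (fun t => h (Complex (x + p) t)) by [].
  have -> : k = Complex (x + p - x) 0 + Complex 0 1 * Complex (y + q - y) 0.
    by apply: complex_eq => /=; ring.
  rewrite /f /= E1 E2; move: E3; rewrite /rectI => /eqP; rewrite addr_eq0 subr_eq => /eqP ->.
  by ring.
have B1 : cnorm (cint x (x + p) (fun t => h (Complex t y)) - h (Complex x y) * Complex (x + p - x) 0)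
   <= 2 * (e / 4) * `|x + p - x|.
  apply: cint_bound => t /xin tp; first exact: hc.
  have -> : Complex t y = Complex x y + Complex (t - x) 0.
    by rewrite Complex_add addr0 addrC subrK.
  by apply/ltW/Hd; rewrite cnorm_real; lra.
have B2 : cnorm (cint y (y + q) (fun t => h (Complex (x + p) t)) - h (Complex x y) * Complex (y + q - y) 0)
   <= 2 * (e / 4) * `|y + q - y|.
  apply: cint_bound => t /yin tp; first by apply: vc; exact: yqa.
  have -> : Complex (x + p) t = Complex x y + Complex p (t - y).
    by rewrite Complex_add; congr Complex; ring.
  apply/ltW/Hd; apply: le_lt_trans (cnorm_leD _) _; rewrite /=; lra.
apply: le_trans (cnormD _ _) _; rewrite cnormM cnorm_imag normr1 mul1r.
move: B1 B2; rewrite (_ : x + p - x = p); last by ring.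
rewrite (_ : y + q - y = q); last by ring.
move=> B1 B2; apply: le_trans (lerD B1 B2) _.
have : e * `|p| <= e * cnorm k by rewrite ler_wpM2l// ltW.
have : e * `|q| <= e * cnorm k by rewrite ler_wpM2l// ltW.
lra.
Qed.

End Primitive.

(** * Means over circles and Cauchy's theorem *)

Section CircleMean.
Variable R : realType.
Local Notation C := R[i].
Implicit Types (g : C -> C).

Lemma circE (t : R) : circ t = cexp (Complex 0 (2 * pi * t)).
Proof. by rewrite /circ /cexp /= expR0 !mul1r. Qed.

Lemma cnorm_circ (t : R) : cnorm (circ t) = 1.
Proof. by rewrite circE cnorm_cexp /= expR0. Qed.

Definition rcirc (r t : R) : C := Complex r 0 * circ t.

Lemma cnorm_rcirc r t : 0 <= r -> cnorm (rcirc r t) = r.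
Proof. by move=> r0; rewrite cnormM cnorm_circ mulr1 cnorm_real ger0_norm. Qed.

Lemma rcircB r s t : cnorm (rcirc r t - rcirc s t) = `|r - s|.
Proof. by rewrite -mulrBl cnormM cnorm_circ mulr1 Complex_opp Complex_add oppr0 addr0 cnorm_real. Qed.

Lemma rcirc_pcont r t : pcont (rcirc r) t.
Proof.
have : ccont (fun z => Complex r 0 * cexp (Complex (2 * pi) 0 * z)) (Complex 0 t).
  apply: ccontM; first exact: ccont_cst.
  apply: (@ccont_comp _ (fun z => Complex (2 * pi) 0 * z) (@cexp R)).
    exact: cdiff_cont (cdiffZ _ (cdiff_id _)).
  exact: cdiff_cont (cdiff_cexp _).
move/ccont_vpath; rewrite (_ : (fun u => _) = rcirc r)//.
by apply/funext => u; rewrite /rcirc circE; congr (_ * cexp _); apply: complex_eq => /=; ring.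
Qed.

Lemma pcont_comp (g : C -> C) (f : R -> C) t : pcont f t -> ccont g (f t) -> pcont (g \o f) t.
Proof.
move=> H K e /K[d d0 Hd]; have [d' d'0 Kd] := H _ d0.
exists d' => // h /Kd hd /=.
by have := Hd _ hd; rewrite addrCA subrr addr0.
Qed.

Definition cmean g (r : R) : C := cint 0 1 (fun t => g (rcirc r t)).

Lemma cmean_cst (c : C) r : cmean (fun=> c) r = c.
Proof.
have := @cint_bound R (fun=> c) 0 1 c 0.
rewrite subr0 mulr0 mul0r (_ : Complex 1 0 = 1)// mulr1 => H.
apply/eqP; rewrite -subr_eq0 -cnorm_eq0 eq_le cnorm_ge0 andbT.
apply: H => x _; last by rewrite subrr cnorm0.
by move=> e e0; exists 1 => // h _; rewrite subrr cnorm0.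
Qed.

(** In the coordinate log z / (2 pi) the annulus becomes a rectangle of height 1. By periodicity the
    integrals over its horizontal sides cancel, and Goursat equates those over the vertical sides,
    which are the two means. *)
Lemma cmean_annulus g (r1 r2 r s : R) : 0 <= r1 -> r1 < r -> r <= s -> s < r2 ->
  (forall z, r1 < cnorm z < r2 -> exists l, cdiff g z l) -> cmean g r = cmean g s.
Proof.
move=> r10 r1r rs sr2 H.
have r0 : 0 < r by apply: le_lt_trans r1r.
have s0 : 0 < s by apply: lt_le_trans rs.
have pi2 : 0 < 2 * pi :> R by rewrite mulr_gt0// pi_gt0.
pose h z := g (cexp (Complex (2 * pi) 0 * z)).
pose a := ln r / (2 * pi); pose b := ln s / (2 * pi).
have ab : a <= b by rewrite ler_pM2r ?invr_gt0// ler_ln ?posrE.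
have hE x t : h (Complex x t) = g (rcirc (expR (2 * pi * x)) t).
  rewrite /h /rcirc circE; congr g.
  have -> : Complex (2 * pi) 0 * Complex x t = Complex (2 * pi * x) 0 + Complex 0 (2 * pi * t).
    by apply: complex_eq => /=; ring.
  by rewrite cexpD; congr (_ * _); rewrite /cexp /= cos0 sin0 mulr0 mulr1.
have aE : expR (2 * pi * a) = r by rewrite /a mulrC divfK ?gt_eqF// lnK.
have bE : expR (2 * pi * b) = s by rewrite /b mulrC divfK ?gt_eqF// lnK.
have Hh : hol_rect h a b 0 1.
  move=> x y /andP[ax xb] _; pose z : C := Complex (2 * pi) 0 * Complex x y.
  have zr : r1 < cnorm (cexp z) < r2.
    rewrite cnorm_cexp /= mul0r subr0; apply/andP; split.
      by apply: lt_le_trans r1r _; rewrite -aE ler_expR ler_pM2l.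
    by apply: le_lt_trans sr2; rewrite -bE ler_expR ler_pM2l.
  have [l Hl] := H _ zr.
  exists (l * (cexp z * (Complex (2 * pi) 0 * 1))).
  apply: (@cdiff_comp _ (fun z => cexp (Complex (2 * pi) 0 * z)) g) => //.
  apply: (@cdiff_comp _ (fun z => Complex (2 * pi) 0 * z) (@cexp R)).
    exact: cdiffZ (cdiff_id _).
  exact: cdiff_cexp.
have := goursat ab ler01 Hh; rewrite /rectI.
have -> : cint a b (fun x => h (Complex x 0)) = cint a b (fun x => h (Complex x 1)).
  apply: eq_cint => x _; rewrite !hE /rcirc /circ.
  by rewrite mulr0 cos0 sin0 mulr1 mulr_natl cos2pi sin2pi.
rewrite subrr add0r => /eqP; rewrite mulf_eq0 => /orP[/eqP[] /eqP|].
  by rewrite oner_eq0.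
rewrite subr_eq0 => /eqP E; apply/esym; rewrite /cmean.
move: E; under [X in X = _]eq_cint => y _ do rewrite hE bE.
by under [X in _ = X]eq_cint => y _ do rewrite hE aE.
Qed.

Lemma cmean_cont g (r0 : R) : 0 <= r0 -> r0 < 1 -> (forall z, cnorm z < 1 -> ccont g z) ->
  forall e : R, 0 < e -> exists2 d : R, 0 < d &
    forall r, 0 <= r < 1 -> `|r - r0| < d -> cnorm (cmean g r - cmean g r0) <= e.
Proof.
move=> r00 r01 H e e0.
pose P (r t : R) : Prop := cnorm (g (rcirc r t) - g (rcirc r0 t)) < e / 2.
(* Compactness of [0, 1] makes the closeness of the two circles' values uniform in t. *)
have cov : \forall r \near nbhs r0, `[0%R, 1%R] `<=` P r.
  apply: ((compact_near_coveringP _).1 (@segment_compact R 0 1) R (nbhs r0) P) => t t01.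
  have e40 : 0 < e / 4 by lra.
  have zt : cnorm (rcirc r0 t) < 1 by rewrite cnorm_rcirc.
  have [d d0 Hd] := H _ zt _ e40.
  have d20 : 0 < d / 2 by lra.
  have [d' d'0 Hd'] := rcirc_pcont r0 t d20.
  have n1 : \forall t' \near t, `|t' - t| < d'.
    by apply/nbhs_ballP; exists d' => //= y; rewrite /ball/= distrC.
  have n2 : \forall r \near r0, `|r - r0| < d / 2.
    by apply/nbhs_ballP; exists (d / 2) => //= y; rewrite /ball/= distrC.
  exists ([set t' | `|t' - t| < d'], [set r | `|r - r0| < d / 2]) => //= -[t' r] /= [h1 h2]; rewrite /P.
  have k1 : cnorm (rcirc r0 t' - rcirc r0 t) < d / 2.
    by have := Hd' _ h1; rewrite addrCA subrr addr0.
  have k2 : cnorm (rcirc r t' - rcirc r0 t) < d.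
    have -> : rcirc r t' - rcirc r0 t = (rcirc r t' - rcirc r0 t') + (rcirc r0 t' - rcirc r0 t).
      by ring.
    by apply: le_lt_trans (cnormD _ _) _; rewrite rcircB; lra.
  have := Hd _ k2; rewrite addrCA subrr addr0 => g2.
  have : cnorm (g (rcirc r0 t') - g (rcirc r0 t)) < e / 4.
    have := Hd (rcirc r0 t' - rcirc r0 t); rewrite addrCA subrr addr0; apply; lra.
  rewrite cnormB => g1.
  have -> : g (rcirc r t') - g (rcirc r0 t') =
     (g (rcirc r t') - g (rcirc r0 t)) + (g (rcirc r0 t) - g (rcirc r0 t')) by ring.
  by apply: le_lt_trans (cnormD _ _) _; lra.
have [d d0 Hd] := (nbhs_ballP _ _).1 cov.
exists d => // r /andP[rp r1] rd.
have pc s : 0 <= s -> s < 1 -> forall t, pcont (fun t => g (rcirc s t)) t.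
  by move=> s0 s1 t; apply: pcont_comp; [exact: rcirc_pcont|apply: H; rewrite cnorm_rcirc].
have -> : cmean g r - cmean g r0 = cint 0 1 (fun t => g (rcirc r t) - g (rcirc r0 t)).
  by rewrite cintB// => t _; apply: pc.
apply: le_trans (@cint_bound0 _ _ _ _ (e / 2) _ _) _.
- by move=> t _; apply: pcontD; [|apply: pcontN]; apply: pc.
- move=> t; rewrite min_l// max_r// => t01; apply/ltW.
  by apply: (Hd r) => /=; [rewrite /ball/= distrC|rewrite in_itv].
- by rewrite subr0 normr1; lra.
Qed.

Lemma small_eq0 (x : R) : (forall e, 0 < e -> x <= e) -> 0 <= x -> x = 0.
Proof.
move=> H x0; apply/eqP; rewrite eq_le x0 andbT leNgt; apply/negP => xp.
by have := H (x / 2) ltac:(lra); lra.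
Qed.

(** On a circle dz is 2 pi i z dt, so the factor z turns the mean into a contour integral of the
    difference quotient. *)
Lemma cauchy_mean0 (f : C -> C) w : cnorm w < 1 -> (forall z, cnorm z < 1 -> exists l, cdiff f z l) ->
  forall r, cnorm w < r -> r < 1 -> cmean (fun z => z * ((f z - f w) / (z - w))) r = 0.
Proof.
move=> w1 H.
have [l Hl] := H _ w1; have [k [k0 kE kc]] := (cdiff_slope _ _ _).1 Hl.
(* The slope [k] extends the difference quotient continuously across w. *)
pose g z := z * k (z - w).
have gE z : z != w -> g z = z * ((f z - f w) / (z - w)).
  move=> zw; have := kE (z - w); rewrite addrCA subrr addr0 => ->.
  by rewrite mulfK// subr_eq0.
have gd z : cnorm z < 1 -> z != w -> exists l, cdiff g z l.
  move=> z1 zw; have [m Hm] := H z z1.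
  have K := cdiffM (cdiff_id z) (cdiffM (cdiffB Hm (cdiff_cst (f w) z))
      (cdiffV _ (cdiffB (cdiff_id z) (cdiff_cst w z)))).
  have {}K := K ltac:(by rewrite subr_eq0).
  eexists; apply: (@cdiff_local _ _ _ _ _ (cnorm (z - w)) _ _ K); first by rewrite cnorm_gt0 subr_eq0.
  move=> h hd; rewrite gE//; apply/eqP => E; move: hd.
  by rewrite -E cnormB (_ : z + h - z = h) ?ltxx//; ring.
have gc z : cnorm z < 1 -> ccont g z.
  move=> z1; have [->|zw] := eqVneq z w; last by have [m /cdiff_cont] := gd _ z1 zw.
  apply: ccontM; first exact: cdiff_cont (cdiff_id _).
  apply: (@ccont_comp _ (fun z => z - w) k); last by rewrite subrr.
  exact: cdiff_cont (cdiffB (cdiff_id _) (cdiff_cst _ _)).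
have g0 : cmean g 0 = 0.
  rewrite -[RHS](cmean_cst 0 0); apply: eq_cint => t _.
  by rewrite /rcirc (_ : Complex 0 0 = 0)// mul0r /g mul0r.
(* continuity of the circular means lets the value 0 at radius 0 pass through
   the radius cnorm w, where g fails to be differentiable *)
have pass s t : 0 <= s -> s < 1 -> s < t -> t <= 1 -> (forall r, s < r < t -> cmean g r = cmean g ((s + t) / 2)) ->
    cmean g s = 0 -> forall r, s < r < t -> cmean g r = 0.
  move=> s0 s1 st t1 Hc gs r rst; apply/eqP; rewrite -cnorm_eq0; apply/eqP.
  apply: small_eq0; last exact: cnorm_ge0.
  move=> e e0; have [d d0 Hd] := cmean_cont s0 s1 gc e0.
  pose u := Num.min (s + d / 2) ((s + t) / 2).
  have su : s < u by rewrite lt_min; apply/andP; split; lra.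
  have ut : u < t by rewrite gt_min; apply/orP; right; lra.
  have us : u <= s + d / 2 by rewrite ge_min lexx.
  have := Hd u; rewrite gs subr0 !Hc// ?su//; apply; first by apply/andP; split; lra.
  by rewrite ger0_norm; lra.
have ann s t : 0 <= s -> s < t -> t <= 1 -> (forall z, s < cnorm z < t -> z != w) ->
   forall r, s < r < t -> cmean g r = cmean g ((s + t) / 2).
  move=> s0 st t1 zw r /andP[sr rt].
  have D z : s < cnorm z < t -> exists l, cdiff g z l.
    by move=> zst; apply: gd; [case/andP: zst => _ zt; lra|exact: zw].
  have [h|/ltW h] := leP r ((s + t) / 2).
    by apply: (@cmean_annulus g s t) => //; lra.
  by apply/esym; apply: (@cmean_annulus g s t) => //; lra.
have gw : cmean g (cnorm w) = 0.
  have [->|w0] := eqVneq (cnorm w) 0; first exact: g0.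
  have wp : 0 < cnorm w by rewrite lt_def w0 cnorm_ge0.
  have Z : forall r, 0 < r < cnorm w -> cmean g r = 0.
    apply: pass => //; [exact: ltW|apply: ann => //; first exact: ltW].
    by move=> z /andP[_]; apply: contraTneq => ->; rewrite ltxx.
  apply/eqP; rewrite -cnorm_eq0; apply/eqP; apply: small_eq0; last exact: cnorm_ge0.
  move=> e e0; have [d d0 Hd] := cmean_cont (ltW wp) w1 gc e0.
  pose u := Num.max (cnorm w - d / 2) (cnorm w / 2).
  have u1 : u < cnorm w by rewrite gt_max; apply/andP; split; lra.
  have u2 : 0 < u by rewrite lt_max; apply/orP; right; lra.
  have u3 : cnorm w - d / 2 <= u by rewrite le_max lexx.
  have := Hd u; rewrite Z ?u1 ?u2// sub0r cnormN; apply; first by apply/andP; split; lra.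
  by rewrite distrC ger0_norm; lra.
move=> r wr r1; rewrite -[RHS](_ : cmean g r = 0).
  apply: eq_cint => t _; rewrite -gE//; apply/eqP => E.
  have := @cnorm_rcirc r t; rewrite E => /(_ ltac:(have := cnorm_ge0 w; lra)); lra.
apply: (pass (cnorm w) 1) => //; [exact: cnorm_ge0| |by rewrite wr].
apply: ann => //; first exact: cnorm_ge0.
by move=> z /andP[+ _]; apply: contraTneq => ->; rewrite ltxx.
Qed.

End CircleMean.

(** * Cauchy's formula and the Taylor remainder *)

Section Taylor.
Variable R : realType.
Local Notation C := R[i].
Local Notation mu := (@lebesgue_measure R).
Implicit Types (f g : C -> C).

Definition hol_disk f := forall z : C, cnorm z < 1 -> exists l, cdiff f z l.

Lemma rcont_cnorm (g : R -> C) x : pcont g x -> rcont (fun t => cnorm (g t)) x.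
Proof.
move=> H e /H[d d0 Hd]; exists d => // h /Hd; apply: le_lt_trans.
rewrite ler_norml; apply/andP; split.
  by have := cnorm_sub (g x) (g (x + h)); rewrite (cnormB (g x)); lra.
exact: cnorm_sub.
Qed.

Lemma le_orint (f1 f2 : R -> R) (a b : R) : a <= b -> (forall x, a <= x <= b -> rcont f1 x) ->
  (forall x, a <= x <= b -> rcont f2 x) -> (forall x, a <= x <= b -> f1 x <= f2 x) ->
  orint a b f1 <= orint a b f2.
Proof.
move=> ab H1 H2 H; rewrite !orint_le//.
by apply: le_Rintegral => //; exact: rcont_integrable.
Qed.

Lemma rcontN (f : R -> R) x : rcont f x -> rcont (fun t => - f t) x.
Proof.
by move=> H e /H[d d0 Hd]; exists d => // h /Hd; rewrite -opprD normrN.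
Qed.

Lemma cint_norm_bound (g : R -> C) (G : R -> R) a b : a <= b ->
  (forall x, a <= x <= b -> pcont g x) -> (forall x, a <= x <= b -> rcont G x) ->
  (forall x, a <= x <= b -> cnorm (g x) <= G x) -> cnorm (cint a b g) <= 2 * orint a b G.
Proof.
move=> ab gc Gc le; apply: le_trans (cnorm_leD _) _; rewrite mulr2n mulrDl mul1r.
have GN : orint a b (fun x => - G x) = - orint a b G.
  rewrite -[RHS]mulN1r -orintZ; first by apply: eq_orint => x _; rewrite mulN1r.
  by rewrite min_l// max_r.
apply: lerD; rewrite ler_norml -GN; apply/andP; split; apply: le_orint => // x xab;
  try by [exact: Gc|apply: rcontN; exact: Gc|apply: pcont_Re; exact: gc|apply: pcont_Im; exact: gc].
- by have := le_trans (cnorm_Re (g x)) (le x xab); rewrite ler_norml => /andP[].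
- by have := le_trans (cnorm_Re (g x)) (le x xab); rewrite ler_norml => /andP[].
- by have := le_trans (cnorm_Im (g x)) (le x xab); rewrite ler_norml => /andP[].
- by have := le_trans (cnorm_Im (g x)) (le x xab); rewrite ler_norml => /andP[].
Qed.

Lemma rcirc_neq0 r t : 0 < r -> rcirc r t != 0 :> C.
Proof. by move=> r0; rewrite -cnorm_gt0 cnorm_rcirc ?ltW. Qed.

Lemma cmeanD g1 g2 r : (forall z, cnorm z = r -> ccont g1 z) -> (forall z, cnorm z = r -> ccont g2 z) ->
  0 <= r -> cmean (fun z => g1 z + g2 z) r = cmean g1 r + cmean g2 r.
Proof.
move=> H1 H2 r0; apply: cintD => t _.
  by apply: (@pcont_comp _ g1); [exact: rcirc_pcont|apply: H1; exact: cnorm_rcirc].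
by apply: (@pcont_comp _ g2); [exact: rcirc_pcont|apply: H2; exact: cnorm_rcirc].
Qed.

Lemma cmeanZ (k : C) g r : (forall z, cnorm z = r -> ccont g z) -> 0 <= r ->
  cmean (fun z => k * g z) r = k * cmean g r.
Proof.
move=> H r0; apply: cintZ => t _.
by apply: (@pcont_comp _ g); [exact: rcirc_pcont|apply: H; exact: cnorm_rcirc].
Qed.

Lemma eq_cmean g1 g2 r : 0 <= r -> (forall z, cnorm z = r -> g1 z = g2 z) ->
  cmean g1 r = cmean g2 r.
Proof. by move=> r0 H; apply: eq_cint => t _; apply: H; exact: cnorm_rcirc. Qed.

Lemma cdiff_kernel w z : z != w -> exists l, cdiff (fun z : C => z / (z - w)) z l.
Proof.
move=> zw; eexists; apply: cdiffM (cdiff_id z) (cdiffV _ (cdiffB (cdiff_id z) (cdiff_cst w z))).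
by rewrite subr_eq0.
Qed.

(** The mean does not depend on the radius beyond |w|, and the kernel tends to 1 at infinity. *)
Lemma cmean_kernel w (r : R) : cnorm w < r -> cmean (fun z : C => z / (z - w)) r = 1.
Proof.
move=> wr; have w0 := cnorm_ge0 w.
have zw z : cnorm w < cnorm z -> z != w by apply: contraTneq => ->; rewrite ltxx.
apply/eqP; rewrite -subr_eq0 -cnorm_eq0; apply/eqP.
apply: small_eq0; last exact: cnorm_ge0.
(* At this radius the error 2 |w| / (s - |w|) is at most e. *)
move=> e e0; pose s := r + 2 * cnorm w / e.
have rs : r <= s by rewrite /s lerDl divr_ge0 ?(ltW e0)// mulr_ge0.
rewrite (@cmean_annulus _ _ (cnorm w) (s + 1) r s)//; last 2 first.
- by rewrite ltrDl.
- by move=> z /andP[/zw]; move=> + _; exact: cdiff_kernel.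
have s0 : 0 <= s by lra.
have := @cint_bound _ (fun t => rcirc s t / (rcirc s t - w)) 0 1 1 (cnorm w / (s - cnorm w)).
rewrite subr0 normr1 !mulr1 => H.
have zwt t : rcirc s t != w by apply: zw; rewrite cnorm_rcirc//; lra.
apply: le_trans (H _ _) _.
- move=> t _; have [l /cdiff_cont] := cdiff_kernel (zwt t).
  by apply: (@pcont_comp _ (fun z => z / (z - w))); exact: rcirc_pcont.
- move=> t _; have -> : rcirc s t / (rcirc s t - w) - 1 = w / (rcirc s t - w).
    by field; rewrite subr_eq0.
  rewrite cnormM cnormV ler_wpM2l// lef_pV2 ?posrE.
  + by have := cnorm_sub (rcirc s t) w; rewrite cnorm_rcirc.
  + by rewrite cnorm_gt0 subr_eq0.
  + by lra.
have sw : 0 < s - cnorm w by lra.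
rewrite mulrA ler_pdivrMr//.
have : e * (2 * cnorm w / e) <= e * (s - cnorm w) by rewrite ler_pM2l// /s; lra.
by rewrite mulrC divfK ?gt_eqF.
Qed.

Lemma cauchy_formula f w r : hol_disk f -> cnorm w < r -> r < 1 ->
  cmean (fun z => f z * (z / (z - w))) r = f w.
Proof.
move=> H wr r1; have w0 := cnorm_ge0 w; have r0 : 0 <= r by lra.
have zw z : cnorm z = r -> z != w by move=> zr; apply: contraTneq wr => <-; rewrite zr ltxx.
have kc z : cnorm z = r -> ccont (fun z => z / (z - w)) z.
  by move=> /zw/cdiff_kernel[l]; exact: cdiff_cont.
have := @cauchy_mean0 _ f w (lt_trans wr r1) H r wr r1.
rewrite (@eq_cmean _ (fun z => f z * (z / (z - w)) + (- f w) * (z / (z - w))))//; last first.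
  by move=> z /zw h; field; rewrite subr_eq0.
rewrite cmeanD//; last 2 first.
- move=> z zr; apply: ccontM (kc z zr).
  by have [l /cdiff_cont] := H z ltac:(lra).
- by move=> z zr; apply: ccontM (kc z zr); exact: ccont_cst.
by rewrite cmeanZ// cmean_kernel// mulr1 => /eqP; rewrite subr_eq0 => /eqP.
Qed.

(** The radius 1/2 is arbitrary, by [tcoefE]. *)
Definition tcoef f k : C := cmean (fun z => f z * (z ^+ k)^-1) (1 / 2).

Lemma cdiff_tcoef f k z : hol_disk f -> cnorm z < 1 -> z != 0 ->
  exists l, cdiff (fun z => f z * (z ^+ k)^-1) z l.
Proof.
move=> H z1 z0; have [l Hl] := H z z1.
eexists; apply: cdiffM Hl (cdiffV _ (cdiffX k (cdiff_id z))).
by rewrite expf_neq0.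
Qed.

Lemma tcoefE f k r : hol_disk f -> 0 < r -> r < 1 ->
  tcoef f k = cmean (fun z => f z * (z ^+ k)^-1) r.
Proof.
move=> H r0 r1.
have D z : 0 < cnorm z < 1 -> exists l, cdiff (fun z => f z * (z ^+ k)^-1) z l.
  by move=> /andP[+ z1]; rewrite cnorm_gt0; exact: cdiff_tcoef.
rewrite /tcoef; have [h|/ltW h] := leP r (1 / 2).
  by apply/esym; apply: (@cmean_annulus _ _ 0 1) => //; lra.
by apply: (@cmean_annulus _ _ 0 1) => //; lra.
Qed.

(** Exact remainder by induction on n: z / (z - w) = 1 + (w / z) (z / (z - w)), where the 1 produces
    the next Taylor coefficient. *)
Lemma taylor_identity f w r n : hol_disk f -> cnorm w < r -> r < 1 ->
  f w - \sum_(k < n) tcoef f k * w ^+ k =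
  cmean (fun z => f z * ((w / z) ^+ n * (z / (z - w)))) r.
Proof.
move=> H wr r1; have w0 := cnorm_ge0 w; have r0 : 0 <= r by lra.
have rp : 0 < r by lra.
have zw z : cnorm z = r -> z != w by move=> zr; apply: contraTneq wr => <-; rewrite zr ltxx.
have z0 z : cnorm z = r -> z != 0 by move=> zr; rewrite -cnorm_gt0 zr.
elim: n => [|n IH].
  rewrite big_ord0 subr0 -(cauchy_formula H wr r1); apply: eq_cmean => // z _.
  by rewrite expr0 mul1r.
rewrite big_ord_recr /= opprD addrA {}IH (tcoefE n H rp r1).
rewrite (@eq_cmean _ (fun z => w ^+ n * (f z * (z ^+ n)^-1) +
    f z * ((w / z) ^+ n.+1 * (z / (z - w)))))//; last first.
  move=> z /[dup]/z0 z0' /zw zw'; rewrite exprS expr_div_n; field.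
  by rewrite z0' subr_eq0 zw' expf_neq0.
have c1 z : cnorm z = r -> ccont (fun z => f z * (z ^+ n)^-1) z.
  move=> zr; have [||l] := @cdiff_tcoef f n z H; [by rewrite zr|exact: z0|exact: cdiff_cont].
rewrite cmeanD//; last 2 first.
- by move=> z /c1; apply: ccontM; exact: ccont_cst.
- move=> z zr; apply: ccontM; first by have [l /cdiff_cont] := H z ltac:(lra).
  apply: ccontM; last by have [l /cdiff_cont] := cdiff_kernel (zw z zr).
  apply: cdiff_cont (cdiffX _ (cdiffM (cdiff_cst w z) (cdiff_inv (z0 z zr)))).
by rewrite cmeanZ// mulrC; ring.
Qed.

(** The circle lies halfway between |w| and 1. Its radius r satisfies |w| <= r^2, whence |w / z|^n
    <= r^n, and r / (r - |w|) <= 2 / (1 - |w|). The other factor 2 comes from [cint_norm_bound]. *)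
Lemma taylor_remainder f w n A : hol_disk f -> cnorm w < 1 ->
  orint 0 1 (fun t => cnorm (f (rcirc ((1 + cnorm w) / 2) t))) <= A ->
  cnorm (f w - \sum_(k < n) tcoef f k * w ^+ k) <=
  4 * A * ((1 + cnorm w) / 2) ^+ n / (1 - cnorm w).
Proof.
move=> H w1; set r := (1 + cnorm w) / 2 => AI.
have w0 := cnorm_ge0 w.
have wr : cnorm w < r by rewrite /r; lra.
have r1 : r < 1 by rewrite /r; lra.
have r0 : 0 < r by lra.
rewrite (@taylor_identity f w r)//.
pose B := r ^+ n * (2 / (1 - cnorm w)).
have fc t : pcont (fun t => f (rcirc r t)) t.
  apply: (@pcont_comp _ f); first exact: rcirc_pcont.
  by have [|l /cdiff_cont] := H (rcirc r t); rewrite // cnorm_rcirc// ltW.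
apply: le_trans (@cint_norm_bound _ (fun t => B * cnorm (f (rcirc r t))) 0 1 _ _ _ _) _ => //.
- move=> t _; have zr : cnorm (rcirc r t) = r by rewrite cnorm_rcirc// ltW.
  have zw : rcirc r t != w by apply: contraTneq wr => <-; rewrite zr ltxx.
  apply: (@pcont_comp _ (fun z => f z * ((w / z) ^+ n * (z / (z - w))))); first exact: rcirc_pcont.
  apply: ccontM; first by have [|l /cdiff_cont] := H (rcirc r t); rewrite // zr.
  apply: ccontM; last by have [l /cdiff_cont] := cdiff_kernel zw.
  apply: cdiff_cont (cdiffX _ (cdiffM (cdiff_cst w _) (cdiff_inv _))).
  by rewrite rcirc_neq0.
- by move=> t _; apply: rcontZ; apply: rcont_cnorm.
- move=> t _; have zr : cnorm (rcirc r t) = r by rewrite cnorm_rcirc// ltW.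
  rewrite cnormM mulrC; apply: ler_wpM2r; first exact: cnorm_ge0.
  rewrite (cnormM (_ ^+ n)) cnormX (cnormM w) (cnormM (rcirc r t)) !cnormV zr /B.
  apply: ler_pM.
  + by rewrite exprn_ge0// divr_ge0// ltW.
  + by rewrite divr_ge0 ?cnorm_ge0// ltW.
  + have n1 : 0 <= cnorm w / r by apply: divr_ge0 => //; exact: ltW.
    apply: lerXn2r; rewrite ?nnegrE ?(ltW r0)// ler_pdivrMr// /r.
    by have := sqr_ge0 (1 - cnorm w); rewrite expr2; lra.
  have rw : r - cnorm w <= cnorm (rcirc r t - w).
    by have := cnorm_sub (rcirc r t) w; rewrite zr.
  have rw0 : 0 < r - cnorm w by lra.
  apply: (@le_trans _ _ (r / (r - cnorm w))).
    by apply: ler_wpM2l; [exact: ltW|rewrite lef_pV2 ?posrE//; lra].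
  rewrite ler_pdivrMr// mulrAC ler_pdivlMr; last by lra.
  by rewrite /r; nra.
rewrite orintZ; last by move=> t _; apply: rcont_cnorm.
have B0 : 0 <= B by rewrite mulr_ge0 ?exprn_ge0 ?divr_ge0//; lra.
have := ler_wpM2l B0 AI; rewrite /B => h.
have -> : 4 * A * r ^+ n / (1 - cnorm w) = 2 * (r ^+ n * (2 / (1 - cnorm w)) * A) by ring.
lra.
Qed.

Lemma hol_disk_pcont f r t : hol_disk f -> 0 <= r < 1 -> pcont (fun t => f (rcirc r t)) t.
Proof.
move=> H /andP[r0 r1]; apply: (@pcont_comp _ f); first exact: rcirc_pcont.
by have [|l /cdiff_cont] := H (rcirc r t); rewrite // cnorm_rcirc.
Qed.

Lemma rcontM (f1 f2 : R -> R) x : rcont f1 x -> rcont f2 x -> rcont (fun t => f1 t * f2 t) x.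
Proof. by move=> /rcontP H /rcontP K; apply/rcontP; exact: cvgM. Qed.

Lemma rcontD (f1 f2 : R -> R) x : rcont f1 x -> rcont f2 x -> rcont (fun t => f1 t + f2 t) x.
Proof. by move=> /rcontP H /rcontP K; apply/rcontP; exact: cvgD. Qed.

Lemma rcont_cst (c : R) x : rcont (fun=> c) x.
Proof. by apply/rcontP; exact: cvg_cst. Qed.

Lemma orint_cst (a b c : R) : orint a b (fun=> c) = c * (b - a).
Proof.
have := @orint_bound R (fun=> c) a b c 0 (fun x _ => rcont_cst c x).
rewrite mul0r => H; apply/eqP; rewrite -subr_eq0 -normr_le0; apply: H => x _.
by rewrite subrr normr0.
Qed.

Lemma mean2E f r : hol_disk f -> 0 <= r < 1 ->
  mean2 f r = (orint 0 1 (fun t => cnorm (f (rcirc r t)) ^+ 2))%:E.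
Proof.
move=> H r01; rewrite orint_le// /mean2.
have I : mu.-integrable `[0%R, 1%R] (EFin \o (fun t => cnorm (f (rcirc r t)) ^+ 2)).
  apply: rcont_integrable => t _.
  have c1 : rcont (fun t => cnorm (f (rcirc r t))) t by apply: rcont_cnorm; exact: hol_disk_pcont.
  exact: (rcontM c1 c1).
rewrite -Rintegral_itv_bndo_bndc; last first.
  by apply: integrableS I => // x /=; rewrite !in_itv/= => /andP[-> /ltW ->].
rewrite /Rintegral fineK//; apply: integrable_fin_num => //.
by apply: integrableS I => // x /=; rewrite !in_itv/= => /andP[-> /ltW ->].
Qed.

(** Uses x <= (1 + x^2) / 2 rather than the Cauchy-Schwarz inequality, so that the bound is affine
    in N. *)
Lemma mean1_le f r (N : R) : hol_disk f -> 0 <= r < 1 -> (mean2 f r <= N%:E)%E ->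
  orint 0 1 (fun t => cnorm (f (rcirc r t))) <= (1 + N) / 2.
Proof.
move=> H r01; rewrite mean2E// lee_fin => le.
have c1 t : rcont (fun t => cnorm (f (rcirc r t))) t by apply: rcont_cnorm; exact: hol_disk_pcont.
have c2 t : rcont (fun t => cnorm (f (rcirc r t)) ^+ 2) t by exact: (rcontM (c1 t) (c1 t)).
apply: (@le_trans _ _ (orint 0 1 (fun t => 1 / 2 * (1 + cnorm (f (rcirc r t)) ^+ 2)))).
  apply: le_orint => // t _.
    by apply: rcontZ; apply: rcontD => //; exact: rcont_cst.
  by have := sqr_ge0 (cnorm (f (rcirc r t)) - 1); rewrite !expr2; lra.
rewrite orintZ ?orintD ?orint_cst; try by move=> t _ //; first [exact: rcont_cst|
  by apply: rcontD => //; exact: rcont_cst].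
by lra.
Qed.

End Taylor.

(** * Absolutely convergent series *)

Section Series.
Variable R : realType.
Local Notation C := R[i].
Implicit Types (a b m : nat -> R) (c d : nat -> C).

Definition rcv a := cvgn (series a).
Definition rsum a : R := limn (series a).

Lemma rcv_le a m : (forall k, `|a k| <= m k) -> rcv m -> rcv a.
Proof.
move=> le cm; apply: normed_cvg; apply: series_le_cvg cm => // k.
  exact: normr_ge0.
exact: (le_trans (normr_ge0 _) (le k)).
Qed.

Lemma rsum_norm a m : (forall k, `|a k| <= m k) -> rcv m -> `|rsum a| <= rsum m.
Proof.
move=> le cm; have ca : cvgn [normed series a].
  apply: series_le_cvg cm => // k; first exact: normr_ge0.
  exact: (le_trans (normr_ge0 _) (le k)).
by apply: le_trans (lim_series_norm ca) _; exact: lim_series_le.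
Qed.

Lemma rsum_le a b : rcv a -> rcv b -> (forall k, a k <= b k) -> rsum a <= rsum b.
Proof. exact: lim_series_le. Qed.

Lemma rcvB a b : rcv a -> rcv b -> rcv (fun k => a k - b k).
Proof. exact: is_cvg_seriesB. Qed.

Lemma rsumB a b : rcv a -> rcv b -> rsum (fun k => a k - b k) = rsum a - rsum b.
Proof. exact: lim_seriesB. Qed.

Lemma rcvD a b : rcv a -> rcv b -> rcv (fun k => a k + b k).
Proof. exact: is_cvg_seriesD. Qed.

Lemma rsumD a b : rcv a -> rcv b -> rsum (fun k => a k + b k) = rsum a + rsum b.
Proof. exact: lim_seriesD. Qed.

Lemma rcvZ a (r : R) : rcv a -> rcv (fun k => r * a k).
Proof. exact: is_cvg_seriesZ. Qed.

Lemma rsumZ a (r : R) : rcv a -> rsum (fun k => r * a k) = r * rsum a.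
Proof. exact: lim_seriesZ. Qed.

Lemma rcv0 : rcv (fun=> 0).
Proof.
rewrite /rcv (_ : series _ = fun=> 0); first exact: is_cvg_cst.
by apply/funext => n; rewrite /series /= big1.
Qed.

Lemma rsum0 : rsum (fun=> 0) = 0.
Proof.
rewrite /rsum (_ : series _ = fun=> 0); first exact: lim_cst.
by apply/funext => n; rewrite /series /= big1.
Qed.

Lemma rsum_ge0 a : rcv a -> (forall k, 0 <= a k) -> 0 <= rsum a.
Proof. by move=> ca a0; rewrite -rsum0; apply: rsum_le => //; exact: rcv0. Qed.

Lemma rsum_term a n : rcv a -> (forall k, 0 <= a k) -> a n <= rsum a.
Proof.
move=> ca a0; apply: (@le_trans _ _ (series a n.+1)).
  rewrite /series /= big_nat_recr//= lerDr; apply: sumr_ge0 => i _; exact: a0.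
apply: nondecreasing_cvgn_le => //.
by apply: nondecreasing_series => k _ _; exact: a0.
Qed.

Lemma geometric_half : geometric 1 2^-1 = (fun k => (2 ^+ k)^-1) :> (nat -> R).
Proof. by apply/funext => k; rewrite /geometric /= mul1r exprVn. Qed.

Lemma norm_half_lt1 : `|2^-1 : R| < 1.
Proof. by rewrite ger0_norm; lra. Qed.

Lemma rcv_half : rcv (fun k => (2 ^+ k)^-1).
Proof.
by have := @is_cvg_geometric_series R 1 _ norm_half_lt1; rewrite geometric_half.
Qed.

Lemma rsum_half : rsum (fun k => (2 ^+ k)^-1) = 2.
Proof.
have := @cvg_geometric_series R 1 _ norm_half_lt1; rewrite geometric_half.
by move=> /(cvg_lim (@Rhausdorff R)); rewrite /rsum => ->; field.
Qed.

Definition ccv c := rcv (fun k => complex.Re (c k)) /\ rcv (fun k => complex.Im (c k)).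
Definition csum c : C := Complex (rsum (fun k => complex.Re (c k))) (rsum (fun k => complex.Im (c k))).

Lemma ccv_le c m : (forall k, cnorm (c k) <= m k) -> rcv m -> ccv c.
Proof.
move=> le cm; split; apply: rcv_le cm => k; apply: le_trans (le k); [exact: cnorm_Re|exact: cnorm_Im].
Qed.

Lemma csum_norm c m : (forall k, cnorm (c k) <= m k) -> rcv m -> cnorm (csum c) <= 2 * rsum m.
Proof.
move=> le cm; apply: le_trans (cnorm_leD _) _; rewrite mulr2n mulrDl mul1r /=.
by apply: lerD; apply: rsum_norm => // k; apply: le_trans (le k); [exact: cnorm_Re|exact: cnorm_Im].
Qed.

Lemma csumB c d : ccv c -> ccv d -> csum (fun k => c k - d k) = csum c - csum d.
Proof.
move=> [c1 c2] [d1 d2]; rewrite /csum Complex_opp Complex_add -!rsumB//.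
by congr Complex; congr rsum; apply/funext => k; rewrite ?cReD ?cReN ?cImD ?cImN.
Qed.

Lemma ccvZ c (l : C) : ccv c -> ccv (fun k => l * c k).
Proof.
move=> [c1 c2]; split.
  rewrite (_ : (fun k => _) = (fun k => complex.Re l * complex.Re (c k) - complex.Im l * complex.Im (c k))).
    by apply: rcvB; exact: rcvZ.
  by apply/funext => k; rewrite cReM.
rewrite (_ : (fun k => _) = (fun k => complex.Re l * complex.Im (c k) + complex.Im l * complex.Re (c k))).
  by apply: rcvD; exact: rcvZ.
by apply/funext => k; rewrite cImM.
Qed.

Lemma ccvB c d : ccv c -> ccv d -> ccv (fun k => c k - d k).
Proof.
move=> [c1 c2] [d1 d2]; split.
  rewrite (_ : (fun k => _) = (fun k => complex.Re (c k) - complex.Re (d k))); first exact: rcvB.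
  by apply/funext => k; rewrite cReD cReN.
rewrite (_ : (fun k => _) = (fun k => complex.Im (c k) - complex.Im (d k))); first exact: rcvB.
by apply/funext => k; rewrite cImD cImN.
Qed.

Lemma csumZ c (l : C) : ccv c -> csum (fun k => l * c k) = l * csum c.
Proof.
case: l => p q [c1 c2]; rewrite /csum Complex_mul -!rsumZ//.
rewrite -rsumB; [|exact: rcvZ|exact: rcvZ]; rewrite -rsumD; [|exact: rcvZ|exact: rcvZ].
by congr Complex; congr rsum; apply/funext => k; rewrite ?cReM ?cImM.
Qed.

(** * Discrete Stieltjes transforms *)

Section Stieltjes.
Variables (X g : nat -> R).
Hypothesis X1 : forall k, 1 <= X k.
Hypothesis g0 : forall k, 0 <= g k.
Hypothesis gX : rcv (fun k => g k / X k).

Definition stj (w : C) : C := csum (fun k => Complex (g k) 0 / (Complex (X k) 0 + w)).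
Definition stj' (w : C) : C := csum (fun k => - Complex (g k) 0 / (Complex (X k) 0 + w) ^+ 2).
Definition rstj (x : R) : R := rsum (fun k => g k / (X k + x)).

(** The margin to the left of the imaginary axis leaves room for increments in all directions at
    points with Re w = 0. *)
Lemma stj_denom w k : - (1 / 2) <= complex.Re w -> X k / 2 <= cnorm (Complex (X k) 0 + w).
Proof.
move=> w0; apply: le_trans (cnorm_Re _); apply: le_trans (ler_norm _); rewrite cReD /=.
by have := X1 k; lra.
Qed.

Lemma stj_denom1 w k : 0 <= complex.Re w -> X k + complex.Re w <= cnorm (Complex (X k) 0 + w).
Proof.
by move=> w0; apply: le_trans (cnorm_Re _); apply: le_trans (ler_norm _); rewrite cReD.
Qed.

Lemma stj_denom0 w k : - (1 / 2) <= complex.Re w -> Complex (X k) 0 + w != 0.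
Proof.
by move=> /(stj_denom k) h; rewrite -cnorm_gt0; have := X1 k; lra.
Qed.

Lemma ccv_stj w : - (1 / 2) <= complex.Re w -> ccv (fun k => Complex (g k) 0 / (Complex (X k) 0 + w)).
Proof.
move=> w0; apply: (@ccv_le _ (fun k => 2 * (g k / X k))); last exact: rcvZ.
move=> k; rewrite cnormM cnormV cnorm_real ger0_norm//.
rewrite (_ : 2 * _ = g k * (X k / 2)^-1); last by rewrite invf_div; ring.
apply: ler_wpM2l => //; have := X1 k => Xk; have h := stj_denom k w0.
by rewrite lef_pV2 ?posrE//; lra.
Qed.

Lemma ccv_stj' w : 0 <= complex.Re w -> ccv (fun k => - Complex (g k) 0 / (Complex (X k) 0 + w) ^+ 2).
Proof.
move=> w0; apply: (@ccv_le _ (fun k => g k / X k)) => // k.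
rewrite cnormM cnormN cnormV cnormX cnorm_real ger0_norm//.
apply: ler_wpM2l => //; have Xk := X1 k; have h := stj_denom1 k w0.
rewrite lef_pV2 ?posrE//; last 2 first.
- by rewrite exprn_gt0//; lra.
- by lra.
by rewrite expr2; nra.
Qed.

(** The second order remainder of the k-th term is at most 2 |h|^2 g_k / X_k, so summability of g_k
    / X_k is enough to differentiate termwise. The 4 in the radius is this 2 times the 2 of
    [csum_norm]. *)
Lemma cdiff_stj w : 0 <= complex.Re w -> cdiff stj w (stj' w).
Proof.
move=> w0 e e0; pose S := rsum (fun k => g k / X k).
have S0 : 0 <= S by apply: rsum_ge0 => // k; rewrite divr_ge0// (le_trans ler01).
exists (Num.min (1 / 2) (e / (4 * S + 1))).
  by rewrite lt_min; apply/andP; split; [lra|rewrite divr_gt0//; lra].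
move=> h; rewrite lt_min => /andP[h1 h2].
have {}h2 : cnorm h * (4 * S + 1) < e by rewrite -ltr_pdivlMr//; lra.
have wh : - (1 / 2) <= complex.Re (w + h).
  by have := cnorm_Re h; rewrite ler_norml cReD => /andP[]; lra.
have w2 : - (1 / 2) <= complex.Re w by lra.
rewrite (mulrC (stj' w)) /stj /stj' -csumZ; last exact: ccv_stj'.
rewrite -csumB; [|exact: ccv_stj|exact: ccv_stj].
rewrite -csumB; [|by apply: ccvB; exact: ccv_stj|by apply: ccvZ; exact: ccv_stj'].
apply: le_trans (@csum_norm _ (fun k => 2 * cnorm h ^+ 2 * (g k / X k)) _ _) _.
- move=> k; have Xk := X1 k.
  have z0 := stj_denom0 k w2; have zh0 := stj_denom0 k wh.
  have d1 := stj_denom1 k w0; have d2 := stj_denom k wh.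
  set z := Complex (X k) 0 in z0 zh0 d1 d2 *.
  have -> : Complex (g k) 0 / (z + (w + h)) - Complex (g k) 0 / (z + w) -
     h * (- Complex (g k) 0 / (z + w) ^+ 2) =
     Complex (g k) 0 * h ^+ 2 / ((z + w) ^+ 2 * (z + (w + h))).
    by field; rewrite z0 zh0.
  rewrite cnormM (cnormM (Complex (g k) 0)) cnormV (cnormM (_ ^+ 2)) !cnormX cnorm_real ger0_norm//.
  set a := cnorm (z + w) in d1 *; set b := cnorm (z + (w + h)) in d2 *.
  rewrite (_ : 2 * _ * _ = g k * cnorm h ^+ 2 * (2 / X k)); last by ring.
  apply: ler_wpM2l; first by rewrite mulr_ge0 ?sqr_ge0.
  have a1 : 1 <= a by lra.
  have b0 : 0 < b by lra.
  have aa : 1 <= a ^+ 2 by rewrite expr2; nra.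
  rewrite -[leRHS]invf_div lef_pV2 ?posrE ?mulr_gt0//; try lra.
  by nra.
- exact: rcvZ.
rewrite rsumZ// -/S.
have : cnorm h * (cnorm h * (4 * S + 1)) <= cnorm h * e.
  by apply: ler_wpM2l; [exact: cnorm_ge0|exact: ltW].
have := sqr_ge0 (cnorm h); rewrite !expr2; nra.
Qed.

Lemma rcv_rstj x : 0 <= x -> rcv (fun k => g k / (X k + x)).
Proof.
move=> x0; apply: rcv_le gX => k; have Xk := X1 k.
rewrite ger0_norm; last by rewrite divr_ge0//; lra.
by rewrite ler_wpM2l// lef_pV2 ?posrE//; lra.
Qed.

Lemma stj_real x : stj (Complex x 0) = Complex (rstj x) 0.
Proof.
rewrite /stj /csum /rstj.
have E k : Complex (g k) 0 / (Complex (X k) 0 + Complex x 0) = Complex (g k / (X k + x)) 0.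
  have -> : (Complex (X k) 0 + Complex x 0) = Complex (X k + x) 0 by rewrite Complex_add addr0.
  have -> : (Complex (X k + x) 0)^-1 = Complex (X k + x)^-1 0.
    by rewrite -[LHS]/(((X k + x)%:C)%C^-1) -fmorphV.
  by rewrite Complex_mul; congr Complex; ring.
congr Complex; first by congr rsum; apply/funext => k; rewrite E.
by rewrite -[RHS]rsum0; congr rsum; apply/funext => k; rewrite E.
Qed.

End Stieltjes.

End Series.

(** * A slowly decaying function on the half-line *)

Section SlowFunction.
Variable R : realType.
Local Notation C := R[i].

Section Weights.
Variables (M : R) (q : nat -> R).
Hypothesis M2 : 2 <= M.
Hypothesis qM : forall k, 2 ^+ k * M <= q k.

(* Since wb k >= M, the reciprocal of ur is (1/M)-Lipschitz; since ur x stays above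
   a multiple of (2 ^+ k * q k)^-1 for x <= wX k, it decays as slowly as q grows fast. *)
Definition wX k := q k ^+ 2.
Definition wb k := q k / 2 ^+ k.

Let pw k : 0 < 2 ^+ k :> R. Proof. exact: exprn_gt0. Qed.
Let pw1 k : 1 <= 2 ^+ k :> R. Proof. by apply: exprn_ege1; lra. Qed.

Lemma q_ge2 k : 2 <= q k.
Proof. apply: le_trans (qM k); apply: le_trans M2 _.
by rewrite ler_peMl// (le_trans _ M2).
Qed.

Lemma wX_ge2 k : 2 <= wX k.
Proof. by rewrite /wX expr2; have := q_ge2 k; nra. Qed.

Lemma wX_ge1 k : 1 <= wX k.
Proof. by have := wX_ge2 k; lra. Qed.

Lemma wb_geM k : M <= wb k.
Proof. by rewrite /wb ler_pdivlMr// mulrC. Qed.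

Lemma wb_ge0 k : 0 <= wb k.
Proof. by have := wb_geM k; move: M2; lra. Qed.

Lemma wbX_le k : `|wb k / wX k| <= M^-1 * (2 ^+ k)^-1.
Proof.
have q2 := q_ge2 k; have q0 : 0 < q k by lra.
rewrite ger0_norm; last by rewrite divr_ge0 ?wb_ge0// (le_trans _ (wX_ge1 k)).
have -> : wb k / wX k = (q k)^-1 * (2 ^+ k)^-1.
  by rewrite /wb /wX; field; rewrite !gt_eqF.
apply: ler_wpM2r; first by rewrite invr_ge0 ltW.
rewrite lef_pV2 ?posrE//; last by move: M2; lra.
by apply: le_trans (qM k); rewrite ler_peMl//; move: M2; lra.
Qed.

Lemma rcv_wbX : rcv (fun k => wb k / wX k).
Proof. by apply: rcv_le wbX_le _; apply: rcvZ; exact: rcv_half. Qed.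

Definition ur (x : R) := rstj wX wb x.

Lemma rcv_ur x : 0 <= x -> rcv (fun k => wb k / (wX k + x)).
Proof. exact: (rcv_rstj wX_ge1 wb_ge0 rcv_wbX). Qed.

Lemma ur_term_ge0 x k : 0 <= x -> 0 <= wb k / (wX k + x).
Proof. by move=> x0; rewrite divr_ge0 ?wb_ge0//; have := wX_ge1 k; lra. Qed.

Lemma ur_term x k : 0 <= x -> wb k / (wX k + x) <= ur x.
Proof.
by move=> x0; apply: (rsum_term k (rcv_ur x0)) => j; exact: ur_term_ge0.
Qed.

Lemma ur_gt0 x : 0 <= x -> 0 < ur x.
Proof.
move=> x0; apply: lt_le_trans (ur_term 0 x0).
by rewrite divr_gt0//; [have := wb_geM 0; move: M2; lra|have := wX_ge1 0; lra].
Qed.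

Lemma ur_mono x y : 0 <= x -> x <= y -> ur y <= ur x.
Proof.
move=> x0 xy; apply: rsum_le => [||k]; [exact/rcv_ur/(le_trans x0)|exact: rcv_ur|].
rewrite ler_wpM2l ?wb_ge0// lef_pV2 ?posrE; have := wX_ge1 k; lra.
Qed.

Lemma ur_le x : 0 <= x -> ur x <= 2 / M.
Proof.
move=> x0; rewrite mulrC -rsum_half -rsumZ; last exact: rcv_half.
apply: le_trans (ur_mono (lexx 0) x0) _; apply: le_trans (ler_norm _) _.
apply: rsum_norm => [k|]; last by apply: rcvZ; exact: rcv_half.
by rewrite addr0 wbX_le.
Qed.

(** The difference of the k-th terms is (y - x) / b_k times their product. Here b_k >= M, the term
    at y is at most the whole sum [ur y], and the terms at x are summed up. *)
Lemma ur_lip x y : 0 <= x -> x <= y -> ur x - ur y <= (y - x) / M * (ur x * ur y).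
Proof.
move=> x0 xy; have y0 := le_trans x0 xy.
have K : (y - x) / M * (ur x * ur y) = rsum (fun k => ((y - x) / M * ur y) * (wb k / (wX k + x))).
  rewrite rsumZ; last exact: rcv_ur.
  by rewrite -[rsum _]/(ur x); ring.
rewrite K -rsumB; [|exact: rcv_ur|exact: rcv_ur].
apply: rsum_le => [||k]; first by apply: rcvB; exact: rcv_ur.
  by apply: rcvZ; exact: rcv_ur.
have bM := wb_geM k; have X2 := wX_ge2 k.
have b0 : 0 < wb k by move: M2; lra.
have M0 : 0 < M by move: M2; lra.
have -> : wb k / (wX k + x) - wb k / (wX k + y) =
   ((y - x) / wb k * (wb k / (wX k + y))) * (wb k / (wX k + x)).
  by field; rewrite !gt_eqF//; lra.
apply: ler_wpM2r; first exact: ur_term_ge0.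
apply: ler_pM; [by rewrite divr_ge0 ?subr_ge0 ?wb_ge0|exact: ur_term_ge0| |exact: ur_term].
by rewrite ler_wpM2l ?subr_ge0// lef_pV2 ?posrE.
Qed.

(** The argument of [ur_lip] at a complex point, with |X_k + w| >= (X_k + x) / 2. The 4 combines
    this loss with the 2 of [csum_norm]. *)
Lemma u_near (w : C) x : 0 <= x -> 0 <= complex.Re w -> x - 1 <= complex.Re w ->
  cnorm (stj wX wb w - Complex (ur x) 0) <= 4 / M * cnorm (w - Complex x 0) * ur x ^+ 2.
Proof.
move=> x0 w0 wx; rewrite /ur -stj_real /stj.
have xr : - (1 / 2) <= complex.Re (Complex x 0 : C) by rewrite /=; lra.
have wr : - (1 / 2) <= complex.Re w by lra.
rewrite -csumB; [|exact: (ccv_stj wX_ge1 wb_ge0 rcv_wbX)|exact: (ccv_stj wX_ge1 wb_ge0 rcv_wbX)].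
have M0 : 0 < M by move: M2; lra.
set D := cnorm (w - Complex x 0).
apply: le_trans (@csum_norm _ _ (fun k => (2 / M * D * ur x) * (wb k / (wX k + x))) _ _) _.
- move=> k; have bM := wb_geM k; have X2 := wX_ge2 k.
  have b0 : 0 < wb k by move: M2; lra.
  have z1 := stj_denom0 wX_ge1 k xr; have z2 := stj_denom0 wX_ge1 k wr.
  have d := stj_denom1 wX k w0.
  have -> : Complex (wb k) 0 / (Complex (wX k) 0 + w) - Complex (wb k) 0 / (Complex (wX k) 0 + Complex x 0)
     = Complex (wb k) 0 * (Complex x 0 - w) / ((Complex (wX k) 0 + w) * (Complex (wX k) 0 + Complex x 0)).
    by field; rewrite z1 z2.
  rewrite !cnormM cnormV cnormM cnorm_real (ger0_norm (ltW b0)) (cnormB _ w) -/D.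
  rewrite Complex_add addr0 cnorm_real (ger0_norm (_ : 0 <= wX k + x)); last by lra.
  set a := cnorm (Complex (wX k) 0 + w) in d *.
  have a2 : (wX k + x) / 2 <= a by lra.
  have a0 : 0 < a by lra.
  have -> : wb k * D / (a * (wX k + x)) = D / a * (wb k / (wX k + x)).
    by field; rewrite !gt_eqF//; lra.
  apply: ler_wpM2r; first exact: ur_term_ge0.
  apply: (@le_trans _ _ (D * (2 / (wX k + x)))).
    apply: ler_wpM2l; first exact: cnorm_ge0.
    by rewrite -[leRHS]invf_div lef_pV2 ?posrE//; lra.
  have t := ur_term k x0.
  have : M / (wX k + x) <= ur x.
    by apply: le_trans t; rewrite ler_wpM2r// invr_ge0; lra.
  rewrite ler_pdivrMr; last by lra.
  move=> h; have D0 : 0 <= D := cnorm_ge0 _.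
  rewrite (_ : 2 / M * D * ur x = D * (2 / M * ur x)); last by ring.
  apply: ler_wpM2l => //; rewrite ler_pdivrMr; last by lra.
  have -> : 2 / M * ur x * (wX k + x) = 2 * (ur x * (wX k + x) / M) by ring.
  have : 1 <= ur x * (wX k + x) / M by rewrite ler_pdivlMr// mul1r.
  lra.
- by apply: rcvZ; exact: rcv_ur.
rewrite rsumZ; last exact: rcv_ur.
by rewrite -[rsum _]/(ur x) -[rstj _ _ _]/(ur x) le_eqVlt; apply/orP; left; apply/eqP; ring.
Qed.

(* By Cauchy-Schwarz [ur ^+ 2 <= Vf'], so the bounded function Vf controls the
   integral of [ur ^+ 2] over a half-line. *)
Definition vg k := (2 ^+ k)^-1 * wX k.

Lemma vg_ge0 k : 0 <= vg k.
Proof. by rewrite mulr_ge0 ?invr_ge0 ?ltW// (lt_le_trans _ (wX_ge1 k)). Qed.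

Lemma vgX k : vg k / wX k = (2 ^+ k)^-1.
Proof. by rewrite /vg mulfK// gt_eqF// (lt_le_trans _ (wX_ge1 k)). Qed.

Lemma rcv_vgX : rcv (fun k => vg k / wX k).
Proof. by rewrite (_ : (fun k => _) = fun k => (2 ^+ k)^-1); [exact: rcv_half|apply/funext => k; exact: vgX]. Qed.

Definition Vf (x : R) := - 2 * rstj wX vg x.
Definition Vf' (x : R) := 2 * rsum (fun k => vg k / (wX k + x) ^+ 2).

Lemma Vf_bound x : 0 <= x -> - 4 <= Vf x <= 0.
Proof.
move=> x0; rewrite /Vf.
have c1 := rcv_rstj wX_ge1 vg_ge0 rcv_vgX x0.
have h0 : 0 <= rstj wX vg x.
  by apply: rsum_ge0 => // k; rewrite divr_ge0 ?vg_ge0//; have := wX_ge1 k; lra.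
have : rstj wX vg x <= 2.
  rewrite -rsum_half; apply: rsum_le => //; first exact: rcv_half.
  by move=> k; rewrite -vgX ler_wpM2l ?vg_ge0// lef_pV2 ?posrE; have := wX_ge1 k; lra.
by move=> ?; apply/andP; split; lra.
Qed.

(** The Cauchy-Riemann equations, in the form of derivatives along horizontal and vertical lines. *)
Lemma cdiff_rdiff (f : C -> C) (x y : R) l : cdiff f (Complex x y) l ->
  [/\ rdiff (fun t => complex.Re (f (Complex t y))) x (complex.Re l),
      rdiff (fun t => complex.Im (f (Complex t y))) x (complex.Im l),
      rdiff (fun t => complex.Re (f (Complex x t))) y (- complex.Im l) &
      rdiff (fun t => complex.Im (f (Complex x t))) y (complex.Re l)].
Proof.
move=> H.
have Hh e : 0 < e -> exists2 d : R, 0 < d & forall h : R, `|h| < d ->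
    cnorm (f (Complex (x + h) y) - f (Complex x y) - l * Complex h 0) <= e * `|h|.
  move=> /H[d d0 Hd]; exists d => // h hd.
  have := Hd (Complex h 0); rewrite cnorm_real => /(_ hd).
  by rewrite Complex_add addr0.
have Hv e : 0 < e -> exists2 d : R, 0 < d & forall h : R, `|h| < d ->
    cnorm (f (Complex x (y + h)) - f (Complex x y) - l * Complex 0 h) <= e * `|h|.
  move=> /H[d d0 Hd]; exists d => // h hd.
  have := Hd (Complex 0 h); rewrite cnorm_imag => /(_ hd).
  by rewrite Complex_add addr0.
split=> e e0.
- have [d d0 Hd] := Hh _ e0; exists d => // h /Hd; apply: le_trans.
  apply: le_trans (cnorm_Re _); rewrite !cReD !cReN cReM /= mulr0 subr0.
  exact: lexx.
- have [d d0 Hd] := Hh _ e0; exists d => // h /Hd; apply: le_trans.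
  apply: le_trans (cnorm_Im _); rewrite !cImD !cImN cImM /= mulr0 add0r.
  exact: lexx.
- have [d d0 Hd] := Hv _ e0; exists d => // h /Hd; apply: le_trans.
  apply: le_trans (cnorm_Re _); rewrite !cReD !cReN cReM /= mulr0 sub0r mulNr.
  exact: lexx.
- have [d d0 Hd] := Hv _ e0; exists d => // h /Hd; apply: le_trans.
  apply: le_trans (cnorm_Im _); rewrite !cImD !cImN cImM /= mulr0 addr0.
  exact: lexx.
Qed.

Lemma rdiff_eq (f : R -> R) x l l' : rdiff f x l -> l = l' -> rdiff f x l'.
Proof. by move=> + <-. Qed.

Lemma Vf_rdiff x : 0 <= x -> rdiff Vf x (Vf' x).
Proof.
move=> x0; have x0' : 0 <= complex.Re (Complex x 0 : C) by [].
have D := cdiffZ (Complex (- 2) 0) (cdiff_stj wX_ge1 vg_ge0 rcv_vgX x0').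
have [+ _ _ _] := cdiff_rdiff D.
rewrite (_ : (fun t => _) = Vf); last first.
  by apply/funext => t; rewrite /Vf stj_real Complex_mul /= !mulr0 subr0.
have -> (z : C) : complex.Re (Complex (- 2) 0 * z) = - 2 * complex.Re z.
  by rewrite cReM /= mul0r subr0.
move/rdiff_eq; apply; rewrite /Vf' mulNr -mulrN.
congr (_ * _); rewrite -[LHS]mulN1r -[complex.Re _]/(rsum _) -rsumZ; last first.
  by have [] := ccv_stj' wX_ge1 vg_ge0 rcv_vgX x0'.
congr rsum; apply/funext => k; rewrite mulN1r.
have -> : (Complex (wX k) 0 + Complex x 0) ^+ 2 = Complex ((wX k + x) ^+ 2) 0.
  by rewrite Complex_add addr0 expr2 Complex_mul expr2; congr Complex; ring.
have -> : (Complex ((wX k + x) ^+ 2) 0)^-1 = Complex ((wX k + x) ^+ 2)^-1 0.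
  by rewrite -[LHS]/((((wX k + x) ^+ 2)%:C)%C^-1) -fmorphV.
by rewrite Complex_opp Complex_mul /=; ring.
Qed.

Lemma ur_sqr_le x : 0 <= x -> ur x ^+ 2 <= Vf' x.
Proof.
move=> x0; rewrite /Vf'.
have c2 : rcv (fun k => vg k / (wX k + x) ^+ 2).
  apply: rcv_le rcv_vgX => k; have := wX_ge2 k => X2.
  rewrite ger0_norm; last by rewrite divr_ge0 ?vg_ge0// exprn_ge0//; lra.
  have Xx : 0 < wX k + x by lra.
  have h1 : 0 <= (wX k + x - 2) * (wX k + x) by rewrite mulr_ge0//; lra.
  apply: ler_wpM2l; first exact: vg_ge0.
  have X0 : 0 < wX k by lra.
  by rewrite lef_pV2 ?posrE ?(exprn_gt0 _ Xx)// expr2; lra.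
(* Cauchy-Schwarz by summing (2^k)^-1 (q_k / (X_k + x) - L)^2 >= 0. The weights add up to 2, and
   this L is the optimal one. *)
pose L := ur x / 2.
have : rsum (fun k => (2 * L) * (wb k / (wX k + x)) - L ^+ 2 * (2 ^+ k)^-1) <=
    rsum (fun k => vg k / (wX k + x) ^+ 2).
  apply: rsum_le => //.
    by apply: rcvB; apply: rcvZ; [exact: rcv_ur|exact: rcv_half].
  move=> k; have X2 := wX_ge2 k; have := sqr_ge0 (q k / (wX k + x) - L) => h.
  have : 0 <= (2 ^+ k)^-1 * (q k / (wX k + x) - L) ^+ 2 by rewrite mulr_ge0// invr_ge0 ltW.
  have -> : wb k / (wX k + x) = (2 ^+ k)^-1 * (q k / (wX k + x)) by rewrite /wb; ring.
  have -> : vg k / (wX k + x) ^+ 2 = (2 ^+ k)^-1 * (q k / (wX k + x)) ^+ 2.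
    by rewrite /vg /wX exprMn exprVn; ring.
  set A := q k / _; set P := (2 ^+ k)^-1; rewrite !expr2; lra.
rewrite rsumB; [|by apply: rcvZ; exact: rcv_ur|by apply: rcvZ; exact: rcv_half].
rewrite !rsumZ; [|exact: rcv_half|exact: rcv_ur].
rewrite rsum_half -[X in 2 * L * X]/(ur x) /L expr2; lra.
Qed.

End Weights.

End SlowFunction.

(** * Transport of the slow function to the strip *)

Section SlowStrip.
Variable R : realType.
Local Notation C := R[i].

(** Carries the line to the half-line on which [ur] lives: close to x on the right and close to 0 on
    the left, where [ur] therefore stays away from 0. *)
Definition lsp (x : R) : R := ln (1 + expR x).
Definition wlog1p (z : C) : C := clog (1 + cexp z).

Let e1_gt0 (x : R) : 0 < 1 + expR x.
Proof. by have := expR_gt0 x; lra. Qed.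

Lemma lsp_ge0 x : 0 <= lsp x.
Proof. by rewrite ln_ge0//; have := expR_gt0 x; lra. Qed.

Lemma lsp_mono x y : x <= y -> lsp x <= lsp y.
Proof. by move=> xy; rewrite ler_ln ?posrE// lerD2l ler_expR. Qed.

Lemma lsp_lip x y : x <= y -> lsp y - lsp x <= y - x.
Proof.
move=> xy; rewrite lerBlDr -[leRHS]expRK -/(lsp y) ler_ln ?posrE ?expR_gt0//.
rewrite expRD lnK ?posrE// mulrDr mulr1 -expRD subrK lerD2r.
by rewrite -expR0 ler_expR subr_ge0.
Qed.

Lemma lsp_ge x : x <= lsp x.
Proof. by rewrite -{1}(expRK x) ler_ln ?posrE ?expR_gt0//; lra. Qed.

Lemma lsp_le x y : 0 <= y -> x <= y -> lsp x <= y + 1.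
Proof.
move=> y0 xy; apply: le_trans (lsp_mono xy) _.
have l0 : lsp 0 <= 1.
  rewrite /lsp expR0 -[leRHS]expRK ler_ln ?posrE ?expR_gt0//.
  by have := expR_ge1Dx (1 : R); lra.
by have := lsp_lip y0; lra.
Qed.

Lemma wlog1p_Re (z : C) : `|complex.Im z| < pi / 2 -> 1 <= complex.Re (1 + cexp z).
Proof. by move=> /cexp_Re_gt0 h; rewrite cReD /= lerDl ltW. Qed.

Lemma cdiff_wlog1p (z : C) : `|complex.Im z| < pi / 2 -> exists l, cdiff wlog1p z l.
Proof.
move=> h; eexists; apply: (@cdiff_comp _ (fun z => 1 + cexp z) (@clog R)).
  exact: cdiffD (cdiff_cst 1 z) (cdiff_cexp z).
by apply: cdiff_clog; apply: lt_le_trans (wlog1p_Re h).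
Qed.

(** On the strip Re e^z > 0, so |1 + e^z| lies between (1 + e^x) / 2 and 1 + e^x, and the real parts
    differ by at most 1. The imaginary part is below pi / 2 < 2. *)
Lemma wlog1p_near (x y : R) : `|y| < pi / 2 ->
  [/\ 0 <= complex.Re (wlog1p (Complex x y)), lsp x - 1 <= complex.Re (wlog1p (Complex x y)) &
   cnorm (wlog1p (Complex x y) - Complex (lsp x) 0) <= 3].
Proof.
move=> yb; have Re1 := @wlog1p_Re (Complex x y) yb.
set z := 1 + cexp (Complex x y) in Re1.
have n1 : 1 <= cnorm z.
  by apply: le_trans Re1 _; apply: le_trans (ler_norm _) (cnorm_Re _).
have up : cnorm z <= 1 + expR x.
  by apply: le_trans (cnormD _ _) _; rewrite cnorm1 cnorm_cexp.
have c0 : 0 < cos y by move: yb; rewrite ltr_norml; exact: cos_gt0_pihalf.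
have ex := expR_gt0 x.
have lo : (1 + expR x) / 2 <= cnorm z.
  rewrite -ler_sqr ?nnegrE ?cnorm_ge0 ?divr_ge0 ?(ltW (e1_gt0 x))//.
  rewrite cnorm_sqr /z cReD cImD /= add0r.
  have -> : (1 + expR x * cos y) ^+ 2 + (expR x * sin y) ^+ 2 =
     1 + 2 * (expR x * cos y) + expR x ^+ 2 * (cos y ^+ 2 + sin y ^+ 2) by ring.
  rewrite cos2Dsin2; have := mulr_gt0 ex c0; have := sqr_ge0 (1 - expR x).
  by rewrite !expr2; lra.
have r0 : 0 <= complex.Re (wlog1p (Complex x y)) by rewrite /= ln_ge0.
have r1 : lsp x - 1 <= complex.Re (wlog1p (Complex x y)).
  rewrite /= lerBlDr -[X in _ + X]expRK -lnM ?posrE ?expR_gt0//; last by lra.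
  rewrite ler_ln ?posrE ?mulr_gt0 ?expR_gt0//; last by lra.
  have e2 : 2 <= expR 1 :> R by have := expR_ge1Dx (1 : R); lra.
  have := ler_wpM2l (cnorm_ge0 z) e2; lra.
split=> //; apply: le_trans (cnorm_leD _) _.
rewrite cReD cReN cImD cImN /= oppr0 addr0.
have u : ln (cnorm z) <= lsp x by rewrite ler_ln ?posrE//; lra.
have a : `|atan (complex.Im z / complex.Re z)| <= 2.
  by apply/ltW/(lt_trans (clog_Im z)); exact: pihalf_lt2.
have b : `|ln (cnorm z) - lsp x| <= 1.
  by move: r1; rewrite /= -/z ler_norml => ?; apply/andP; split; lra.
have := lerD b a; rewrite -/z; lra.
Qed.

(** The bounded V controls the integral of u^2 to the right. The lower bound on u reaches up to 2
    X_k, which leaves an interval of length X_k over which [P_slow] integrates u^2. *)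
Lemma slow_function (kap : R) (T : nat -> R) : 0 < kap <= 1 ->
  exists (U : C -> C) (u V V' : R -> R) (X : nat -> R),
  [/\ forall z, `|complex.Im z| < pi / 2 -> exists l, cdiff U z l,
      forall x, 0 < u x <= kap,
      forall x y, x <= y -> u y <= u x /\ u x - u y <= kap * (y - x) * (u x * u y),
      forall x y, `|y| < pi / 2 -> cnorm (U (Complex x y) - Complex (u x) 0) <= kap * u x ^+ 2 &
      (forall x, 0 <= x -> [/\ rdiff V x (V' x), u x ^+ 2 <= V' x & - 4 <= V x <= 0]) /\
      (forall k, [/\ 1 <= X k, T k <= X k &
        forall x, x <= 2 * X k -> (4 ^+ k)^-1 / 16 <= X k * u x ^+ 2])].
Proof.
(* 12 is the 4 of [u_near] times the distance 3 of [wlog1p_near]. *)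
move=> /andP[k0 k1]; pose M := 12 / kap.
have M12 : 12 <= M by rewrite /M ler_pdivlMr//; lra.
have M2 : 2 <= M by lra.
have M0 : 0 < M by lra.
have MV : M^-1 = kap / 12 by rewrite /M invf_div.
pose q k := 2 ^+ k * M + `|T k|.
have qM k : 2 ^+ k * M <= q k by rewrite lerDl.
have X1 := wX_ge1 M2 qM; have b0 := wb_ge0 M2 qM; have cX := rcv_wbX M2 qM.
exists (fun z => stj (wX q) (wb q) (wlog1p z)), (fun x => ur q (lsp x)), (Vf q), (Vf' q), (wX q).
split; [| | | |split].
- move=> z zb; have [l Hl] := cdiff_wlog1p zb.
  have r0 : 0 <= complex.Re (wlog1p z).
    by case: z zb {Hl} => x y /= yb; have [] := @wlog1p_near x y yb.
  by eexists; apply: (@cdiff_comp _ wlog1p); [exact: Hl|exact: (cdiff_stj X1 b0 cX)].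
- move=> x; rewrite (ur_gt0 M2 qM (lsp_ge0 x)) /=.
  by apply: le_trans (ur_le M2 qM (lsp_ge0 x)) _; rewrite MV; lra.
- move=> x y xy; have l0 := lsp_ge0 x; have lxy := lsp_mono xy.
  split; first exact: (ur_mono M2 qM).
  apply: le_trans (ur_lip M2 qM l0 lxy) _; rewrite MV.
  apply: ler_wpM2r; first by rewrite mulr_ge0// ltW// (ur_gt0 M2 qM)// lsp_ge0.
  have := lsp_lip xy => h; have := ler_wpM2r (ltW k0) h => h2.
  have := mulr_ge0 (ltW k0) (_ : 0 <= y - x); rewrite subr_ge0 => /(_ xy); lra.
- move=> x y yb; have [w0 w1 w3] := wlog1p_near x yb.
  apply: le_trans (u_near M2 qM (lsp_ge0 x) w0 w1) _.
  apply: ler_wpM2r; first exact: sqr_ge0.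
  rewrite MV; have := ler_wpM2l (ltW k0) w3; lra.
- move=> x x0; split; [exact: (Vf_rdiff M2 qM)| |exact: (Vf_bound M2 qM)].
  apply: le_trans (ur_sqr_le M2 qM x0).
  have h := ur_mono M2 qM x0 (lsp_ge x); have h2 := ur_gt0 M2 qM (lsp_ge0 x).
  by rewrite !expr2; apply: ler_pM => //; exact: ltW.
move=> k; have q2 := q_ge2 M2 qM k; have pk : 0 < 2 ^+ k :> R by exact: exprn_gt0.
split; first exact: X1.
  have Tq : T k <= q k.
    by apply: le_trans (ler_norm _) _; rewrite lerDr mulr_ge0// ltW.
  by rewrite /wX expr2; nra.
move=> x xX; have Xk := X1 k.
have l1 : lsp x <= 2 * wX q k + 1 by apply: lsp_le => //; lra.
have := ur_term M2 qM k (lsp_ge0 x) => ut.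
(* Since X_k + lsp x <= 3 X_k + 1 <= 4 X_k, the k-th term alone gives this bound. *)
have ut2 : (2 ^+ k * (4 * q k))^-1 <= ur q (lsp x).
  apply: le_trans ut.
  have -> : (2 ^+ k * (4 * q k))^-1 = wb q k / (4 * wX q k).
    by rewrite /wb /wX; field; rewrite !gt_eqF//; lra.
  apply: ler_wpM2l; first exact: b0.
  by have := lsp_ge0 x => l0; rewrite lef_pV2 ?posrE; lra.
have p0 : 0 <= (2 ^+ k * (4 * q k))^-1 by rewrite invr_ge0 mulr_ge0 ?ltW//; lra.
have : (2 ^+ k * (4 * q k))^-1 ^+ 2 <= ur q (lsp x) ^+ 2 by rewrite !expr2; apply: ler_pM.
have X0 : 0 <= wX q k by lra.
move=> /(ler_wpM2l X0); apply: le_trans; rewrite le_eqVlt; apply/orP; left; apply/eqP.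
have -> : (4 : R) ^+ k = 2 ^+ k * 2 ^+ k by rewrite -exprMn -natrM.
by rewrite /wX; field; rewrite !gt_eqF//; lra.
Qed.

End SlowStrip.

(** * Level curves of Re f in the strip *)

Section StripGeometry.
Variable R : realType.
Local Notation C := R[i].
Let k : R := 1 / 1000.
(* Im f varies by about [c ^+ 2 * pi] along a level curve of Re f, and this has to
   lie strictly between [2 * pi] (surjectivity) and [4 * pi] (2-valence). *)
Let c : R := 7 / 4.

Lemma lipschitz_ivt (H : R -> R) (a b K v : R) : a <= b -> 0 <= K ->
  (forall x y, a <= x -> x <= y -> y <= b -> `|H x - H y| <= K * (y - x)) ->
  H a <= v <= H b -> exists2 x, a <= x <= b & H x = v.
Proof.
(* Composing with the clamp [cl] extends H to the whole line, so that it is continuous at the end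
   points too. *)
move=> ab K0 lip Hv; pose cl x := Num.max a (Num.min x b).
have cl1 x : a <= cl x by rewrite le_max lexx.
have cl2 x : cl x <= b by rewrite ge_max ab ge_min lexx orbT.
have clid x : a <= x <= b -> cl x = x by move=> /andP[ax xb]; rewrite /cl min_l// max_r.
have clip x y : x <= y -> cl x <= cl y /\ cl y - cl x <= y - x.
  by move=> xy; rewrite /cl /Num.max /Num.min; repeat case: ifP; move=> *; split; lra.
pose G x := H (cl x).
have Glip x y : x <= y -> `|G x - G y| <= K * (y - x).
  move=> /[dup] xy /clip[h1 h2]; apply: le_trans (lip _ _ (cl1 x) h1 (cl2 y)) _.
  by rewrite ler_wpM2l.
have Gc x : rcont G x.
  move=> e e0; exists (e / (K + 1)); first by rewrite divr_gt0//; lra.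
  move=> h; rewrite ltr_pdivlMr; last by lra.
  move=> hd; have n0 := normr_ge0 h; apply: (@le_lt_trans _ _ (K * `|h|)); last by lra.
  have [hp|hn] := leP 0 h.
    have := Glip x (x + h) ltac:(lra); rewrite (_ : x + h - x = h); last by ring.
    by rewrite distrC (ger0_norm hp).
  have := Glip (x + h) x ltac:(lra); rewrite (_ : x - (x + h) = - h); last by ring.
  by rewrite (ltr0_norm hn).
have [||x xab Gx] := @IVT R G a b v ab.
- by apply: rcont_within => x _; exact: Gc.
- rewrite /G !clid ?lexx ?ab//; move: Hv => /andP[h1 h2].
  by rewrite ge_min le_max h1 h2 orbT.
by exists x; [|rewrite -Gx /G clid]; move: xab; rewrite in_itv.
Qed.

Section Geometry.
Variables (U : C -> C) (u V V' : R -> R) (f : C -> C).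
Local Notation strip y := (`|y| < pi / 2).
Hypothesis u_bnd : forall x, 0 < u x <= k.
Hypothesis u_lip : forall x y, x <= y -> u y <= u x /\ u x - u y <= k * (y - x) * (u x * u y).
Hypothesis U_near : forall x y, strip y -> cnorm (U (Complex x y) - Complex (u x) 0) <= k * u x ^+ 2.
Hypothesis V_bnd : forall x, 0 <= x -> [/\ rdiff V x (V' x), u x ^+ 2 <= V' x & - 4 <= V x <= 0].

Definition Ffun (z : C) : C := Complex 0 c * U z - U z ^+ 2.
Hypothesis f_prim : forall z, `|complex.Im z| < pi / 2 -> cdiff f z (Ffun z).

Let P (x y : R) := complex.Re (f (Complex x y)).
Let Q (x y : R) := complex.Im (f (Complex x y)).

(** With U = u + p + i q and B = k u^2, the a_i stand for the products u p, u q, p^2, q^2 and p q in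
    f'. Named this way, the estimate becomes linear. *)
Lemma Ffun_arith (B p q a1 a2 a3 a4 a5 : R) : `|p| <= B -> `|q| <= B ->
  `|a1| <= k * B -> `|a2| <= k * B -> `|a3| <= k * B -> `|a4| <= k * B -> `|a5| <= k * B ->
  `|- (c * q) - 2 * a1 - a3 + a4| <= 2 * B /\ `|c * p - 2 * a2 - 2 * a5| <= 2 * B.
Proof.
clear; rewrite /k /c !ler_norml => /andP[p1 p2] /andP[q1 q2] /andP[b1 b2] /andP[b3 b4].
move=> /andP[b5 b6] /andP[b7 b8] /andP[b9 b10].
split; apply/andP; split.
- by clear p1 p2 b1 b3 b4 b5 b8 b9 b10; lra.
- by clear p1 p2 b2 b3 b4 b6 b7 b9 b10; lra.
- by clear q1 q2 b1 b2 b3 b5 b6 b7 b8 b9; lra.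
- by clear q1 q2 b1 b2 b4 b5 b6 b7 b8 b10; lra.
Qed.

(** U differs from u by at most k u^2, so f' is - u^2 + i c u up to relative errors 2 k = 1/500,
    which is the [e] below. *)
Lemma Ffun_bnd x y : strip y ->
  `|complex.Re (Ffun (Complex x y)) + u x ^+ 2| <= u x ^+ 2 / 500 /\
  `|complex.Im (Ffun (Complex x y)) - c * u x| <= u x / 500.
Proof.
move=> yb; have := U_near x yb; have /andP[u0 u1] := u_bnd x.
rewrite /Ffun; case: (U _) => s q; set D := _ - _ => h.
have := le_trans (cnorm_Re D) h; have := le_trans (cnorm_Im D) h.
rewrite /D /= oppr0 addr0 => hq hp.
pose p := s - u x; have sE : s = u x + p by rewrite /p; ring.
rewrite sE; move: hp; rewrite -/p => hp.
set w := u x in u0 u1 hp hq *.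
have w2 : w ^+ 2 <= k * w by rewrite expr2 ler_wpM2r// ltW.
have kw : k * w ^+ 2 <= k * (k * w) by rewrite ler_wpM2l// /k; lra.
have w20 : 0 <= w ^+ 2 := sqr_ge0 w.
have /andP[p1 p2] : - (k * w ^+ 2) <= p <= k * w ^+ 2 by rewrite -ler_norml.
have /andP[q1 q2] : - (k * w ^+ 2) <= q <= k * w ^+ 2 by rewrite -ler_norml.
have B : 0 <= k * w ^+ 2 by rewrite mulr_ge0// /k; lra.
have Bk : k * w ^+ 2 <= k by move: kw w2 u1; rewrite /k; lra.
have wp1 : `|w * p| <= k * (k * w ^+ 2) by rewrite normrM (gtr0_norm u0) ler_pM// ltW.
have wq1 : `|w * q| <= k * (k * w ^+ 2) by rewrite normrM (gtr0_norm u0) ler_pM// ltW.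
have pp : `|p * p| <= k * (k * w ^+ 2) by rewrite normrM ler_pM// (le_trans hp).
have qq : `|q * q| <= k * (k * w ^+ 2) by rewrite normrM ler_pM// (le_trans hq).
have pq : `|p * q| <= k * (k * w ^+ 2) by rewrite normrM ler_pM// (le_trans hp).
have rE : complex.Re (Complex 0 c * Complex (w + p) q - Complex (w + p) q ^+ 2) + w ^+ 2 =
   - (c * q) - 2 * (w * p) - p * p + q * q.
  by rewrite expr2 cReD cReN !cReM /=; ring.
have iE : complex.Im (Complex 0 c * Complex (w + p) q - Complex (w + p) q ^+ 2) - c * w =
   c * p - 2 * (w * q) - 2 * (p * q).
  by rewrite expr2 cImD cImN !cImM /=; ring.
rewrite rE iE; have [L1 L2] := Ffun_arith hp hq wp1 wq1 pp qq pq.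
by split; [apply: le_trans L1 _|apply: le_trans L2 _]; move: w2 u1; rewrite /k; lra.
Qed.

Let e : R := 1 / 500.

Lemma u_gt0 x : 0 < u x. Proof. by have /andP[] := u_bnd x. Qed.
Lemma u_le x y : x <= y -> u y <= u x. Proof. by move=> /u_lip[]. Qed.

Lemma u_sqr_le x y : x <= y -> u y ^+ 2 <= u x ^+ 2.
Proof. by move=> xy; rewrite !expr2; apply: ler_pM; rewrite ?u_le//; exact/ltW/u_gt0. Qed.

(** Here and in the next three lemmas: P falls to the right at rate u^2 and upwards at rate c u; Q
    rises to the right at rate c u and falls upwards at rate u^2. Monotonicity of u moves the
    intermediate point of the mean value theorem to the end points. *)
Lemma Px_bnd x1 x2 y : strip y -> x1 <= x2 ->
  (1 - e) * u x2 ^+ 2 * (x2 - x1) <= P x1 y - P x2 y <= (1 + e) * u x1 ^+ 2 * (x2 - x1).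
Proof.
move=> yb x12; have [|t /andP[t1 t2] E] := @rmean_value R (fun x => P x y)
    (fun x => complex.Re (Ffun (Complex x y))) x1 x2 x12.
  by move=> x _; have [] := cdiff_rdiff (f_prim (_ : `|complex.Im (Complex x y)| < _)).
have [h _] := Ffun_bnd t yb; have h1 := u_sqr_le t1; have h2 := u_sqr_le t2.
have -> : P x1 y - P x2 y = - complex.Re (Ffun (Complex t y)) * (x2 - x1).
  by rewrite mulNr; move: E => /= <-; ring.
move: h; rewrite ler_norml => /andP[h3 h4].
have d0 : 0 <= x2 - x1 by lra.
by apply/andP; split; apply: ler_wpM2r => //; rewrite /e; lra.
Qed.

Lemma Qx_bnd x1 x2 y : strip y -> x1 <= x2 ->
  (c - e) * u x2 * (x2 - x1) <= Q x2 y - Q x1 y <= (c + e) * u x1 * (x2 - x1).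
Proof.
move=> yb x12; have [|t /andP[t1 t2] E] := @rmean_value R (fun x => Q x y)
    (fun x => complex.Im (Ffun (Complex x y))) x1 x2 x12.
  by move=> x _; have [] := cdiff_rdiff (f_prim (_ : `|complex.Im (Complex x y)| < _)).
have [_ h] := Ffun_bnd t yb; have h1 := u_le t1; have h2 := u_le t2.
rewrite E; move: h; rewrite ler_norml => /andP[h3 h4].
have d0 : 0 <= x2 - x1 by lra.
by apply/andP; split; apply: ler_wpM2r => //; move: h3 h4; rewrite /e /c; lra.
Qed.

Lemma strip_between (y1 y2 y : R) : strip y1 -> strip y2 -> y1 <= y <= y2 -> strip y.
Proof.
by rewrite !ltr_norml => /andP[? ?] /andP[? ?] /andP[? ?]; apply/andP; split; lra.
Qed.

Lemma Py_bnd x y1 y2 : strip y1 -> strip y2 -> y1 <= y2 ->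
  (c - e) * u x * (y2 - y1) <= P x y1 - P x y2 <= (c + e) * u x * (y2 - y1).
Proof.
move=> s1 s2 y12; have [|t tb E] := @rmean_value R (fun y => P x y)
    (fun y => - complex.Im (Ffun (Complex x y))) y1 y2 y12.
  move=> y /(strip_between s1 s2) yb.
  by have [] := cdiff_rdiff (f_prim (_ : `|complex.Im (Complex x y)| < _)).
have [_ h] := Ffun_bnd x (strip_between s1 s2 tb).
have -> : P x y1 - P x y2 = complex.Im (Ffun (Complex x t)) * (y2 - y1).
  by rewrite -opprB; move: E => /= ->; ring.
move: h; rewrite ler_norml => /andP[h3 h4].
have d0 : 0 <= y2 - y1 by lra.
by apply/andP; split; apply: ler_wpM2r => //; move: h3 h4; rewrite /e /c; lra.
Qed.

Lemma Qy_bnd x y1 y2 : strip y1 -> strip y2 -> y1 <= y2 ->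
  (1 - e) * u x ^+ 2 * (y2 - y1) <= Q x y1 - Q x y2 <= (1 + e) * u x ^+ 2 * (y2 - y1).
Proof.
move=> s1 s2 y12; have [|t tb E] := @rmean_value R (fun y => Q x y)
    (fun y => complex.Re (Ffun (Complex x y))) y1 y2 y12.
  move=> y /(strip_between s1 s2) yb.
  by have [] := cdiff_rdiff (f_prim (_ : `|complex.Im (Complex x y)| < _)).
have [h _] := Ffun_bnd x (strip_between s1 s2 tb).
have -> : Q x y1 - Q x y2 = - complex.Re (Ffun (Complex x t)) * (y2 - y1).
  by rewrite -opprB; move: E => /= ->; ring.
move: h; rewrite ler_norml => /andP[h3 h4].
have d0 : 0 <= y2 - y1 by lra.
by apply/andP; split; apply: ler_wpM2r => //; rewrite /e; lra.
Qed.

Lemma strip0 : strip (0 : R). Proof. by rewrite normr0 divr_gt0// pi_gt0. Qed.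

Let L x := P x 0.

Lemma L_anti x y : x <= y -> L y <= L x.
Proof.
move=> xy; have /andP[h _] := Px_bnd strip0 xy.
have : 0 <= (1 - e) * u y ^+ 2 * (y - x).
  by rewrite mulr_ge0 ?subr_ge0// mulr_ge0 ?sqr_ge0// /e; lra.
rewrite /L; lra.
Qed.

(** For x >= 0, L' >= - 2 u^2 and V' >= u^2, so L + 2 V is non-decreasing; as V has values in
    [-4, 0], L loses at most 8. *)
Lemma L_lower x : L 0 - 8 <= L x.
Proof.
have [x0|/ltW/L_anti] := leP 0 x; last by lra.
have [|t /andP[t1 t2] E] := @rmean_value R (fun x => L x + 2 * V x)
    (fun x => complex.Re (Ffun (Complex x 0)) + 2 * V' x) 0 x x0.
  move=> y /andP[y0 _].
  have [D1 _ _ _] := cdiff_rdiff (f_prim (strip0 : `|complex.Im (Complex y 0)| < _)).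
  have [D2 _ _] := V_bnd y0.
  apply/rdiffP; exact: (is_deriveD ((rdiffP _ _ _).1 D1) (is_deriveZ 2 ((rdiffP _ _ _).1 D2))).
have [h _] := Ffun_bnd t strip0; have [_ v1 _] := V_bnd t1.
have [_ _ /andP[a1 a2]] := V_bnd x0; have [_ _ /andP[b1 b2]] := V_bnd (lexx 0).
have : 0 <= (complex.Re (Ffun (Complex t 0)) + 2 * V' t) * (x - 0).
  rewrite mulr_ge0//; last by lra.
  by move: h; rewrite ler_norml => /andP[h3 h4]; have := sqr_ge0 (u t); lra.
move: E => /= <-; lra.
Qed.

Let L0 := inf (range L).

Lemma L_has_inf : has_inf (range L).
Proof.
by split; [exists (L 0), 0|exists (L 0 - 8) => _ [x _ <-]; exact: L_lower].
Qed.

Lemma L_ge_inf x : L0 <= L x.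
Proof. by apply: inf_lbound; [case: L_has_inf|exists x]. Qed.

(** The reason why f' can be treated as constant: u hardly changes over N times its own length
    scale. *)
Lemma u_far x N : 0 <= N -> N <= 100 -> u x <= (1 + k * N) * u (x + N / u x).
Proof.
move=> N0 N1; have ux := u_gt0 x.
have h0 : x <= x + N / u x by rewrite lerDl divr_ge0// ltW.
have [_] := u_lip h0.
have -> : k * (x + N / u x - x) * (u x * u (x + N / u x)) = k * N * u (x + N / u x).
  by field; rewrite gt_eqF.
lra.
Qed.

(** Over the length 100 / u x the function u keeps 10/11 of its value, so L falls by more than 50 u
    x. *)
Lemma L_ge_u x : 50 * u x <= L x - L0.
Proof.
have ux := u_gt0 x; pose y := x + 100 / u x.
have xy : x <= y by rewrite lerDl divr_ge0// ltW.
have uy : u x <= (1 + k * 100) * u y by apply: u_far; lra.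
have /andP[h _] := Px_bnd strip0 xy.
have := L_ge_inf y; move: h; rewrite -/(L x) -/(L y).
have -> : y - x = 100 / u x by rewrite /y; ring.
move=> h h1.
have yy : (u x * (10 / 11)) * (u x * (10 / 11)) <= u y * u y.
  have b0 : 0 <= u x * (10 / 11) by lra.
  have b1 : u x * (10 / 11) <= u y by move: uy; rewrite /k; lra.
  exact: ler_pM.
have : 50 * u x <= (1 - e) * u y ^+ 2 * (100 / u x).
  rewrite [leRHS]mulrA ler_pdivlMr// expr2; move: yy; rewrite /e; nra.
lra.
Qed.

Lemma P_near x y : strip y -> `|P x y - L x| <= 4 * u x.
Proof.
move=> yb; have p2 : pi / 2 < 2 :> R := pihalf_lt2 R.
have ux := u_gt0 x; move: (yb); rewrite ltr_norml => /andP[y1 y2].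
have [y0|/ltW y0] := leP 0 y.
  have /andP[h1 h2] := Py_bnd x strip0 yb y0; rewrite ler_norml -/(L x) in h1 h2 *.
  move: h1 h2; rewrite subr0 -/(L x) => h1 h2.
  have := mulr_ge0 (ltW ux) y0; have := ler_wpM2l (ltW ux) (ltW y2).
  have := ler_wpM2l (ltW ux) (ltW p2).
  by move: h1 h2; rewrite /c /e => *; apply/andP; split; lra.
have /andP[h1 h2] := Py_bnd x yb strip0 y0; rewrite ler_norml.
move: h1 h2; rewrite sub0r -/(L x) => h1 h2.
have := mulr_ge0 (ltW ux) (_ : 0 <= - y); rewrite oppr_ge0 => /(_ y0).
have := ler_wpM2l (ltW ux) (ltW y1).
have := ler_wpM2l (ltW ux) (ltW p2).
by move: h1 h2; rewrite /c /e => *; apply/andP; split; lra.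
Qed.

(** Leaving the axis changes P by at most 4 u, whereas L - L0 >= 50 u. Hence the infimum over the
    axis is a strict lower bound in the whole strip. *)
Lemma P_bounds x y : strip y ->
  [/\ 0 < P x y - L0, (L x - L0) / 2 <= P x y - L0 & P x y - L0 <= 2 * (L x - L0)].
Proof.
move=> yb; have := P_near x yb; have := L_ge_u x; have := u_gt0 x.
by rewrite ler_norml => ? ? /andP[? ?]; split; lra.
Qed.

Lemma P_xlt x1 x2 y : strip y -> x1 < x2 -> P x2 y < P x1 y.
Proof.
move=> yb x12; have /andP[h _] := Px_bnd yb (ltW x12).
have : 0 < (1 - e) * u x2 ^+ 2 * (x2 - x1).
  by rewrite !mulr_gt0 ?exprn_gt0 ?u_gt0//; rewrite /e; lra.
lra.
Qed.

Lemma Q_xlt x1 x2 y : strip y -> x1 < x2 -> Q x1 y < Q x2 y.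
Proof.
move=> yb x12; have /andP[h _] := Qx_bnd yb (ltW x12).
have : 0 < (c - e) * u x2 * (x2 - x1).
  by rewrite !mulr_gt0 ?u_gt0//; rewrite /c /e; lra.
lra.
Qed.

Lemma P_ylt x y1 y2 : strip y1 -> strip y2 -> y1 < y2 -> P x y2 < P x y1.
Proof.
move=> s1 s2 y12; have /andP[h _] := Py_bnd x s1 s2 (ltW y12).
have : 0 < (c - e) * u x * (y2 - y1).
  by rewrite !mulr_gt0 ?u_gt0//; rewrite /c /e; lra.
lra.
Qed.

Lemma Q_ylt x y1 y2 : strip y1 -> strip y2 -> y1 < y2 -> Q x y2 < Q x y1.
Proof.
move=> s1 s2 y12; have /andP[h _] := Qy_bnd x s1 s2 (ltW y12).
have : 0 < (1 - e) * u x ^+ 2 * (y2 - y1).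
  by rewrite !mulr_gt0 ?exprn_gt0 ?u_gt0//; rewrite /e; lra.
lra.
Qed.

(** P decreases to the right and upwards, so a level curve descends to the right; both components of
    this motion raise Q. *)
Lemma level_order x1 y1 x2 y2 : strip y1 -> strip y2 -> x1 < x2 -> P x1 y1 = P x2 y2 ->
  y2 < y1 /\ Q x1 y1 < Q x2 y2.
Proof.
move=> s1 s2 x12 E.
have y21 : y2 < y1.
  rewrite ltNge; apply/negP => y12.
  have h := P_xlt s1 x12; have : P x2 y2 <= P x2 y1.
    by move: y12; rewrite le_eqVlt => /predU1P[->//|/(P_ylt x2 s1 s2)/ltW].
  lra.
by split=> //; exact: lt_trans (Q_ylt x1 s2 s1 y21) (Q_xlt s2 x12).
Qed.

Lemma level_inj x1 y1 x2 y2 : strip y1 -> strip y2 -> P x1 y1 = P x2 y2 ->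
  Q x1 y1 = Q x2 y2 -> x1 = x2 /\ y1 = y2.
Proof.
move=> s1 s2 EP EQ; have [x12|x21|x12] := ltgtP x1 x2.
- by have [_] := level_order s1 s2 x12 EP; lra.
- by have [_] := level_order s2 s1 x21 (esym EP); lra.
split=> //; rewrite x12 in EP.
have [y12|y21|//] := ltgtP y1 y2.
- by have := P_ylt x2 s1 s2 y12; lra.
- by have := P_ylt x2 s2 s1 y21; lra.
Qed.

Lemma Q_near x y : strip y -> `|Q x y - Q x 0| <= 1 / 100.
Proof.
move=> yb; have p2 : pi / 2 < 2 :> R := pihalf_lt2 R.
have /andP[ux uk] := u_bnd x; move: (yb); rewrite ltr_norml => /andP[y1 y2].
have u2 : u x ^+ 2 <= k * k by rewrite expr2 ler_pM// ltW.
have u20 := sqr_ge0 (u x).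
have [y0|/ltW y0] := leP 0 y.
  have /andP[h1 h2] := Qy_bnd x strip0 yb y0; rewrite ler_norml.
  have := mulr_ge0 u20 y0; have := ler_wpM2l u20 (ltW y2).
  have := ler_wpM2l u20 (ltW p2).
  by move: h1 h2 u2; rewrite subr0 /e /k => *; apply/andP; split; lra.
have /andP[h1 h2] := Qy_bnd x yb strip0 y0; rewrite ler_norml.
have := mulr_ge0 u20 (_ : 0 <= - y); rewrite oppr_ge0 => /(_ y0).
have := ler_wpM2l u20 (ltW y1).
have := ler_wpM2l u20 (ltW p2).
by move: h1 h2 u2; rewrite sub0r /e /k => *; apply/andP; split; lra.
Qed.

(** On a common level, L x1 - L x2 is at most the variation of P across the strip, about c pi u.
    This forces (x2 - x1) u x1 <= N for an N slightly above c pi, and Q gains at most about c N < 4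
    pi. *)
Lemma gap_upper x1 y1 x2 y2 : strip y1 -> strip y2 -> x1 <= x2 -> P x1 y1 = P x2 y2 ->
  Q x2 y2 - Q x1 y1 < 4 * pi.
Proof.
move=> s1 s2 x12 E; have pi2 := pi_ge2 R; have p2 := pihalf_lt2 R.
have u1 := u_gt0 x1; have u2 := u_gt0 x2; have u12 := u_le x12.
have Lgap : L x1 - L x2 <= (c + e) * pi * u x1.
  have N x y : strip y -> `|P x y - L x| <= (c + e) * u x * (pi / 2).
    move=> yb; have ux := u_gt0 x; move: (yb); rewrite ltr_norml => /andP[ya yb'].
    have cu : 0 <= (c + e) * u x by rewrite mulr_ge0 ?ltW//; rewrite /c /e; lra.
    have cu' : 0 <= (c - e) * u x by rewrite mulr_ge0 ?ltW//; rewrite /c /e; lra.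
    have [y0|/ltW y0] := leP 0 y.
      have /andP[h1 h2] := Py_bnd x strip0 yb y0; rewrite subr0 -/(L x) in h1 h2.
      have := ler_wpM2l cu (ltW yb'); have := mulr_ge0 cu' y0.
      by move=> *; rewrite ler_norml; apply/andP; split; lra.
    have /andP[h1 h2] := Py_bnd x yb strip0 y0; rewrite sub0r -/(L x) in h1 h2.
    have := ler_wpM2l cu (_ : - y <= pi / 2); have := mulr_ge0 cu' (_ : 0 <= - y).
    rewrite oppr_ge0 => /(_ y0) ? /(_ ltac:(lra)) ?.
    by rewrite ler_norml; apply/andP; split; lra.
  have := N x1 y1 s1; have := N x2 y2 s2; rewrite !ler_norml => /andP[a1 a2] /andP[b1 b2].
  have : (c + e) * u x2 * (pi / 2) <= (c + e) * u x1 * (pi / 2).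
    by rewrite ler_pM2r ?divr_gt0 ?pi_gt0// ler_pM2l//; rewrite /c /e; lra.
  lra.
(* Exceeds c pi by enough to absorb the factor (1 - e) (99/100)^2. *)
pose N : R := (37 / 20) * pi.
have N0 : 0 <= N by rewrite /N; lra.
have N1 : N <= 8 by rewrite /N; lra.
have short : (x2 - x1) * u x1 <= N.
  rewrite leNgt; apply/negP => long.
  pose y := x1 + N / u x1.
  have yx2 : y <= x2 by rewrite -lerBrDl ler_pdivrMr// ltW.
  have xy : x1 <= y by rewrite lerDl divr_ge0// ltW.
  have uy : u x1 <= (1 + k * N) * u y by apply: u_far => //; lra.
  have /andP[h _] := Px_bnd strip0 xy; have h2 := L_anti yx2.
  have yy : u x1 * (99 / 100) <= u y.
    have uy0 := u_gt0 y.
    by have := ler_wpM2l (ltW uy0) N1; move: uy; rewrite /k; lra.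
  have yy2 : (u x1 * (99 / 100)) * (u x1 * (99 / 100)) <= u y * u y.
    have b0 : 0 <= u x1 * (99 / 100) by lra.
    exact: ler_pM.
  move: h; rewrite -/(L x1) -/(L y) (_ : y - x1 = N / u x1); last by rewrite /y; ring.
  move=> h.
  have : (1 - e) * ((99 / 100) * (99 / 100)) * u x1 * N <= (1 - e) * u y ^+ 2 * (N / u x1).
    rewrite [leRHS]mulrA ler_pdivlMr// expr2.
    have := ler_wpM2l N0 yy2; rewrite /e; lra.
  have : 0 < u x1 * pi by rewrite mulr_gt0 ?pi_gt0.
  by move: Lgap h h2; rewrite /N /c /e; lra.
have := Q_near x1 s1; have := Q_near x2 s2; rewrite !ler_norml => /andP[a1 a2] /andP[b1 b2].
have /andP[_ h] := Qx_bnd strip0 x12.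
have : (c + e) * u x1 * (x2 - x1) <= (c + e) * N.
  by rewrite -mulrA ler_pM2l; [lra|rewrite /c /e; lra].
by move: h; rewrite /N /c /e; lra.
Qed.

Lemma strip_s : strip (49 / 100 * pi : R) /\ strip (- (49 / 100 * pi) : R).
Proof.
by have p0 := pi_gt0 R; rewrite normrN ger0_norm; [split; lra|lra].
Qed.

(** The heights +-s, with s = 49/100 pi, stay inside the open strip. If (x2 - x1) u x1 reaches 2 pi,
    Q gains nearly 2 c pi. Otherwise u is nearly constant, the loss of L by about 2 c s u forces (x2
    - x1) u x1 up to about 2 c s, and Q gains about 2 c^2 s, close to c^2 pi. *)
Lemma gap_lower x1 x2 : x1 <= x2 -> P x1 (49 / 100 * pi) = P x2 (- (49 / 100 * pi)) ->
  2 * pi <= Q x2 (- (49 / 100 * pi)) - Q x1 (49 / 100 * pi).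
Proof.
set s := 49 / 100 * pi => x12 E; have pi2 := pi_ge2 R; have p2 := pihalf_lt2 R.
have [s1 s2] := strip_s; rewrite -/s in s1 s2.
have s0 : 0 <= s by rewrite /s; lra.
have sN0 : - s <= 0 by lra.
have u1 := u_gt0 x1; have u2 := u_gt0 x2; have u12 := u_le x12.
have Lgap : (c - e) * s * (u x1 + u x2) <= L x1 - L x2.
  have /andP[h1 _] := Py_bnd x1 strip0 s1 s0.
  have /andP[h2 _] := Py_bnd x2 s2 strip0 sN0.
  rewrite /L; lra.
have := Q_near x1 s1; have := Q_near x2 s2; rewrite !ler_norml => /andP[a1 a2] /andP[b1 b2].
(* The surplus of 7/500 pi pays for the two changes of Q, each at most 1/100, between the axis and
   the heights +-s. *)
suff : (1007 / 500) * pi <= Q x2 0 - Q x1 0 by lra.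
pose N : R := 2 * pi.
have N0 : 0 <= N by rewrite /N; lra.
have N1 : N <= 8 by rewrite /N; lra.
have far y : x1 <= y -> u x1 <= (1 + k * N) * u y -> u x1 * (99 / 100) <= u y.
  move=> _ uy; have uy0 := u_gt0 y.
  by have := ler_wpM2l (ltW uy0) N1; move: uy; rewrite /k; lra.
have [long|/ltW short] := leP N ((x2 - x1) * u x1).
  pose y := x1 + N / u x1.
  have yx2 : y <= x2 by rewrite -lerBrDl ler_pdivrMr.
  have xy : x1 <= y by rewrite lerDl divr_ge0// ltW.
  have uy : u x1 * (99 / 100) <= u y by apply: far => //; apply: u_far => //; lra.
  have /andP[h _] := Qx_bnd strip0 xy; have /andP[h2 _] := Qx_bnd strip0 yx2.
  have h3 : 0 <= (c - e) * u x2 * (x2 - y).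
    by rewrite mulr_ge0 ?subr_ge0// mulr_ge0 ?ltW//; rewrite /c /e; lra.
  have : (c - e) * (99 / 100) * N <= (c - e) * u y * (y - x1).
    rewrite (_ : y - x1 = N / u x1); last by rewrite /y; ring.
    rewrite [leRHS]mulrA ler_pdivlMr//.
    have := ler_wpM2l N0 uy; rewrite /c /e; lra.
  move: h h2 h3; rewrite /N /c /e; lra.
have /andP[_ h] := Px_bnd strip0 x12; rewrite -/(L x1) -/(L x2) in h.
have uu : u x1 * (99 / 100) <= u x2.
  have [_ l] := u_lip x12.
  have : (x2 - x1) * u x1 * u x2 <= 8 * u x2.
    by rewrite ler_pM2r// (le_trans short).
  move: l; rewrite /k; lra.
have D : (c - e) * s * (199 / 100) <= (1 + e) * ((x2 - x1) * u x1).
  rewrite -(ler_pM2r u1).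
  have : (c - e) * s * (199 / 100) * u x1 <= (c - e) * s * (u x1 + u x2).
    rewrite -mulrA; apply: ler_wpM2l; last by lra.
    by rewrite mulr_ge0//; rewrite /c /e; lra.
  rewrite expr2 in h; lra.
have /andP[q _] := Qx_bnd strip0 x12.
have : (c - e) * (99 / 100) * ((x2 - x1) * u x1) <= (c - e) * u x2 * (x2 - x1).
  have := ler_wpM2r (_ : 0 <= x2 - x1) uu; rewrite subr_ge0 => /(_ x12).
  by rewrite /c /e; lra.
move: q D; rewrite /s /c /e; lra.
Qed.

Lemma u_le1 x : u x <= 1.
Proof. by have /andP[_] := u_bnd x; rewrite /k; lra. Qed.

Lemma u_sqr_le1 x : u x ^+ 2 <= 1.
Proof. by rewrite expr2 -[leRHS]mulr1 ler_pM// ?u_le1// ltW// u_gt0. Qed.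

Lemma P_lip x1 x2 y : strip y -> x1 <= x2 -> `|P x1 y - P x2 y| <= 2 * (x2 - x1).
Proof.
move=> yb x12; have /andP[h1 h2] := Px_bnd yb x12.
have d0 : 0 <= x2 - x1 by lra.
have := ler_wpM2r d0 (u_sqr_le1 x1).
have : 0 <= (1 - e) * u x2 ^+ 2 * (x2 - x1).
  by rewrite mulr_ge0// mulr_ge0 ?sqr_ge0// /e; lra.
by move: h1 h2; rewrite /e => *; rewrite ler_norml; apply/andP; split; lra.
Qed.

Lemma level_point al y : strip y -> 0 < al -> exists x, P x y - L0 = al.
Proof.
move=> yb al0; have u00 : 0 < u 0 ^+ 2 by rewrite exprn_gt0// u_gt0.
(* To the left of 0, u is at least u 0, so L grows at least linearly. At a it exceeds L0 by 2 al,
   twice the level, because [P_bounds] halves it. *)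
pose a := - (4 * al / u 0 ^+ 2).
have a0 : a <= 0 by rewrite oppr_le0 divr_ge0 ?ltW// mulr_gt0.
have La : 2 * al <= L a - L0.
  have /andP[h _] := Px_bnd strip0 a0; have := L_ge_inf 0; move: h.
  rewrite -/(L a) -/(L 0) sub0r opprK.
  have -> : (1 - e) * u 0 ^+ 2 * (4 * al / u 0 ^+ 2) = (1 - e) * (4 * al).
    by field; rewrite gt_eqF// u_gt0.
  by rewrite /e; lra.
have [_ [b0 _ <-] Lb] := @inf_adherent R (range L) (al / 2) ltac:(lra) L_has_inf.
pose b := Num.max a b0.
have ab : a <= b by rewrite le_max lexx.
have Lb' : L b <= L b0 by apply: L_anti; rewrite le_max lexx orbT.
have [_ pa _] := P_bounds a yb; have [_ _ pb] := P_bounds b yb.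
have [||x _ E] := @lipschitz_ivt (fun x => - P x y) a b 2 (- (al + L0)) ab (ler0n _ 2).
- by move=> x1 x2 _ x12 _; rewrite -opprD normrN; exact: P_lip.
- by rewrite !lerN2 -/L0 in Lb *; apply/andP; split; lra.
by exists x; lra.
Qed.

Lemma level_surj al b : 0 < al ->
  exists x y (n : int), [/\ strip y, P x y - L0 = al & Q x y = b + 2 * pi * n%:~R].
Proof.
move=> al0; pose s : R := 49 / 100 * pi; have [s1 s2] := strip_s; rewrite -/s in s1 s2.
have p0 := pi_gt0 R.
have sN : - s < s by rewrite /s; lra.
have [x1 E1] := level_point s1 al0; have [x2 E2] := level_point s2 al0.
have E12 : P x1 s = P x2 (- s) by lra.
have x12 : x1 < x2.
  rewrite ltNge le_eqVlt; apply/negP => /orP[/eqP x12|x21].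
    by have := P_ylt x1 s2 s1 sN; rewrite E12 x12; lra.
  by have := P_xlt s1 x21; have := P_ylt x2 s2 s1 sN; lra.
have mid y : - s <= y <= s -> strip y by exact: strip_between.
(* E x is the height of the level curve above x; it exists since P x is at least the level at - s
   and at most the level at s. *)
have /choice[E HE] : forall x, exists y, x1 <= x <= x2 -> - s <= y <= s /\ P x y - L0 = al.
  move=> x; have [/andP[xx1 xx2]|h] := boolP (x1 <= x <= x2); last first.
    by exists 0.
  have Pmono y a1 a2 : strip y -> a1 <= a2 -> P a2 y <= P a1 y.
    by move=> yb; rewrite le_eqVlt => /predU1P[->//|/(P_xlt yb)/ltW].
  have h1 := Pmono s x1 x s1 xx1; have h2 := Pmono (- s) x x2 s2 xx2.
  have [||y yb Ey] := @lipschitz_ivt (fun y => - P x y) (- s) s 4 (- (al + L0)) (ltW sN) (ler0n _ 4).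
  - move=> y y' ya yy y's; have /andP[h3 h4] := Py_bnd x (mid y ltac:(lra)) (mid y' ltac:(lra)) yy.
    rewrite -opprD normrN.
    have d0 : 0 <= y' - y by lra.
    have := ler_wpM2r d0 (u_le1 x).
    have : 0 <= (c - e) * u x * (y' - y).
      by rewrite mulr_ge0// mulr_ge0 ?(ltW (u_gt0 x))// /c /e; lra.
    by move: h3 h4; rewrite /c /e => *; rewrite ler_norml; apply/andP; split; lra.
  - by apply/andP; split; lra.
  by exists y => _; split=> //; lra.
have E1s : E x1 = s.
  have [|ya Ea] := HE x1; first by rewrite lexx ltW.
  apply/eqP; rewrite eq_le; case/andP: (ya) => _ -> /=; rewrite leNgt; apply/negP => lt.
  by have := P_ylt x1 (mid _ ya) s1 lt; lra.
have E2s : E x2 = - s.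
  have [|ya Ea] := HE x2; first by rewrite lexx ltW.
  apply/eqP; rewrite eq_le; case/andP: (ya) => -> _; rewrite andbT leNgt; apply/negP => lt.
  by have := P_ylt x2 s2 (mid _ ya) lt; lra.
have gap := gap_lower (ltW x12) E12; rewrite -/s in gap.
pose H x := Q x (E x).
(* The first point of b + 2 pi Z not below the left end value of Q; the gap of 2 pi puts it before
   the right end value. *)
pose n : int := Num.ceil ((H x1 - b) / (2 * pi)).
have pi2 : 0 < 2 * pi :> R by lra.
have n1 : H x1 <= b + 2 * pi * n%:~R.
  have := ceil_ge ((H x1 - b) / (2 * pi)); rewrite ler_pdivrMr// -/n; lra.
have n2 : b + 2 * pi * n%:~R <= H x2.
  have : (n%:~R : R) < (H x1 - b) / (2 * pi) + 1.
    by have := gt_pred_ceil ((H x1 - b) / (2 * pi)); rewrite -/n intrD; lra.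
  rewrite -(ltr_pM2r pi2).
  have -> : ((H x1 - b) / (2 * pi) + 1) * (2 * pi) = H x1 - b + 2 * pi.
    by rewrite mulrDl mul1r divfK// gt_eqF.
  have : 2 * pi <= H x2 - H x1 by rewrite /H E1s E2s.
  lra.
(* A lower bound for the vertical rate of P over [x1, x2]. It makes E, and with it H, Lipschitz, in
   place of an implicit function theorem. *)
pose m := (c - e) * u x2.
have m0 : 0 < m by rewrite mulr_gt0 ?u_gt0// /c /e; lra.
have [|||x xx Hx] := @lipschitz_ivt H x1 x2 (2 + 2 * (2 / m)) (b + 2 * pi * n%:~R) (ltW x12).
- by rewrite addr_ge0// mulr_ge0// divr_ge0// ltW.
- move=> x x' xx1 xx' xx2.
  have [|ya Ea] := HE x; first by rewrite xx1 (le_trans xx').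
  have [|ya' Ea'] := HE x'; first by rewrite xx2 (le_trans xx1).
  have sa := mid _ ya; have sa' := mid _ ya'.
  have d0 : 0 <= x' - x by lra.
  have EE : E x' <= E x.
    move: xx'; rewrite le_eqVlt => /predU1P[->//|lt].
    by have [/ltW] := level_order sa sa' lt ltac:(lra).
  have := P_lip sa xx'; have /andP[py _] := Py_bnd x' sa' sa EE.
  rewrite ler_norml => /andP[_ pl].
  have Em : (E x - E x') * m <= 2 * (x' - x).
    have um : u x2 <= u x' by exact: u_le.
    have dE : 0 <= E x - E x' by lra.
    have := ler_wpM2r dE um; move: py pl; rewrite /m /c /e; lra.
  have {}Em : E x - E x' <= 2 / m * (x' - x).
    by rewrite mulrAC ler_pdivlMr.
  have /andP[q1 q2] := Qx_bnd sa xx'; have /andP[q3 q4] := Qy_bnd x' sa' sa EE.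
  have dE : 0 <= E x - E x' by lra.
  have q5 : 0 <= (c - e) * u x' * (x' - x).
    by rewrite mulr_ge0// mulr_ge0 ?(ltW (u_gt0 _))// /c /e; lra.
  have q6 : 0 <= (1 - e) * u x' ^+ 2 * (E x - E x').
    by rewrite mulr_ge0// mulr_ge0 ?sqr_ge0// /e; lra.
  have q7 := ler_wpM2r d0 (u_le1 x); have q8 := ler_wpM2r dE (u_sqr_le1 x').
  move: q1 q2 q3 q4 q5 q6; rewrite /H /c /e => *.
  by rewrite ler_norml; apply/andP; split; lra.
- by rewrite n1 n2.
have [ya Ea] := HE x xx.
by exists x, (E x), n; split=> //; exact: mid.
Qed.

(** From X0 to 2 X0, L falls by at least (1 - e) X0 u(2 X0)^2, and [P_bounds] retains half of L -
    L0. *)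
Lemma P_slow (X0 t : R) x y : 0 <= X0 -> x <= X0 -> strip y -> t <= X0 * u (2 * X0) ^+ 2 ->
  t / 4 <= P x y - L0.
Proof.
move=> X00 xX yb tX; have [_ pl _] := P_bounds x yb.
have X2 : X0 <= 2 * X0 by lra.
have /andP[h _] := Px_bnd strip0 X2; have := L_ge_inf (2 * X0); have := L_anti xX.
have := mulr_ge0 X00 (sqr_ge0 (u (2 * X0))).
move: h; rewrite -/(L X0) -/(L (2 * X0)) /e; lra.
Qed.

(** Two distinct points with the same value of exp f differ in Im f by a nonzero multiple of 2 pi
    smaller than 4 pi, hence by +-2 pi. For three points, two such differences would add up to a
    third one, but 1 and -1 are not sums of two signs. *)
Lemma strip_triple z1 z2 z3 :
  `|complex.Im z1| < pi / 2 -> `|complex.Im z2| < pi / 2 -> `|complex.Im z3| < pi / 2 ->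
  z1 != z2 -> z2 != z3 -> z1 != z3 ->
  complex.Re (f z1) = complex.Re (f z2) -> complex.Re (f z2) = complex.Re (f z3) ->
  forall n1 n2 : int, complex.Im (f z1) = complex.Im (f z2) + 2 * pi * n1%:~R ->
  complex.Im (f z2) = complex.Im (f z3) + 2 * pi * n2%:~R -> False.
Proof.
case: z1 z2 z3 => [x1 y1] [x2 y2] [x3 y3] /= s1 s2 s3 d12 d23 d13 r12 r23 n1 n2 i12 i23.
have p0 := pi_gt0 R.
have key x y x' y' (n : int) : strip y -> strip y' -> Complex x y != Complex x' y' ->
    P x y = P x' y' -> Q x y = Q x' y' + 2 * pi * n%:~R -> (n == 1) || (n == -1).
  move=> s s' d EP EQ.
  have n0 : n != 0.
    apply/eqP => n0; move: EQ; rewrite n0 mulr0 addr0 => EQ.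
    by have [xE yE] := level_inj s s' EP EQ; rewrite xE yE eqxx in d.
  have g : `|Q x y - Q x' y'| < 4 * pi.
    rewrite ltr_norml; have [xx|/ltW xx] := leP x x'.
      have := gap_upper s s' xx EP; rewrite EQ => ?.
      move: xx; rewrite le_eqVlt => /predU1P[xE|lt]; last first.
        by have [_] := level_order s s' lt EP; rewrite EQ; lra.
      suff yE : y = y' by rewrite xE yE eqxx in d.
      have [lt|lt|//] := ltgtP y y'; rewrite xE in EP.
        by have := P_ylt x' s s' lt; lra.
      by have := P_ylt x' s' s lt; lra.
    have := gap_upper s' s xx (esym EP); rewrite EQ => ?.
    move: xx; rewrite le_eqVlt => /predU1P[xE|lt]; last first.
      by have [_] := level_order s' s lt (esym EP); rewrite EQ; lra.
    suff yE : y = y' by rewrite xE yE eqxx in d.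
    have [lt|lt|//] := ltgtP y y'; rewrite xE in EP.
      by have := P_ylt x s s' lt; lra.
    by have := P_ylt x s' s lt; lra.
  move: g; rewrite EQ addrC addrA addNr add0r normrM (gtr0_norm (_ : 0 < 2 * pi)); last by lra.
  rewrite (_ : 4 * pi = 2 * pi * 2); last by ring.
  rewrite ltr_pM2l; last by lra.
  rewrite -intr_norm (_ : 2 = (2 : int)%:~R)// ltr_int.
  by case: n n0 {EQ} => [[|[|n]]|[|n]].
have k1 := key _ _ _ _ _ s1 s2 d12 r12 i12; have k2 := key _ _ _ _ _ s2 s3 d23 r23 i23.
have := key x1 y1 x3 y3 (n1 + n2) s1 s3 d13 (etrans r12 r23).
rewrite intrD => /(_ _); rewrite /Q i12 i23 => /(_ ltac:(ring)).
by case/orP: k1 => /eqP ->; case/orP: k2 => /eqP ->.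
Qed.

End Geometry.

End StripGeometry.

(** * The exponential of f on the strip *)

Section StripMap.
Variable R : realType.
Local Notation C := R[i].

Lemma cos_eq1 (t : R) : cos t = 1 -> exists n : int, t = 2 * pi * n%:~R.
Proof.
move=> ct; have p0 := pi_gt0 R; have pi2 : 0 < 2 * pi :> R by lra.
pose n : int := Num.floor (t / (2 * pi)).
have n1 : 2 * pi * n%:~R <= t.
  by have := floor_le (t / (2 * pi)); rewrite ler_pdivlMr// -/n; lra.
have n2 : t < 2 * pi * n%:~R + 2 * pi.
  have := lt_succ_floor (t / (2 * pi)); rewrite ltr_pdivrMr// -/n intrD; lra.
exists n; pose s := t - 2 * pi * n%:~R.
have per (m : nat) v : cos (v + 2 * pi * m%:R) = cos v :> R.
  elim: m => [|m IH]; first by rewrite mulr0 addr0.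
  rewrite -(natr1 m) mulrDr mulr1 addrA (_ : 2 * pi = pi *+ 2); last by rewrite mulr2n; ring.
  by rewrite cosD2pi -[in RHS]IH; congr (cos (_ + _)); rewrite mulr2n; ring.
have cs : cos s = 1.
  rewrite -ct /s; case: (n) => m.
    by rewrite -[in RHS](subrK (2 * pi * m%:R) t) per.
  by rewrite NegzE intrN mulrN opprK per.
have s0 : 0 <= s by rewrite /s; lra.
have s2 : s < 2 * pi by rewrite /s; lra.
suff : s = 0 by rewrite /s; lra.
apply/eqP; rewrite eq_le s0 andbT leNgt; apply/negP => sp.
have [spi|/ltW pis] := leP s pi.
  have := @ltr_cos R 0 s; rewrite !in_itv/= lexx s0 spi (ltW p0) => /(_ isT isT).
  by rewrite cos0 cs ltxx sp.
have : cos (2 * pi - s) = 1.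
  rewrite (_ : 2 * pi - s = - s + pi *+ 2); last by rewrite mulr2n; ring.
  by rewrite cosD2pi cosN.
have := @ltr_cos R 0 (2 * pi - s); rewrite !in_itv/= lexx (ltW p0).
rewrite (_ : 0 <= 2 * pi - s); last by lra.
rewrite (_ : 2 * pi - s <= pi); last by lra.
move=> /(_ isT isT) + cE; rewrite cos0 cE ltxx => /esym; lra.
Qed.

Lemma cexp_inj_mod (a b : C) : cexp a = cexp b ->
  complex.Re a = complex.Re b /\ exists n : int, complex.Im a = complex.Im b + 2 * pi * n%:~R.
Proof.
move=> E; have : cexp (a - b) = 1 by rewrite cexpD cexpN E divff// cexp_neq0.
move=> E1; have re : complex.Re a = complex.Re b.
  by apply: expR_inj; rewrite -!cnorm_cexp E.
split=> //; have : cos (complex.Im (a - b)) = 1.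
  by move: E1 => [] + _; rewrite cReD cReN re subrr expR0 mul1r.
by move=> /cos_eq1[n]; rewrite cImD cImN => nE; exists n; lra.
Qed.

(** For a square root v of w, either v or - v has a logarithm [clog], and twice it is a logarithm of
    w; or v is imaginary, and then w is negative with argument pi. *)
Lemma cexp_surj (w : C) : w != 0 -> exists z, cexp z = w.
Proof.
move=> w0; pose v := sqrtc w.
have vE : v * v = w by rewrite -expr2 sqr_sqrtc.
have sq z : 0 < complex.Re z -> cexp (clog z + clog z) = z * z.
  by move=> /clogK zE; rewrite cexpD zE.
have [vp|vn|v0] := ltgtP 0 (complex.Re v).
- by exists (clog v + clog v); rewrite sq.
- exists (clog (- v) + clog (- v)); rewrite sq ?mulrNN//.
  by rewrite cReN oppr_gt0.
have v1 : complex.Im v != 0.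
  apply: contra w0 => /eqP v1; rewrite -vE (_ : v = 0) ?mul0r//.
  exact: complex_eq.
pose t := complex.Im v; have t2 : 0 < t ^+ 2 by rewrite lt_def sqrf_eq0 v1 sqr_ge0.
exists (Complex (ln (t ^+ 2)) pi); rewrite /cexp /= lnK ?posrE// cospi sinpi -vE.
have rv : complex.Re v = 0 by [].
by apply: complex_eq; rewrite ?cReM ?cImM rv -/t /=; ring.
Qed.

(** g is f minus the infimum of Re f over the axis, so e^g covers the outside of the closed disk and
    e^-g the punctured disk. 64 is the 16 of [slow_function] times the 4 of [P_slow]. *)
Theorem strip_map (T : nat -> R) : exists g : C -> C,
  [/\ forall z, `|complex.Im z| < pi / 2 -> exists l, cdiff g z l,
      forall z, `|complex.Im z| < pi / 2 -> 0 < complex.Re (g z),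
      forall z1 z2 z3, `|complex.Im z1| < pi / 2 -> `|complex.Im z2| < pi / 2 ->
        `|complex.Im z3| < pi / 2 -> z1 != z2 -> z2 != z3 -> z1 != z3 ->
        cexp (g z1) = cexp (g z2) -> cexp (g z2) = cexp (g z3) -> False,
      forall w, 1 < cnorm w -> exists2 z, `|complex.Im z| < pi / 2 & cexp (g z) = w &
      forall k z, `|complex.Im z| < pi / 2 -> complex.Re z <= T k ->
        (4 ^+ k)^-1 / 64 <= complex.Re (g z)].
Proof.
have [|U [u [V [V' [X [UD ub ul Un [Vb Xb]]]]]]] := @slow_function R (1 / 1000) T; first by lra.
have [|f Hf] := @strip_primitive R (pi / 2) (Ffun U).
  move=> z /UD[l Hl]; eexists; rewrite /Ffun.
  exact: cdiffB (cdiffZ _ Hl) (cdiffX 2 Hl).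
pose L0 := inf (range (fun x : R => complex.Re (f (Complex x 0)))).
exists (fun z => f z - Complex L0 0).
have RE z : complex.Re (f z - Complex L0 0) = complex.Re (f z) - L0 by rewrite cReD.
have IE z : complex.Im (f z - Complex L0 0) = complex.Im (f z).
  by rewrite cImD /= oppr0 addr0.
split.
- by move=> z /Hf Hz; eexists; apply: cdiffB Hz (cdiff_cst _ _).
- move=> [x y] /= yb; rewrite RE.
  by have [] := P_bounds ub ul Un Vb Hf x yb.
- move=> z1 z2 z3 s1 s2 s3 d12 d23 d13 /cexp_inj_mod[r12 [n1 i12]] /cexp_inj_mod[r23 [n2 i23]].
  rewrite !RE !IE in r12 r23 i12 i23.
  apply: (strip_triple ub ul Un Hf s1 s2 s3 d12 d23 d13 _ _ i12 i23); lra.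
- move=> w w1; have w0 : w != 0 by rewrite -cnorm_gt0; lra.
  have [z zE] := cexp_surj w0.
  have al0 : 0 < complex.Re z by rewrite -expR_gt1 -cnorm_cexp zE.
  have [x [y [n [yb PE QE]]]] := level_surj ub ul Un Vb Hf (complex.Im z) al0.
  exists (Complex x y) => //; rewrite -zE.
  have nat_per (m : nat) (v : C) : cexp (v + Complex 0 (2 * pi * m%:R)) = cexp v.
    elim: m => [|m IH]; first by rewrite mulr0 addr0.
    rewrite -(natr1 m) mulrDr mulr1.
    have -> : v + Complex 0 (2 * pi * m%:R + 2 * pi) =
      v + Complex 0 (2 * pi * m%:R) + Complex 0 (2 * pi) by apply: complex_eq; rewrite !(cReD, cImD) /=; ring.
    rewrite cexpD IH (_ : cexp (Complex 0 (2 * pi)) = 1) ?mulr1//.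
    by rewrite /cexp /= expR0 !mul1r mulr_natl cos2pi sin2pi.
  have E : f (Complex x y) - Complex L0 0 = z + Complex 0 (2 * pi * n%:~R).
    by apply: complex_eq; rewrite ?(RE, IE) ?(cReD, cImD) /= ?addr0.
  rewrite E; case: (n) => m; first exact: nat_per.
  by rewrite NegzE intrN mulrN -(nat_per m.+1) -addrA Complex_add addr0 addNr addr0.
- move=> k [x y] /= yb xT; have [X1 TX XL] := Xb k.
  have := P_slow ub ul Un Vb Hf (_ : 0 <= X k) (le_trans xT TX) yb (XL _ (lexx _)).
  by rewrite RE => /(_ ltac:(lra)); rewrite -/L0; lra.
Qed.

End StripMap.

(** * Passage from the strip to the disk *)

Section DiskMap.
Variable R : realType.
Local Notation C := R[i].

Definition cayley (z : C) : C := (1 + z) / (1 - z).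
Definition disk_strip (z : C) : C := clog (cayley z).

Lemma disk_den (z : C) : cnorm z < 1 -> 1 - z != 0.
Proof.
move=> z1; rewrite subr_eq0; apply/eqP => zE; move: z1.
by rewrite -zE cnorm1 ltxx.
Qed.

Lemma cayley_Re (z : C) : cnorm z < 1 -> 0 < complex.Re (cayley z).
Proof.
move=> z1; have d0 := disk_den z1; rewrite /cayley.
have n0 : 0 < cnorm (1 - z) ^+ 2 by rewrite exprn_gt0// cnorm_gt0.
have h : cnorm z ^+ 2 < 1 by rewrite expr2; have := cnorm_ge0 z; nra.
move: n0 h d0; rewrite !cnorm_sqr; case: z {z1} => x y /= n0 h d0.
set D := _ + _ in n0 *.
have -> : (1 + x) * ((1 - x) / D) - (0 + y) * - ((0 - y) / D) = (1 - (x ^+ 2 + y ^+ 2)) / D by ring.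
by rewrite divr_gt0// subr_gt0.
Qed.

Lemma disk_strip_Im (z : C) : `|complex.Im (disk_strip z)| < pi / 2.
Proof. exact: clog_Im. Qed.

Lemma cdiff_disk_strip (z : C) : cnorm z < 1 -> exists l, cdiff disk_strip z l.
Proof.
move=> z1; eexists; apply: (@cdiff_comp _ cayley (@clog R)).
  apply: cdiffM (cdiffD (cdiff_cst 1 z) (cdiff_id z)) (cdiffV _ (cdiffB (cdiff_cst 1 z) (cdiff_id z))).
  exact: disk_den.
exact: cdiff_clog (cayley_Re z1).
Qed.

Lemma disk_strip_inj (z w : C) : cnorm z < 1 -> cnorm w < 1 -> disk_strip z = disk_strip w -> z = w.
Proof.
move=> z1 w1 /(congr1 (@cexp R)); rewrite /disk_strip !clogK ?cayley_Re// /cayley.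
have dz := disk_den z1; have dw := disk_den w1.
move/(congr1 (fun t => t * ((1 - z) * (1 - w)))).
have -> : (1 + z) / (1 - z) * ((1 - z) * (1 - w)) = (1 + z) * (1 - w) by field.
have -> : (1 + w) / (1 - w) * ((1 - z) * (1 - w)) = (1 + w) * (1 - z) by field.
move=> E; have : 2 * (z - w) = 0 by rewrite -[RHS](subrr ((1 + w) * (1 - z))) -{1}E; ring.
by move/eqP; rewrite mulf_eq0 pnatr_eq0 /= subr_eq0 => /eqP.
Qed.

Lemma disk_strip_surj (s : C) : `|complex.Im s| < pi / 2 ->
  exists2 z, cnorm z < 1 & disk_strip z = s.
Proof.
move=> sb; have e0 := cexp_Re_gt0 sb; move: (cexpK sb); set w := cexp s in e0 *; clearbody w => wK.
have w1 : w + 1 != 0.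
  apply/eqP => /(congr1 (@complex.Re R)).
  by rewrite cReD [complex.Re 1]/= [complex.Re 0]/=; lra.
pose z := (w - 1) / (w + 1).
have zn : cnorm z < 1.
  rewrite cnormM cnormV ltr_pdivrMr ?cnorm_gt0// mul1r.
  rewrite -ltr_sqr ?nnegrE ?cnorm_ge0// !cnorm_sqr.
  rewrite !cReD !cImD cReN cImN /= !expr2; lra.
exists z => //; rewrite /disk_strip -wK; congr clog.
have dz := disk_den zn; rewrite /cayley.
have -> : 1 - z = 2 / (w + 1) by rewrite /z; field.
have -> : 1 + z = 2 * w / (w + 1) by rewrite /z; field.
by field.
Qed.

(** With y = x / 2, sin x = 2 sin y cos y >= 2 y cos^2 y, and cos^2 y >= 1/2 because cos x >= 0. *)
Lemma sin_ge_half (x : R) : 0 <= x -> x <= pi / 2 -> x / 2 <= sin x.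
Proof.
move=> x0 xp; have p0 := pi_gt0 R; pose y := x / 2.
have y0 : 0 <= y by rewrite /y; lra.
have [|c /andP[c0 cy] E] := @rmean_value R (@sin R) (@cos R) 0 y y0.
  by move=> t _; apply/rdiffP; exact: is_derive_sin.
have cc : cos y <= cos c.
  rewrite leNgt; apply/negP => h; have := @ltr_cos R y c.
  rewrite !in_itv/= y0 c0 h.
  rewrite (_ : y <= pi); last by rewrite /y; lra.
  rewrite (_ : c <= pi); last by move: cy; rewrite /y; lra.
  by move=> /(_ isT isT); lra.
move: E; rewrite sin0 !subr0 => sE.
have cy0 : 0 <= cos y by apply: cos_ge0_pihalf; apply/andP; split; rewrite /y; lra.
have cx0 : 0 <= cos x by apply: cos_ge0_pihalf; apply/andP; split; lra.
have xE : x = y *+ 2 by rewrite mulr2n /y; lra.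
move: cx0; rewrite {1}xE cos_mulr2n mulr2n => cx0.
have -> : sin x = 2 * (cos y * sin y) by rewrite {1}xE sin_mulr2n mulr2n; ring.
have : cos y * (y * cos y) <= cos y * sin y.
  by rewrite ler_wpM2l// sE mulrC ler_wpM2r.
have := mulr_ge0 y0 cx0; rewrite expr2 /y; nra.
Qed.

(** With m = min(t, 1 - t) the chord is 2 sin (pi m) >= pi m >= 2 m. *)
Lemma circ_dist (t : R) : 0 <= t <= 1 -> 2 * Num.min t (1 - t) <= cnorm (1 - circ t).
Proof.
move=> /andP[t0 t1]; have p2 := pi_ge2 R; set m := Num.min t (1 - t).
have m0 : 0 <= m by rewrite /m le_min t0 subr_ge0.
have mh : m <= 1 / 2 by rewrite /m ge_min; have [h|h] := leP t (1 / 2); rewrite ?orbT//; lra.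
have sE : sin (pi * m) = sin (pi * t).
  rewrite /m /Num.min; case: ifP => // _.
  by rewrite mulrBr mulr1 sinB sinpi cospi; ring.
have nE : cnorm (1 - circ t) ^+ 2 = (2 * sin (pi * m)) ^+ 2.
  rewrite cnorm_sqr sE /circ /= sub0r sqrrN.
  have -> : 2 * pi * t = (pi * t) *+ 2 by rewrite mulr2n; ring.
  rewrite cos_mulr2n sin_mulr2n !mulr2n.
  have := cos2Dsin2 (pi * t); set a := cos _; set b := sin _ => ab.
  have -> : a ^+ 2 = 1 - b ^+ 2 by lra.
  have -> : (a * b + a * b) ^+ 2 = 4 * a ^+ 2 * b ^+ 2 by ring.
  have -> : a ^+ 2 = 1 - b ^+ 2 by lra.
  by ring.
have sg : pi * m / 2 <= sin (pi * m).
  apply: sin_ge_half; first by rewrite mulr_ge0//; lra.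
  have := ler_wpM2l (ltW (pi_gt0 R)) mh; lra.
have s0 : 0 <= sin (pi * m) by apply: le_trans sg; rewrite divr_ge0// mulr_ge0//; lra.
have -> : cnorm (1 - circ t) = 2 * sin (pi * m).
  by apply/eqP; rewrite -(@eqrXn2 _ 2) ?cnorm_ge0 ?mulr_ge0// nE.
have := ler_wpM2r m0 p2; lra.
Qed.

(** The real part is ln (|1 + z| / |1 - z|), and |1 - z| is at least half of |1 - e^(2 pi i t)|
    whatever r is, because 1 - r <= |1 - z|. *)
Lemma disk_strip_bound (r t s : R) : 0 <= r < 1 -> 0 <= t <= 1 ->
  2 * expR (- s) <= Num.min t (1 - t) -> complex.Re (disk_strip (rcirc r t)) <= s.
Proof.
move=> /andP[r0 r1] t01 h; have es := expR_gt0 (- s).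
have d := circ_dist t01; set D := cnorm (1 - circ t) in d.
have zn : cnorm (rcirc r t) = r by rewrite cnorm_rcirc.
have d1 : D / 2 <= cnorm (1 - rcirc r t).
  have : D <= cnorm (1 - rcirc r t) + cnorm (rcirc r t - circ t).
    by rewrite /D -(subrKA (rcirc r t)); exact: cnormD.
  have -> : cnorm (rcirc r t - circ t) = 1 - r.
    have -> : circ t = rcirc 1 t by rewrite /rcirc (_ : Complex 1 0 = 1)// mul1r.
    by rewrite rcircB distrC ger0_norm// subr_ge0 ltW.
  by have := cnorm_sub 1 (rcirc r t); rewrite cnorm1 zn; lra.
have d2 : cnorm (1 + rcirc r t) <= 2.
  by apply: le_trans (cnormD _ _) _; rewrite cnorm1 zn; lra.
have c0 : cayley (rcirc r t) != 0.
  apply/eqP => E; have := @cayley_Re (rcirc r t); rewrite E zn => /(_ r1) /=.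
  by rewrite ltxx.
rewrite /= -[leRHS]expRK ler_ln ?posrE ?expR_gt0 ?cnorm_gt0//.
rewrite /cayley cnormM cnormV ler_pdivrMr; last by rewrite cnorm_gt0 disk_den// zn.
apply: le_trans d2 _.
have e1 : expR s * expR (- s) = 1 by rewrite -expRD subrr expR0.
have h2 : 2 * expR (- s) <= cnorm (1 - rcirc r t) by lra.
have := ler_wpM2l (expR_ge0 s) h2; lra.
Qed.

Lemma pvalent2_of_triple (phi : C -> C) :
  (forall z1 z2 z3, cnorm z1 < 1 -> cnorm z2 < 1 -> cnorm z3 < 1 ->
    z1 != z2 -> z2 != z3 -> z1 != z3 -> phi z1 = phi z2 -> phi z2 = phi z3 -> False) ->
  pvalent 2 phi.
Proof.
move=> H w [|z1 [|z2 [|z3 s]]]//= /and4P[n1 n2 n3 _] Hs; exfalso.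
have [d1 e1] := Hs z1 (mem_head _ _).
have [d2 e2] : disk z2 /\ phi z2 = w by apply: Hs; rewrite !inE eqxx orbT.
have [d3 e3] : disk z3 /\ phi z3 = w by apply: Hs; rewrite !inE eqxx !orbT.
move: n1 n2; rewrite !inE !negb_or => /and3P[a b _] /andP[c _].
by apply: (H z1 z2 z3) => //; rewrite ?e1 ?e2 ?e3.
Qed.

Theorem disk_map (T : nat -> R) : exists phi : C -> C,
  [/\ analytic_selfmap phi, pvalent 2 phi,
      phi @` (@disk R) = [set w | @disk R w /\ w != 0] &
      forall k r t, 0 <= r < 1 -> 0 <= t <= 1 -> 2 * expR (- T k) <= Num.min t (1 - t) ->
        cnorm (phi (rcirc r t)) <= expR (- ((4 ^+ k)^-1 / 64))].
Proof.
have [g [gD g0 g3 gS gT]] := strip_map T.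
pose phi z := cexp (- g (disk_strip z)).
have im z := disk_strip_Im z.
have pn z : cnorm (phi z) < 1.
  by rewrite cnorm_cexp cReN expR_lt1 oppr_lt0 g0.
exists phi; split.
- split; last by move=> z _; exact: pn.
  apply/holomorphic_onP => z z1; have [l Hl] := cdiff_disk_strip z1.
  have [m Hm] := gD _ (im z).
  eexists; apply: (@cdiff_comp _ (fun z => - g (disk_strip z)) (@cexp R)).
    by apply: cdiffN; apply: (@cdiff_comp _ disk_strip g); [exact: Hl|exact: Hm].
  exact: cdiff_cexp.
- apply: pvalent2_of_triple => z1 z2 z3 d1 d2 d3 n12 n23 n13.
  rewrite /phi !cexpN => /invr_inj e12 /invr_inj e23.
  apply: (g3 (disk_strip z1) (disk_strip z2) (disk_strip z3)) => //.
  + by apply: contra n12 => /eqP/(disk_strip_inj d1 d2)/eqP.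
  + by apply: contra n23 => /eqP/(disk_strip_inj d2 d3)/eqP.
  + by apply: contra n13 => /eqP/(disk_strip_inj d1 d3)/eqP.
- apply/seteqP; split=> [_ [z _ <-]|w /= [w1 w0]].
    by split; [exact: pn|exact: cexp_neq0].
  have [|s sb sE] := gS w^-1.
    by rewrite cnormV invf_gt1 ?cnorm_gt0.
  have [z z1 zE] := disk_strip_surj sb.
  by exists z => //; rewrite /phi zE cexpN sE invrK.
- move=> k r t r01 t01 h; rewrite cnorm_cexp ler_expR cReN lerN2.
  exact: gT (im _) (disk_strip_bound r01 t01 h).
Qed.

End DiskMap.

(** * Boundary values close to the unit circle *)

Section BoundaryMeasure.
Variable R : realType.
Local Notation C := R[i].
Local Notation mu := (@lebesgue_measure R).

Lemma expRN_le (x : R) : 0 <= x <= 1 -> expR (- x) <= 1 - x / 2.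
Proof.
move=> /andP[x0 x1]; have ex := expR_gt0 x; have h := expR_ge1Dx x.
have e1 : expR x * expR (- x) = 1 by rewrite -expRD subrr expR0.
have e0 := expR_gt0 (- x); have := ler_wpM2r (ltW e0) h; rewrite e1; nra.
Qed.

Lemma lebesgue_ends_le (tau : R) : 0 <= tau ->
  (mu (`[0%R, tau] `|` `[(1 - tau)%R, 1%R]) <= (2 * tau)%:E)%E.
Proof.
move=> t0.
apply: le_trans (_ : (_ <= mu `[0%R, tau] + mu `[(1 - tau)%R, 1%R])%E) _.
  exact: measureU2.
rewrite !lebesgue_measure_itv/= !lte_fin -!EFinB.
have -> : (2 * tau)%:E = (tau%:E + tau%:E)%E by rewrite -EFinD; congr EFin; ring.
by apply: leeD; case: ifP => _; rewrite ?lee_fin//; lra.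
Qed.

Lemma circle_measure_le (A : set C) (tau : R) : 0 <= tau ->
  (forall t, 0 <= t < 1 -> A (circ t) -> Num.min t (1 - t) <= tau) ->
  (circle_measure A <= (2 * tau)%:E)%E.
Proof.
move=> t0 H; rewrite /circle_measure.
apply: (@le_trans _ _ (@lebesgue_measure R (`[0%R, tau] `|` `[(1 - tau)%R, 1%R]))).
  (* A is not assumed to be measurable; the monotonicity used is that of the outer measure. *)
  rewrite /lebesgue_measure /lebesgue_stieltjes_measure /measure_extension.
  apply: le_mu_ext => t /= [+ At]; rewrite !in_itv/= => t01.
  have := H t t01 At; case/andP: t01 => p0 p1; rewrite ge_min => /orP[h|h]; [left|right].
    by rewrite p0.
  by apply/andP; split; lra.
exact: lebesgue_ends_le.
Qed.

Theorem small_boundary_values (delta : R -> R) :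
  (forall h, 0 < h < 1 -> 0 < delta h < 1) ->
  (forall h1 h2, 0 < h1 -> h1 <= h2 -> h2 < 1 -> delta h1 <= delta h2) ->
  exists phi : C -> C,
    analytic_selfmap phi /\ pvalent 2 phi /\
    phi @` (@disk R) = [set w | @disk R w /\ w != 0] /\
    exists h0 : R, 0 < h0 < 1 /\
      forall h : R, 0 < h -> h <= h0 ->
        (circle_measure
           [set xi | exists L, radial_limit phi xi L /\ (1 - h <= cnorm L)%R]
         <= (delta h)%:E)%E.
Proof.
move=> d01 dmono.
(* Farther than tau k from the ends, |phi| <= exp (- 4 c_k) <= 1 - 2 c_k, so a radial limit has
   modulus below 1 - h if h < c_k. For c_(k+1) <= h, the two ends have total length 2 tau k = delta
   (c_(k+1)) <= delta h. *)
pose c k : R := (4 ^+ k)^-1 / 256.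
have p4 k : 1 <= 4 ^+ k :> R by apply: exprn_ege1; lra.
have c01 k : 0 < c k <= 1 / 256.
  have p0 : (0 : R) < 4 ^+ k by exact: exprn_gt0.
  have v0 : (0 : R) < (4 ^+ k)^-1 by rewrite invr_gt0.
  have v1 : (4 ^+ k)^-1 <= (1 : R) by rewrite -[leRHS]invr1 lef_pV2 ?posrE.
  by rewrite /c; apply/andP; split; lra.
pose tau k := delta (c k.+1) / 2.
have tau0 k : 0 < tau k.
  have /andP[a b] := c01 k.+1; rewrite /tau divr_gt0//.
  by have /andP[] : 0 < delta (c k.+1) < 1 by apply: d01; apply/andP; split; lra.
have [phi [An pv im bd]] := disk_map (fun k => - ln (tau k / 2)).
(* h0 = 1/512 lies below c_0 = 1/256, so the least n with c_n <= h is positive. *)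
exists phi; do 3 (split=> //); clear im; exists (1 / 512); split; first by apply/andP; split; lra.
move=> h h0 hh.
have [k /andP[k1 k2]] : exists k, c k.+1 <= h < c k.
  have ex : exists n, c n <= h.
    pose n := (Num.trunc h^-1).+1.
    exists n; have hn : h^-1 < n%:R by rewrite truncnS_gt.
    have n4 : n%:R <= 4 ^+ n :> R by rewrite -natrX ler_nat ltnW// ltn_expl.
    have : h^-1 < 4 ^+ n by lra.
    rewrite -[ltRHS]invrK ltf_pV2 ?posrE ?invr_gt0 ?exprn_gt0// /c => ?; lra.
  have := ex_minnP ex => -[[|k] ck mk].
    by move: ck; rewrite /c expr0 invr1; lra.
  exists k; rewrite ck /= ltNge; apply/negP => /mk; by rewrite ltnn.
have dE : 2 * tau k <= delta h.
  rewrite /tau mulrC divfK// dmono//; have /andP[] := c01 k.+1; lra.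
apply: (@le_trans _ _ (2 * tau k)%:E); last by rewrite lee_fin.
apply: circle_measure_le; first exact: ltW.
move=> t /andP[t0 t1] [L [HL Lh]]; rewrite leNgt; apply/negP => tt.
have t01 : 0 <= t <= 1 by rewrite t0 ltW.
have T2 : 2 * expR (- (- ln (tau k / 2))) <= Num.min t (1 - t).
  have tk := tau0 k.
  have lnE : expR (ln (tau k / 2)) = tau k / 2 by rewrite lnK// posrE divr_gt0.
  by rewrite opprK lnE; lra.
have e0 : 0 < c k / 2 by have /andP[] := c01 k; lra.
have [d [dp Hd]] := HL _ e0.
pose r := Num.max (1 - d / 2) (1 / 2).
have r1 : r < 1 by rewrite gt_max; apply/andP; split; lra.
have r2 : 1 - d < r by rewrite lt_max; apply/orP; left; lra.
have r0 : 0 <= r by rewrite le_max; apply/orP; right; lra.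
have r01 : 0 <= r < 1 by rewrite r0.
have := Hd r r2 r1; have := bd k r t r01 t01 T2.
have := cnorm_sub L (phi (rcirc r t)); rewrite (cnormB L).
have ec : (4 ^+ k)^-1 / 64 = 4 * c k by rewrite /c; lra.
have := @expRN_le (4 * c k) ltac:(have /andP[] := c01 k; lra).
rewrite ec => h1 h2 h3; rewrite -/(rcirc r t) => h4; lra.
Qed.

End BoundaryMeasure.

(** * The surjective symbol *)

Section FastSymbol.
Variable R : realType.
Local Notation C := R[i].
Local Notation mu := (@lebesgue_measure R).

(* So small that every series [\sum_k (4 ^+ k) ^+ J * sig k] converges. *)
Definition sig (k : nat) : R := (2 ^+ (k ^ 2))^-1.

Lemma sig_gt0 k : 0 < sig k.
Proof. by rewrite invr_gt0 exprn_gt0. Qed.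

(** g is dominated by the sum over k of B (4^k)^J on the set min(t, 1 - t) <= sig k, of measure at
    most 2 sig k. The constant depends on J alone, which makes the result uniform over the circles
    |z| = r. *)
Lemma weight_bound (J : nat) : exists2 c : R, 0 <= c & forall (B : R) (g : R -> R),
  0 <= B -> (forall t, rcont g t) -> (forall t, 0 <= g t) ->
  (forall t, 0 < t < 1 -> exists k, Num.min t (1 - t) <= sig k /\ g t <= B * (4 ^+ k) ^+ J) ->
  orint 0 1 g <= B * c.
Proof.
pose A k : set R := `[0%R, sig k] `|` `[(1 - sig k)%R, 1%R].
have mA k : measurable (A k) by exact: measurableU.
exists (4 * 2 ^+ ((2 * J + 1) ^ 2)) => [|B g B0 gc g0 Hg]; first by rewrite mulr_ge0 ?exprn_ge0.
pose a k : R := B * (4 ^+ k) ^+ J.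
have a0 k : 0 <= a k by rewrite mulr_ge0// !exprn_ge0.
pose w k t : \bar R := ((a k)%:E * (\1_(A k) t)%:E)%E.
have w0 k t : (0 <= w k t)%E by rewrite mule_ge0// lee_fin.
have mI k : measurable_fun `](0 : R), (1 : R)[ (EFin \o (\1_(A k) : R -> R)).
  by apply/measurable_EFinP; exact: measurable_indic.
have gi : mu.-integrable `[0%R, 1%R] (EFin \o g).
  by apply: rcont_integrable.
have mg : measurable_fun `](0 : R), (1 : R)[ (EFin \o g).
  apply: measurable_funS (measurable_int _ gi) => // x /=; rewrite !in_itv/= => /andP[x0 x1]; apply/andP; split; exact: ltW.
rewrite orint_le// -lee_fin /Rintegral fineK; last exact: integrable_fin_num.
rewrite integral_itv_bndoo//.
have mw k : measurable_fun `](0 : R), (1 : R)[ (w k) by exact: (measurable_funeM (a k)%:E (mI k)).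
apply: (@le_trans _ _ (\int[mu]_(t in `]0%R, 1%R[) (\sum_(0 <= k <oo) w k t)%E)%E).
  apply: ge0_le_integral => //=.
  - by move=> t _; rewrite lee_fin.
  - by apply: (@ge0_emeasurable_sum _ _ _ _ w predT).
  move=> t; rewrite in_itv/= => t01; have [k [tk gt]] := Hg t t01.
  case/andP: (t01) => t0 t1.
  apply: le_trans (_ : (w k t <= _)%E).
    rewrite /w indicE mem_set ?mule1 ?lee_fin// /A /= !in_itv/=.
    move: tk; rewrite ge_min => /orP[h|h]; [left|right]; apply/andP; split; lra.
  have := @nneseries_lim_ge R (w^~ t) predT 0 k.+1 (fun n _ _ => w0 n t).
  apply: le_trans; rewrite big_nat_recr//= leeDr// sume_ge0//.
rewrite integral_nneseries//.
have e0 : 0 <= B * (4 * 2 ^+ ((2 * J + 1) ^ 2)) by rewrite !mulr_ge0 ?exprn_ge0.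
(* The k-th integral is compared with the fraction 2^-(k+1) of the claimed bound. *)
apply: le_trans (epsilon_trick0 predT e0).
apply: lee_nneseries => [k _ _|k _]; first exact: integral_ge0.
have -> : (\int[mu]_(t in `]0%R, 1%R[) w k t = (a k)%:E * mu (A k `&` `]0%R, 1%R[))%E.
  by rewrite -integral_indic ?ge0_integralZl_EFin//; [exact: mI|exact: mA].
apply: (@le_trans _ _ ((a k)%:E * (2 * sig k)%:E)%E).
  apply: lee_wpmul2l; first by rewrite lee_fin.
  apply: le_trans (lebesgue_ends_le (ltW (sig_gt0 k))).
  apply: le_measure; rewrite ?inE; [|exact: mA|by move=> t []].
  by apply: measurableI; [exact: mA|].
have two4 : (4 : R) = 2 ^+ 2 by rewrite expr2; ring.
rewrite -EFinM lee_fin /a -[leRHS]mulrA -[leLHS]mulrA ler_wpM2l// natrX ler_pdivlMr ?exprn_gt0//.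
have -> : (4 ^+ k) ^+ J * (2 * sig k) * 2 ^+ k.+1 = 2 ^+ (2 * (k * J) + (k + 2)) * sig k.
  rewrite exprD (exprM _ 2) (exprD _ k 2) -two4 (exprM _ k) exprS; ring.
rewrite /sig ler_pdivrMr ?exprn_gt0//.
rewrite two4 -!exprD ler_weXn2l//; first by lra.
(* The exponents have to satisfy (2 J + 1) k <= (2 J + 1)^2 + k^2, which explains the constant. *)
have [+ _] := nat_Cauchy (2 * J + 1) k.
nia.
Qed.

(* [mob] maps 0 to -1/2; the square of [mob \o phi] still covers the disk although
   phi omits 0, because 1/2 is attained. *)
Definition mob (z : C) : C := (2 * z - 1) / (2 - z).

Lemma mob_den (z : C) : cnorm z < 1 -> 2 - z != 0.
Proof.
move=> z1; rewrite subr_eq0; apply/eqP => zE; move: z1; rewrite -zE.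
by rewrite (_ : (2 : C) = Complex 2 0) ?cnorm_real ?ger0_norm//; [lra|apply: complex_eq; rewrite /= ?addr0].
Qed.

(** |2 - z|^2 - |2 z - 1|^2 = 3 (1 - |z|^2), and |2 - z| <= 3. *)
Lemma mob_norm (z : C) : cnorm z < 1 -> cnorm (mob z) ^+ 2 <= 1 - (1 - cnorm z) / 3.
Proof.
move=> z1; have d0 := mob_den z1; have n0 : 0 < cnorm (2 - z) by rewrite cnorm_gt0.
have z0 := cnorm_ge0 z.
have c2 : cnorm (2 : C) = 2.
  by rewrite (_ : (2 : C) = Complex 2 0) ?cnorm_real ?ger0_norm//; apply: complex_eq; rewrite /= ?addr0.
have n3 : cnorm (2 - z) <= 3.
  by apply: le_trans (cnormD _ _) _; rewrite cnormN c2; lra.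
have E : cnorm (2 * z - 1) ^+ 2 = cnorm (2 - z) ^+ 2 - 3 * (1 - cnorm z ^+ 2).
  rewrite !cnorm_sqr !(cReD, cImD, cReN, cImN, cReM, cImM) /=; ring.
rewrite /mob cnormM cnormV exprMn exprVn E ler_pdivrMr ?exprn_gt0//.
have h1 : cnorm (2 - z) ^+ 2 <= 9 by rewrite expr2; nra.
have h2 : cnorm z ^+ 2 <= cnorm z by rewrite expr2; nra.
have := ler_wpM2l (_ : 0 <= 1 - cnorm z) h1; rewrite subr_ge0 => /(_ (ltW z1)); lra.
Qed.

Lemma mob_lt1 (z : C) : cnorm z < 1 -> cnorm (mob z) < 1.
Proof.
move=> z1; have := mob_norm z1; rewrite expr2; have := cnorm_ge0 (mob z); nra.
Qed.

Lemma mob_inj (z w : C) : cnorm z < 1 -> cnorm w < 1 -> mob z = mob w -> z = w.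
Proof.
move=> /mob_den dz /mob_den dw /(congr1 (fun t => t * ((2 - z) * (2 - w)))).
have -> : mob z * ((2 - z) * (2 - w)) = (2 * z - 1) * (2 - w) by rewrite /mob; field.
have -> : mob w * ((2 - z) * (2 - w)) = (2 * w - 1) * (2 - z) by rewrite /mob; field.
move=> E; have : 3 * (z - w) = 0 by rewrite -[RHS](subrr ((2 * w - 1) * (2 - z))) -{1}E; ring.
by move/eqP; rewrite mulf_eq0 pnatr_eq0 /= subr_eq0 => /eqP.
Qed.

(** The inverse of [mob] is v -> - mob (- v), which vanishes only at v = -1/2. *)
Lemma mob_surj (v : C) : cnorm v < 1 -> 2 * v + 1 != 0 ->
  exists z, [/\ cnorm z < 1, z != 0 & mob z = v].
Proof.
move=> v1 vn; pose z := - mob (- v).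
have v1' : cnorm (- v) < 1 by rewrite cnormN.
have d := mob_den v1'; rewrite opprK in d.
have zE : z = (2 * v + 1) / (2 + v) by rewrite /z /mob opprK; field.
have z1 : cnorm z < 1 by rewrite /z cnormN mob_lt1.
exists z; split=> //; first by rewrite zE mulf_neq0// invr_eq0.
have dz := mob_den z1; rewrite zE in dz *; rewrite /mob.
have -> : 2 - (2 * v + 1) / (2 + v) = 3 / (2 + v) by field.
have -> : 2 * ((2 * v + 1) / (2 + v)) - 1 = 3 * v / (2 + v) by field.
by field.
Qed.

Lemma pvalent_double (phi psi : C -> C) : pvalent 2 phi ->
  (forall w, exists v1 v2, forall z, cnorm z < 1 -> psi z = w -> phi z = v1 \/ phi z = v2) ->
  pvalent 4 psi.
Proof.
move=> H K w s us Hs; have [v1 [v2 Hv]] := K w.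
rewrite -(count_predC (fun z => phi z == v1) s) -!size_filter.
rewrite -[4%N]/(2 + 2)%N; apply: leq_add.
  apply: (H v1); first exact: filter_uniq.
  by move=> z; rewrite mem_filter => /andP[/eqP zv /Hs[]].
apply: (H v2); first exact: filter_uniq.
move=> z; rewrite mem_filter => /andP[/= zv /Hs[zd zw]]; split=> //.
by have [/eqP|//] := Hv z zd zw; rewrite (negbTE zv).
Qed.

Theorem fast_symbol : exists psi : C -> C,
  [/\ analytic_selfmap psi, psi @` (@disk R) = @disk R, pvalent 4 psi &
    forall r t, 0 <= r < 1 -> 0 < t < 1 -> exists k,
      Num.min t (1 - t) <= sig k /\ (384 * 4 ^+ k)^-1 <= 1 - cnorm (psi (rcirc r t))].
Proof.
have [phi [[hol self] pv im bd]] := disk_map (fun k => - ln (sig k.+1 / 2)).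
have self' z : cnorm z < 1 -> cnorm (phi z) < 1 by move=> /self.
pose psi z := mob (phi z) ^+ 2.
exists psi; split.
- split.
    apply/holomorphic_onP => z z1; have [l Hl] := (holomorphic_onP _ _).1 hol z z1.
    eexists; apply: cdiffX.
    apply: cdiffM (cdiffB (cdiffZ 2 Hl) (cdiff_cst 1 z)) (cdiffV _ (cdiffB (cdiff_cst 2 z) Hl)).
    exact/mob_den/self'.
  move=> z z1; rewrite /disk /= cnormX expr2.
  by have := mob_lt1 (self' z z1); have := cnorm_ge0 (mob (phi z)); nra.
- apply/seteqP; split=> [_ [z z1 <-]|w w1].
    rewrite /disk /= cnormX expr2.
    by have := mob_lt1 (self' z z1); have := cnorm_ge0 (mob (phi z)); nra.
  (* At most one of the two square roots of w equals -1/2; the other one is taken. *)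
  have [v [v1 vE vn]] : exists v : C, [/\ cnorm v < 1, v ^+ 2 = w & 2 * v + 1 != 0].
    pose v := sqrtc w; have vE : v ^+ 2 = w by exact: sqr_sqrtc.
    have v1 : cnorm v < 1.
      rewrite ltNge; apply/negP => h; move: w1; rewrite /disk /= -vE cnormX expr2; nra.
    have [h|h] := eqVneq (2 * v + 1) 0; last by exists v.
    exists (- v); split; [by rewrite cnormN|by rewrite sqrrN|].
    have -> : 2 * - v + 1 = 2 - (2 * v + 1) by ring.
    by rewrite h subr0 pnatr_eq0.
  have [z [z1 z0 zE]] := mob_surj v1 vn.
  have : (phi @` (@disk R)) z by rewrite im.
  by move=> [x x1 xE]; exists x => //; rewrite /psi xE zE.
- apply: (pvalent_double pv) => w.
  pose v := sqrtc w; have vE : v ^+ 2 = w by exact: sqr_sqrtc.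
  have pre u : exists z, forall x, cnorm x < 1 -> mob (phi x) = u -> phi x = z.
    have [[x0 x01 x0E]|no] := pselect (exists2 x, cnorm x < 1 & mob (phi x) = u).
      exists (phi x0) => x x1 xE; apply: mob_inj; rewrite ?self'//.
      by rewrite xE x0E.
    by exists 0 => x x1 xE; exfalso; apply: no; exists x.
  have [z1 H1] := pre v; have [z2 H2] := pre (- v).
  exists z1, z2 => x x1; rewrite /psi -vE => /eqP; rewrite eqf_sqr => /orP[/eqP h|/eqP h].
    by left; exact: H1.
  by right; exact: H2.
clear im; move=> r t r01 /andP[t0 t1].
have t01 : 0 <= t <= 1 by rewrite !ltW.
have m0 : 0 < Num.min t (1 - t) by rewrite lt_min t0 subr_gt0.
(* The least such index k gives both claims: min(t, 1 - t) <= sig k by minimality, or by sig 0 = 1,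
   while [disk_map] applies at k. 384 = 64 * 2 * 3, with factors from [disk_map], [expRN_le] and
   [mob_norm]. *)
have ex : exists n, sig n.+1 <= Num.min t (1 - t).
  pose n := (Num.trunc (Num.min t (1 - t))^-1).+1.
  exists n; have hn : (Num.min t (1 - t))^-1 < n%:R by rewrite truncnS_gt.
  rewrite -[leRHS]invrK lef_pV2 ?posrE ?invr_gt0 ?exprn_gt0//.
  apply: le_trans (ltW hn) _; rewrite -natrX ler_nat.
  apply: leq_trans (ltnW (ltn_expl n (ltnSn 1))) _; rewrite leq_exp2l//; lia.
have := ex_minnP ex => -[k ck mk]; exists k; split.
  case: k ck mk => [|k] ck mk.
    rewrite /sig expr0 invr1 ge_min; apply/orP; left; exact: ltW.
  by apply/ltW; rewrite ltNge; apply/negP => /mk; rewrite ltnn.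
have T2 : 2 * expR (- (- ln (sig k.+1 / 2))) <= Num.min t (1 - t).
  have tk := sig_gt0 k.+1.
  have lnE : expR (ln (sig k.+1 / 2)) = sig k.+1 / 2 by rewrite lnK// posrE divr_gt0.
  by rewrite opprK lnE; lra.
have p4 : 1 <= 4 ^+ k :> R by apply: exprn_ege1; lra.
have p0 : (0 : R) < 4 ^+ k by exact: exprn_gt0.
have i0 : (0 : R) < (4 ^+ k)^-1 by rewrite invr_gt0.
have i1 : (4 ^+ k)^-1 <= (1 : R) by rewrite -[leRHS]invr1 lef_pV2 ?posrE.
have zd : cnorm (rcirc r t) < 1 by case/andP: r01 => r0 r1; rewrite cnorm_rcirc.
have := bd k r t r01 t01 T2.
have := @expRN_le R ((4 ^+ k)^-1 / 64) ltac:(lra).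
have := mob_norm (self' _ zd); rewrite /psi cnormX invfM.
lra.
Qed.

End FastSymbol.

(** * Approximation numbers of the composition operator *)

Section CompositionOperator.
Variable R : realType.
Local Notation C := R[i].

Lemma mean2_le_h2norm2 (f : C -> C) r : 0 <= r < 1 -> (mean2 f r <= h2norm2 f)%E.
Proof. by move=> r01; apply: ereal_sup_ubound; exists r. Qed.

Lemma h2norm2_ge0 (f : C -> C) : hol_disk f -> (0 <= h2norm2 f)%E.
Proof.
move=> H; have r01 : 0 <= (0 : R) < 1 by rewrite lexx ltr01.
apply: le_trans (mean2_le_h2norm2 f r01).
by apply: integral_ge0 => t _; rewrite lee_fin exprn_ge0// cnorm_ge0.
Qed.

Lemma h2norm2_bounded (f : C -> C) (K : R) : hol_disk f ->
  (forall z, cnorm z < 1 -> cnorm (f z) <= K) -> (h2norm2 f <= (K ^+ 2)%:E)%E.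
Proof.
move=> H B; apply: ge_ereal_sup => _ [r /= r01 <-]; rewrite in_itv/= in r01.
rewrite mean2E// lee_fin.
have c1 t : rcont (fun t => cnorm (f (rcirc r t))) t by apply: rcont_cnorm; exact: hol_disk_pcont.
apply: (@le_trans _ _ (orint 0 1 (fun=> K ^+ 2))).
  apply: le_orint => // t _; [exact: (rcontM (c1 t) (c1 t))|exact: rcont_cst|].
  apply: lerXn2r; rewrite ?nnegrE ?cnorm_ge0//; last apply: B.
    by apply: le_trans (cnorm_ge0 (f 0)) (B _ _); rewrite cnorm0.
  by case/andP: r01 => r0 r1; rewrite cnorm_rcirc.
by rewrite orint_cst subr0 mulr1.
Qed.

Lemma h2norm_le (f : C -> C) (b : R) : 0 <= b -> (h2norm2 f <= (b ^+ 2)%:E)%E ->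
  (h2norm f <= b%:E)%E.
Proof.
move=> b0 H; have -> : b%:E = sqrte (b ^+ 2)%:E by rewrite /= sqrtr_sqr ger0_norm.
by rewrite /h2norm lee_sqrt// lee_fin exprn_ge0.
Qed.

Lemma tcoef_linear (f g : C -> C) (a b : C) k : hol_disk f -> hol_disk g ->
  tcoef (fun z => a * f z + b * g z) k = a * tcoef f k + b * tcoef g k.
Proof.
move=> Hf Hg; have h0 : (0 : R) <= 1 / 2 by lra.
have K (u : C -> C) z : hol_disk u -> cnorm z = 1 / 2 -> ccont (fun z => u z * (z ^+ k)^-1) z.
  move=> Hu zE; have z0 : z != 0 by rewrite -cnorm_gt0 zE; lra.
  by have [|l /cdiff_cont] := cdiff_tcoef k Hu _ z0; rewrite // zE; lra.
rewrite /tcoef -(cmeanZ a (fun z zE => K f z Hf zE) h0) -(cmeanZ b (fun z zE => K g z Hg zE) h0).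
rewrite -cmeanD// => [|z zE|z zE]; last 2 first.
- by apply: ccontM; [exact: ccont_cst|exact: K].
- by apply: ccontM; [exact: ccont_cst|exact: K].
by apply: eq_cmean => // z _; ring.
Qed.

(** (1 - k / 2)^n <= exp (- n k / 2), and exp x >= (x / (N + 1))^(N + 1). The leading 2 pays for the
    exponent n - 1, as 1 - k / 2 >= 1/2. *)
Lemma expr_decay (N n : nat) (k : R) : (0 < n)%N -> 0 < k <= 1 ->
  (1 - k / 2) ^+ n.-1 <= 2 * (2 * N.+1%:R) ^+ N.+1 / (n%:R * k) ^+ N.+1.
Proof.
move=> n0 /andP[k0 k1]; have n0' : (0 : R) < n%:R by rewrite ltr0n.
have N0 : (0 : R) < N.+1%:R by rewrite ltr0n.
have q0 : 1 / 2 <= 1 - k / 2 by lra.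
have nk0 : 0 < n%:R * k by rewrite mulr_gt0.
apply: (@le_trans _ _ (2 * (1 - k / 2) ^+ n)).
  rewrite -{2}(prednK n0) exprS; have : 0 <= (1 - k / 2) ^+ n.-1 by rewrite exprn_ge0//; lra.
  nra.
rewrite -mulrA ler_wpM2l// ler_pdivlMr ?exprn_gt0//.
pose y := n%:R * k / (2 * N.+1%:R).
have y0 : 0 <= y by rewrite divr_ge0// ?ltW// mulr_gt0.
have e1 : (1 - k / 2) ^+ n <= expR (- (n%:R * k / 2)).
  have -> : - (n%:R * k / 2) = n%:R * (- (k / 2)) by ring.
  rewrite expRM_natl lerXn2r ?nnegrE ?expR_ge0//; first by lra.
  by have := expR_ge1Dx (- (k / 2)); lra.
have e2 : y ^+ N.+1 <= expR (n%:R * k / 2).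
  have -> : n%:R * k / 2 = N.+1%:R * y.
    by rewrite /y; field; rewrite lt0r_neq0.
  rewrite expRM_natl lerXn2r ?nnegrE ?expR_ge0//.
  by have := expR_ge1Dx y; lra.
have -> : (n%:R * k) ^+ N.+1 = (2 * N.+1%:R) ^+ N.+1 * y ^+ N.+1.
  by rewrite -exprMn /y mulrCA divff ?mulr1// lt0r_neq0// mulr_gt0.
rewrite mulrCA -[leRHS]mulr1 ler_wpM2l ?exprn_ge0// ?mulr_ge0//.
apply: (@le_trans _ _ (expR (- (n%:R * k / 2)) * expR (n%:R * k / 2))).
  by apply: ler_pM; rewrite ?exprn_ge0//; lra.
by rewrite -expRD addNr expR0.
Qed.

Variable psi : C -> C.
Hypothesis psi_self : analytic_selfmap psi.
Hypothesis psi_fast : forall r t, 0 <= r < 1 -> 0 < t < 1 -> exists k,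
  Num.min t (1 - t) <= sig R k /\ (384 * 4 ^+ k)^-1 <= 1 - cnorm (psi (rcirc r t)).

Let psi1 z : cnorm z < 1 -> cnorm (psi z) < 1.
Proof. exact: psi_self.2. Qed.

Let psi_hol : hol_disk psi.
Proof. by move=> z z1; exact: ((holomorphic_onP _ _).1 psi_self.1). Qed.

Lemma hol_disk_powsum (c : nat -> C) n : hol_disk (fun z => \sum_(k < n) c k * psi z ^+ k).
Proof.
elim: n => [|n IH] z z1.
  exists 0; rewrite (_ : (fun _ => _) = fun=> 0); first exact: cdiff_cst.
  by apply/funext => w; rewrite big_ord0.
have [l Hl] := IH z z1; have [m Hm] := psi_hol z1.
eexists; rewrite (_ : (fun _ => _) =
  fun z => \sum_(k < n) c k * psi z ^+ k + c n * psi z ^+ n); last first.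
  by apply/funext => w; rewrite big_ord_recr.
by apply: cdiffD Hl _; apply: cdiffZ; apply: cdiffX Hm.
Qed.

Lemma H2_powsum (c : nat -> C) n : H2 (fun z => \sum_(k < n) c k * psi z ^+ k).
Proof.
split; first by apply/holomorphic_onP; exact: hol_disk_powsum.
apply: le_lt_trans (ltry ((\sum_(k < n) cnorm (c k)) ^+ 2)).
apply: h2norm2_bounded; first exact: hol_disk_powsum.
move=> z z1; elim: n => [|n IH]; first by rewrite !big_ord0 cnorm0.
rewrite !big_ord_recr/=; apply: le_trans (cnormD _ _) _; apply: lerD => //.
rewrite cnormM -[leRHS]mulr1 ler_wpM2l ?cnorm_ge0// cnormX exprn_ile1 ?cnorm_ge0//.
exact/ltW/psi1.
Qed.

Lemma hol_disk_comp f : hol_disk f -> hol_disk (f \o psi).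
Proof.
move=> H z z1; have [l Hl] := psi_hol z1; have [m Hm] := H _ (psi1 z1).
by eexists; apply: cdiff_comp Hl Hm.
Qed.

Definition truncation n : opT R := fun f z => \sum_(k < n) tcoef f k * psi z ^+ k.

Lemma truncation_error N : exists2 D : R, 0 <= D & forall f (M : R) n, hol_disk f -> 0 <= M ->
  (h2norm2 f <= M%:E)%E -> (0 < n)%N ->
  (h2norm2 (fun z => (comp_op psi f z - truncation n.-1 f z)%R) <=
    ((D * (1 + M) / n%:R ^+ N.+1) ^+ 2)%:E)%E.
Proof.
have [c c0 Hc] := weight_bound R (2 * N.+2).
pose D0 : R := 4 * (2 * N.+1%:R) ^+ N.+1 * 384 ^+ N.+2.
have twoN : 0 <= 2 * N.+1%:R :> R by rewrite mulr_ge0.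
have D00 : 0 <= D0.
  apply: mulr_ge0; last exact: exprn_ge0 (ler0n _ _).
  by apply: mulr_ge0; [exact: ler0n|exact: exprn_ge0].
exists (D0 * Num.sqrt c) => [|f M n H M0 fM n0]; first by rewrite mulr_ge0 ?sqrtr_ge0.
have n0' : (0 : R) < n%:R by rewrite ltr0n.
have HG : hol_disk (fun z => comp_op psi f z - truncation n.-1 f z).
  move=> z z1; have [l Hl] := hol_disk_comp H z1; have [m Hm] := hol_disk_powsum (tcoef f) n.-1 z1.
  by eexists; exact: cdiffB Hl Hm.
apply: ge_ereal_sup => _ [r /= r01 <-]; rewrite in_itv/= in r01.
rewrite mean2E// lee_fin.
pose b := D0 * (1 + M) / n%:R ^+ N.+1.
have b0 : 0 <= b by rewrite divr_ge0 ?exprn_ge0// mulr_ge0//; lra.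
have -> : (D0 * Num.sqrt c * (1 + M) / n%:R ^+ N.+1) ^+ 2 = b ^+ 2 * c.
  rewrite -[in RHS](sqr_sqrtr c0) -exprMn /b; congr (_ ^+ 2); ring.
apply: Hc => [||t|t t01]; first exact: exprn_ge0.
- move=> t; have c1 : rcont (fun t => cnorm (comp_op psi f (rcirc r t) - truncation n.-1 f (rcirc r t))) t.
    by apply: rcont_cnorm; exact: hol_disk_pcont HG r01.
  exact: (rcontM c1 c1).
- by rewrite exprn_ge0// cnorm_ge0.
have [k [tk Hk]] := psi_fast r01 t01; exists k; split=> //.
have p0 : (0 : R) < 4 ^+ k by exact: exprn_gt0.
rewrite mulnC exprM -exprMn; apply: lerXn2r;
  [by rewrite nnegrE cnorm_ge0|by rewrite nnegrE mulr_ge0// exprn_ge0// ltW|].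
have z1 : cnorm (rcirc r t) < 1 by case/andP: r01 => r0 r1; rewrite cnorm_rcirc.
set w := psi (rcirc r t); have w1 : cnorm w < 1 by exact: psi1.
have w0 := cnorm_ge0 w; set d := 1 - cnorm w in Hk.
have d0 : 0 < d by rewrite subr_gt0.
have s01 : 0 <= (1 + cnorm w) / 2 < 1 by apply/andP; split; lra.
have A1 := mean1_le H s01 (le_trans (mean2_le_h2norm2 f s01) fM).
apply: le_trans (taylor_remainder n.-1 H w1 A1) _.
have -> : (1 + cnorm w) / 2 = 1 - d / 2 by rewrite /d; field.
rewrite -/d; have := @expr_decay N n d n0 _.
rewrite d0 => /(_ ltac:(rewrite /d; lra)) E.
have K0 : (0 : R) < 384 * 4 ^+ k by apply: mulr_gt0 p0; rewrite ltr0n.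
have dV : d^-1 <= 384 * 4 ^+ k.
  by rewrite -[leRHS]invrK lef_pV2 ?posrE ?invr_gt0; [exact: Hk|exact: d0|exact: K0].
apply: (@le_trans _ _ (4 * ((1 + M) / 2) * (2 * (2 * N.+1%:R) ^+ N.+1 / (n%:R * d) ^+ N.+1) / d)).
  rewrite ler_wpM2r ?invr_ge0 ?(ltW d0)// ler_wpM2l//; lra.
have -> : 4 * ((1 + M) / 2) * (2 * (2 * N.+1%:R) ^+ N.+1 / (n%:R * d) ^+ N.+1) / d =
  4 * (2 * N.+1%:R) ^+ N.+1 * (1 + M) / n%:R ^+ N.+1 * d^-1 ^+ N.+2.
  rewrite [(d^-1) ^+ _]exprS exprVn (exprMn _ n%:R d).
  have : d ^+ N.+1 != 0 by rewrite expf_neq0 ?lt0r_neq0.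
  have : n%:R ^+ N.+1 != 0 :> R by rewrite expf_neq0 ?lt0r_neq0.
  move: (_ ^+ N.+1) (_ ^+ N.+1) (_ ^+ N.+1) => x1 x2 x3 x10 x20.
  by field; rewrite x10 x20 lt0r_neq0.
have -> : b * (4 ^+ k) ^+ N.+2 =
  4 * (2 * N.+1%:R) ^+ N.+1 * (1 + M) / n%:R ^+ N.+1 * (384 * 4 ^+ k) ^+ N.+2.
  rewrite (exprMn N.+2 384) /b /D0.
  move: (384 ^+ N.+2) ((4 ^+ k) ^+ N.+2) ((2 * N.+1%:R) ^+ N.+1) (n%:R ^+ N.+1)^-1 => x1 x2 x3 x4.
  ring.
apply: ler_wpM2l.
  by rewrite divr_ge0 ?exprn_ge0// mulr_ge0 ?addr_ge0// mulr_ge0 ?exprn_ge0// mulr_ge0.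
by apply: lerXn2r; [rewrite nnegrE invr_ge0 ltW|rewrite nnegrE (ltW K0)|exact: dV].
Qed.

Lemma H2_finite (f : C -> C) : H2 f -> hol_disk f /\ exists2 M : R, 0 <= M & (h2norm2 f <= M%:E)%E.
Proof.
move=> [/holomorphic_onP H fin]; split=> //; have h0 := h2norm2_ge0 H.
exists (fine (h2norm2 f)); first exact: fine_ge0.
by rewrite fineK// ge0_fin_numE.
Qed.

(** For n = 1 the truncation is 0, and the error bound is a bound on the norm of f o psi itself. *)
Lemma comp_op_H2 f : H2 f -> H2 (comp_op psi f).
Proof.
move=> /H2_finite[H [M M0 fM]]; split; first by apply/holomorphic_onP; exact: hol_disk_comp.
have [D D0 HD] := truncation_error 0.
have := HD f M 1%N H M0 fM isT.
have -> : (fun z => comp_op psi f z - truncation 1.-1 f z) = comp_op psi f.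
  by apply/funext => z; rewrite /truncation big_ord0 subr0.
by move/le_lt_trans; apply; exact: ltry.
Qed.

Lemma truncation_linear n : linear_on_H2 (truncation n).
Proof.
split=> [f _|f g a b /H2_finite[Hf _] /H2_finite[Hg _] z _]; first exact: H2_powsum.
rewrite /truncation !mulr_sumr -big_split /=; apply: eq_bigr => k _.
by rewrite tcoef_linear//; ring.
Qed.

Lemma truncation_rank n : (0 < n)%N -> rank_lt (truncation n.-1) n.
Proof.
move=> n0; exists n.-1, (fun i z => psi z ^+ i); split; first by rewrite prednK.
split=> [i|f _]; last by exists (fun i => tcoef f i).
(* psi^i is a power sum in psi with a single nonzero coefficient. *)
have := H2_powsum (fun k => (k == i)%:R) i.+1.
congr H2; apply/funext => z; rewrite big_ord_recr/= eqxx mul1r big1 ?add0r// => j _.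
by rewrite (ltn_eqF (ltn_ord j)) mul0r.
Qed.

Lemma approx_number_le N : exists2 D : R, 0 <= D & forall n, (0 < n)%N ->
  (approx_number (comp_op psi) n <= (D / n%:R ^+ N.+1)%:E)%E.
Proof.
have [D D0 HD] := truncation_error N; exists (2 * D) => [|n n0]; first by rewrite mulr_ge0.
apply: le_trans (_ : (opnorm_diff (comp_op psi) (truncation n.-1) <= _)%E).
  apply: ereal_inf_lbound; exists (truncation n.-1) => //; split; first exact: truncation_linear.
  exact: truncation_rank.
apply: ge_ereal_sup => _ [f /= [/H2_finite[H _] f1] <-].
have f1' : (h2norm2 f <= 1%:E)%E.
  rewrite -(@lee_sqrt R _ 1%:E) ?lee_fin//; apply: le_trans f1 _.
  by rewrite /= sqrtr1.
have := HD f 1 n H ler01 f1' n0; rewrite (_ : D * (1 + 1) = 2 * D); last by ring.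
by apply: h2norm_le; rewrite divr_ge0 ?exprn_ge0 ?mulr_ge0.
Qed.

(** The zero function lies in the unit ball, so every supremum contains a nonnegative value.
    Monotonicity of the p-th power relies on this. *)
Lemma approx_number_ge0 (T : opT R) n : (0 <= approx_number T n)%E.
Proof.
pose o : C -> C := fun=> 0.
have Z0 : H2 o /\ (h2norm o <= 1%:E)%E.
  have Z : hol_disk o by move=> z _; exists 0; exact: cdiff_cst.
  have h : (h2norm2 o <= (0 ^+ 2)%:E)%E.
    by apply: h2norm2_bounded => // z _; rewrite cnorm0.
  split; first by split; [apply/holomorphic_onP|apply: le_lt_trans h (ltry _)].
  by apply: h2norm_le => //; apply: le_trans h _; rewrite lee_fin lerXn2r ?nnegrE.
apply: le_ereal_inf_tmp => _ [S _ <-].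
apply: le_trans (_ : (h2norm (fun z => (T o z - S o z)%R) <= _)%E).
  exact: sqrte_ge0.
by apply: ereal_sup_ubound; exists o.
Qed.

(** Telescoping: 1 / k^2 <= 2 / k - 2 / (k + 1) for k >= 1. *)
Lemma sum_inv_sq n : \sum_(1 <= k < n) (k%:R ^+ 2)^-1 <= 2 - 2 / n%:R :> R \/ (n <= 1)%N.
Proof.
elim: n => [|n [IH|n1]]; [by right| |].
  case: n IH => [|n] IH; first by right.
  left; rewrite big_nat_recr//=; apply: le_trans (lerD IH (lexx _)) _.
  have n0 : (0 : R) < n.+1%:R by rewrite ltr0n.
  have -> : n.+2%:R = n.+1%:R + 1 :> R by rewrite -natr1.
  have n1 : (1 : R) <= n.+1%:R by rewrite ler1n.
  move: (n.+1%:R : R) n0 n1 => x x0 x1.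
  rewrite -subr_ge0.
  have -> : 2 - 2 / (x + 1) - (2 - 2 / x + (x ^+ 2)^-1) = (x - 1) / (x ^+ 2 * (x + 1)).
    by field; lra.
  by rewrite divr_ge0 ?mulr_ge0 ?exprn_ge0//; lra.
case: n n1 => [|[|//]] _; first by right.
by left; rewrite big_nat1 expr1n invr1; lra.
Qed.

Theorem comp_op_schatten p : 0 < p -> schatten p (comp_op psi).
Proof.
(* N satisfies (N + 1) p >= 2, so that the p-th powers are at most a multiple of 1 / n^2. *)
move=> p0; pose N := Num.trunc (2 / p); have [D D0 HD] := approx_number_le N.
have Np : 2 <= N.+1%:R * p by rewrite -ler_pdivrMr//; exact/ltW/truncnS_gt.
have le n : (0 < n)%N -> ((approx_number (comp_op psi) n) `^ p <= (D `^ p * (n%:R ^+ 2)^-1)%:E)%E.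
  move=> n0; have n0' : (0 : R) < n%:R by rewrite ltr0n.
  have b0 : 0 <= D / n%:R ^+ N.+1 by rewrite divr_ge0 ?exprn_ge0.
  apply: (@le_trans _ _ ((D / n%:R ^+ N.+1)%:E `^ p)%E).
    apply: (gt0_ler_poweR (ltW p0)); rewrite ?in_itv/= ?leey ?andbT ?approx_number_ge0 ?lee_fin//.
    exact: HD.
  rewrite poweR_EFin lee_fin ler_pdivlMr ?exprn_gt0//.
  apply: (@le_trans _ _ ((D / n%:R ^+ N.+1) `^ p * (n%:R ^+ N.+1) `^ p)).
    rewrite ler_wpM2l ?powR_ge0// -!powR_mulrn ?(ltW n0')// -powRrM.
    by apply: ler_powR; rewrite ?ler1n.
  by rewrite -powRM ?exprn_ge0// divfK// expf_neq0// lt0r_neq0.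
rewrite /schatten; apply: le_lt_trans (ltry (D `^ p * 2)).
apply: lime_le; first by apply: is_cvg_nneseries => n _ _; exact: poweR_ge0.
apply: nearW => n.
apply: (@le_trans _ _ (\sum_(1 <= k < n) (D `^ p * (k%:R ^+ 2)^-1)%:E)%E).
  by rewrite !big_nat; apply: lee_sum => k /andP[k0 _]; exact: le.
rewrite sumEFin lee_fin -mulr_sumr ler_wpM2l ?powR_ge0//.
have [h|h] := sum_inv_sq n; last by rewrite big_geq.
by apply: le_trans h _; rewrite gerBl divr_ge0.
Qed.

End CompositionOperator.

Theorem theorem1p2 (R : realType) :
  (forall delta : R -> R,
      (forall h, 0 < h < 1 -> 0 < delta h < 1) ->
      (forall h1 h2, 0 < h1 -> h1 <= h2 -> h2 < 1 -> delta h1 <= delta h2) ->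
      exists phi : R[i] -> R[i],
        analytic_selfmap phi /\ pvalent 2 phi /\
        phi @` (@disk R) = [set w | @disk R w /\ w != 0] /\
        exists h0 : R, 0 < h0 < 1 /\
          forall h : R, 0 < h -> h <= h0 ->
            (circle_measure
               [set xi | exists L, radial_limit phi xi L /\ (1 - h <= cnorm L)%R]
             <= (delta h)%:E)%E)
  /\
  (exists psi : R[i] -> R[i],
      analytic_selfmap psi /\ psi @` (@disk R) = @disk R /\ pvalent 4 psi /\
      (forall f, H2 f -> H2 (comp_op psi f)) /\
      forall p : R, 0 < p -> schatten p (comp_op psi)).
Proof.
split; first exact: small_boundary_values.
have [psi [self im pv fast]] := fast_symbol R.
exists psi; do 3 (split; first by []); split=> [f|]; [exact: comp_op_H2|exact: comp_op_schatten].
Qed.
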